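(* Let $d\ge2$, $1\le k\le d+1$, and $\gamma=(\gamma_1,\dots,\gamma_{d+1-k})$ with $\gamma_j>-1$ (no $\gamma$ if $k=d+1$). Then: (i) $\langle\cdot,\cdot\rangle_{\gamma,-\mathbf 1_k}$ is an inner product on polynomials if all $\lambda,\lambda_i,\lambda_I$ occurring in it are positive, for $1\le k\le d$; for $k=d+1$ it is an inner product if all $\lambda_I>0$ and at least one $\lambda_{j,0}$ is positive. (ii) Under the conditions of (i), for each $n\ge0$, $\mathcal U_n^d(W_{\gamma,-\mathbf 1_k})$ is the space of orthogonal polynomials of degree $n$ with respect to $\langle\cdot,\cdot\rangle_{\gamma,-\mathbf 1_k}$ (i.e. the orthogonal complement of $\Pi_{n-1}^d$ in $\Pi_n^d$), where for $k=d+1$ one takes $\mathcal U_1^d(W_{-\mathbf 1})=\mathrm{span}\{x_1+c_1,\dots,x_d+c_d\}$ with $c_j=-\lambda_{j,0}/(\lambda_{0,0}+\lambda_{1,0}+\dots+\lambda_{d,0})$. (iii) For $k=1$ the sum $\mathcal U_n^d(W_{\gamma,-1})=x_{d+1}\mathcal V_{n-1}^d(W_{\gamma,1})+H^d_{n,\{d+1\}}(W_{(\gamma,0)})$ is orthogonal with respect to $\langle\cdot,\cdot\rangle_{\gamma,-1}$.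
   Context: Notation: $|x|=x_1+\dots+x_d$, $x_{d+1}:=1-|x|$, $T^d=\{x\in\mathbb R^d:x_i\ge0,1-|x|\ge0\}$, $\Pi_m^d$ polynomials of degree $\le m$, $e_0=0$, $e_i$ standard basis vectors; for $I\subset\{1,\dots,d+1\}$, $T_I=\{x\in T^d:x_i=0\ \forall i\in I\}$ with its Lebesgue measure in the remaining free coordinates; $\partial^I=\prod_{i\in I}\partial/\partial x_i$; $x^\gamma:=\prod_{i\le d+1-k}x_i^{\gamma_i}$; $x_J=\prod_{i\in J}x_i$. For parameters $>-1$, $\mathcal V_m^d(W_{\boldsymbol\varepsilon})$ is the space of polynomials of degree $m$ orthogonal in $L^2(\prod_{i=1}^{d+1}x_i^{\varepsilon_i},T^d)$ to $\Pi^d_{m-1}$; negative-index spaces are $\{0\}$. Face spaces $H_{m,S}^d(W_{\boldsymbol\varepsilon})$: choose $r\notin S$ ($r=d+1$ if $d+1\notin S$, else fixed in $\{1,..,d\}\setminus S$), $A=\{1,..,d+1\}\setminus(S\cup\{r\})$, $D_i=\partial_i-\partial_r$ ($\partial_{d+1}:=0$), $R_{\mathbf m}=\big(\prod_{i\in A\cup\{r\}}x_i^{-\varepsilon_i}\big)\prod_{i\in A}D_i^{m_i}\big[\big(\prod_{i\in A}x_i^{\varepsilon_i+m_i}\big)x_r^{\varepsilon_r+|\mathbf m|}\big]$, $H_{m,S}^d=\mathrm{span}\{R_{\mathbf m}:\mathbf m\in\mathbb N_0^A,|\mathbf m|=m\}$, and $H_{m,S}^d=\{0\}$ if $|S|\ge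 d$. Spaces $\mathcal U$: with $B=\{d-k+2,\dots,d+1\}$ and $\varepsilon^J$ ($J\subset B$) given by $\varepsilon^J_i=\gamma_i$ ($i\le d-k+1$), $1$ ($i\in J$), $0$ ($i\in B\setminus J$): $\mathcal U_0^d=\mathrm{span}\{1\}$; for $k\le d$, $n\ge1$: $\mathcal U_n^d(W_{\gamma,-\mathbf 1_k})=x_B\mathcal V_{n-k}^d(W_{\gamma,\mathbf 1_k})+\sum_{j=1}^{k-1}\sum_{J\subset B,|J|=j}x_JH^d_{n-j,B\setminus J}(W_{\varepsilon^J})+H^d_{n,B}(W_{(\gamma,\mathbf 0_k)})$; for $k=d+1$, $n\ge2$: $\mathcal U_n^d(W_{-\mathbf 1})=x_1\cdots x_{d+1}\mathcal V_{n-d-1}^d(W_{\mathbf 1})+\sum_{j=2}^d\sum_{|J|=j}x_JH^d_{n-j,\{1..d+1\}\setminus J}(W_{\varepsilon^J})$. Inner products ($\lambda$'s $\ge0$): for $k=1$: $\langle f,g\rangle_{\gamma,-1}=\sum_{i=1}^d\int_{T^d}x_i\partial_if\,\partial_ig\,x^\gamma dx+\lambda\int_{T_{\{d+1\}}}fg\,x_1^{\gamma_1}\cdots x_d^{\gamma_d}$, the last integral over $\{x_1+\dots+x_d=1\}$ in coordinates $(x_1,..,x_{d-1})$. For $2\le k\le d$, with $\mathbf m_k=\{d-k+2,\dots,d\}$: $\langle f,g\rangle_{\gamma,-\mathbf 1_k}=\int_{T^d}\partial^{\mathbf m_k}f\,\partial^{\mathbf m_k}g\,(1-|x|)^{k-2}x^\gamma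 dx+\sum_{i=1}^{k-2}\sum_{I\subset\mathbf m_k,|I|=i}\lambda_I\int_{T_{\mathbf m_k\setminus I}}\partial^If\,\partial^Ig\,(1-|x|)^{i-1}x^\gamma+\sum_{i=1}^{d-k+1}\lambda_i\int_{T_{\mathbf m_k}}x_i\partial_if\,\partial_ig\,x^\gamma+\lambda\int_{T_{\mathbf m_k\cup\{d+1\}}}fg\,x^\gamma$, where for $k=d$ the last term is replaced by $\lambda f(e_1)g(e_1)$. For $k=d+1$: $\langle f,g\rangle_{-\mathbf 1}=\int_{T^d}\partial^{\{1..d\}}f\,\partial^{\{1..d\}}g\,(1-|x|)^{d-1}dx+\sum_{i=1}^{d-1}\sum_{I\subset\{1..d\},|I|=i}\lambda_I\int_{T_{\{1..d\}\setminus I}}\partial^If\,\partial^Ig\,(1-|x|)^{i-1}+\sum_{j=0}^d\lambda_{j,0}f(e_j)g(e_j)$. *)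

(* Defs.v *)
From mathcomp Require Import all_boot all_order all_algebra.
From mathcomp Require Import mpoly.
From mathcomp Require Import all_classical all_reals all_analysis.
Import Order.TTheory GRing.Theory Num.Theory.

Set Implicit Arguments.
Unset Strict Implicit.
Unset Printing Implicit Defensive.

Local Open Scope ring_scope.

(*  - Polynomials in d variables: {mpoly R[d]}; the variable 'X_j (j : 'I_d)  *)
(*    is the coordinate x_{j+1}.                                              *)
(*  - Points of R^d: row vectors x : 'rV[R]_d, x_{j+1} = x ord0 j.            *)
(*  - Coordinate indices i in {1,...,d+1} are elements of 'I_d.+2 (the index  *)
(*    0 is never used); ord_max (value d+1) is the index of                  *)
(*    x_{d+1} = 1 - |x|.  Subsets I of {1,...,d+1} are {set 'I_d.+2}.        *)
(*  - Parameter families gamma, eps, lambda_i, lambda_{j,0} are nat -> R,     *)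
(*    indexed by the paper's indices.                                        *)

Section Simplex.
Variables (R : realType) (d : nat).
Local Notation poly := {mpoly R[d]}.
Local Notation pt := 'rV[R]_d.
Local Notation idx := 'I_d.+2.

Definition xv (x : pt) (i : idx) : R :=
  if i == ord_max then 1 - \sum_(j < d) x ord0 j
  else \sum_(j < d | j.+1 == i :> nat) x ord0 j.

Definition xc (i : idx) : poly :=
  if i == ord_max then 1 - \sum_(j < d) 'X_j
  else \sum_(j < d | j.+1 == i :> nat) 'X_j.

Definition xJ (J : {set idx}) : poly := \prod_(i in J) xc i.

(* partial derivative d/dx_i, with d/dx_{d+1} := 0 *)
Definition pd (i : idx) (p : poly) : poly :=
  \sum_(j < d | j.+1 == i :> nat) p^`M(j).

Definition pdI (I : {set idx}) (p : poly) : poly := foldr pd p (enum I).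

Definition ev (p : poly) (x : pt) : R := p.@[fun j => x ord0 j].

(* the vertex e_j (e_0 = 0) *)
Definition ept (j : nat) : pt := \row_l ((l.+1 == j)%:R).

Definition inPi (m : nat) (p : poly) : Prop := (msize p <= m.+1)%N.

(* integral over the scaled simplex {y in R^m : y_l >= 0, sum y <= s}
   (Lebesgue measure), written as iterated Lebesgue integrals *)
Fixpoint sint (m : nat) (s : R) (h : seq R -> R) : R :=
  match m with
  | 0 => h [::]
  | m'.+1 => Rintegral (@lebesgue_measure R) `[0, s]%classic
               (fun t => sint m' (s - t) (fun y => h (t :: y)))
  end.

Definition free (I : {set idx}) : seq 'I_d :=
  seq.filter (fun j : 'I_d => (inord j.+1 : idx) \notin I) (enum 'I_d).

Definition embed (fr : seq 'I_d) (y : seq R) : pt :=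
  \row_j (if j \in fr then nth 0 y (index j fr) else 0).

(* integral over T_I = {x in T^d : x_i = 0, i in I} w.r.t. the Lebesgue
   measure in its free coordinates; if d+1 in I, the face lies in
   {|x| = 1} and is parametrised by all free coordinates but the last one *)
Definition face_int (I : {set idx}) (g : pt -> R) : R :=
  let fr := free I in
  if ord_max \notin I then sint (size fr) 1 (fun y => g (embed fr y))
  else if fr is [::] then 0
  else sint (size fr).-1 1
         (fun y => g (embed fr (rcons y (1 - \sum_(t <- y) t)))).

Definition Tint (g : pt -> R) : R := face_int finset.set0 g.

Definition xgam (k : nat) (gam : nat -> R) (x : pt) : R :=
  \prod_(i : idx | (0 < i <= d.+1 - k)%N) powR (xv x i) (gam i).

Definition Wt (eps : nat -> R) (x : pt) : R :=
  \prod_(i : idx | (0 < i)%N) powR (xv x i) (eps i).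

Definition space := poly -> Prop.
Definition zsp : space := fun p => p = 0.
Definition sumsp (A B : space) : space :=
  fun p => exists a b, A a /\ B b /\ p = a + b.
Definition bigsum (l : seq space) : space := foldr sumsp zsp l.
Definition mulsp (q : poly) (A : space) : space :=
  fun p => exists a, A a /\ p = q * a.
Definition span (l : seq poly) : space :=
  fun p => exists c : seq R, p = \sum_(i < size l) c`_i *: l`_i.

Definition Vsp (eps : nat -> R) (m : nat) : space :=
  fun p => inPi m p /\
    forall q : poly, (msize q <= m)%N ->
      Tint (fun x => ev p x * ev q x * Wt eps x) = 0.

Definition Vn (eps : nat -> R) (j n : nat) : space :=
  if (j <= n)%N then Vsp eps (n - j) else zsp.

Definition rch (S : {set idx}) : idx :=
  if ord_max \notin S then ord_max
  else head ord_max (seq.filter (fun i : idx => (0 < i)%N && (i \notin S)) (enum idx)).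

Definition Aset (S : {set idx}) : {set idx} :=
  [set i : idx | [&& (0 < i)%N, i \notin S & i != rch S]].

(* the direction e_i (with e_{d+1} := 0) *)
Definition dirv (i : idx) : pt := \row_j ((j.+1 == i :> nat)%:R).

Definition Dop (S : {set idx}) (i : idx) (f : pt -> R) : pt -> R :=
  fun x => derive f x (dirv i - dirv (rch S)).

Definition mindex (S : {set idx}) (m : nat) (mv : {ffun idx -> 'I_m.+1}) : bool :=
  [forall i, (i \notin Aset S) ==> (mv i == 0 :> nat)] &&
  (\sum_(i : idx) (mv i : nat) == m)%N.

(* the Rodrigues-type function R_m (as a real function on R^d) *)
Definition Rod (eps : nat -> R) (S : {set idx}) (m : nat)
    (mv : {ffun idx -> 'I_m.+1}) : pt -> R :=
  let r := rch S in
  let A := Aset S in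
  let base := fun y => (\prod_(i in A) powR (xv y i) (eps i + (mv i : nat)%:R))
                       * powR (xv y r) (eps r + m%:R) in
  fun x => (\prod_(i in r |: A) powR (xv x i) (- eps i)) *
           (foldr (fun i f => iter (mv i) (Dop S i) f) base (enum A)) x.

Definition interior_T (x : pt) : Prop :=
  (forall j, 0 < x ord0 j) /\ 0 < 1 - \sum_(j < d) x ord0 j.

(* H_{m,S}^d(W_eps) = span{R_m : |m| = m} (as polynomials; the functions R_m
   are identified with polynomials on the interior of T^d); {0} if |S| >= d *)
Definition Hsp (eps : nat -> R) (m : nat) (S : {set idx}) : space :=
  fun p => if (d <= #|S|)%N then p = 0 else
    exists c : {ffun {ffun idx -> 'I_m.+1} -> R},
      forall x, interior_T x ->
        ev p x = \sum_(mv | mindex S mv) c mv * Rod eps S mv x.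

Definition Hn (eps : nat -> R) (j n : nat) (S : {set idx}) : space :=
  if (j <= n)%N then Hsp eps (n - j) S else zsp.

Definition epsJ (k : nat) (gam : nat -> R) (J : {set idx}) : nat -> R :=
  fun i => if (i <= d.+1 - k)%N then gam i
           else if [exists j in J, (j : nat) == i] then 1 else 0.

Definition Bset (k : nat) : {set idx} := [set i : idx | (d.+2 - k <= i)%N].

Definition Usp (k : nat) (gam : nat -> R) (lam0 : nat -> R) (n : nat) : space :=
  let B := Bset k in
  if n == 0%N then span [:: 1]
  else if (k <= d)%N then
    bigsum ([:: mulsp (xJ B) (Vn (epsJ k gam B) k n)] ++
            [seq mulsp (xJ J) (Hn (epsJ k gam J) #|J| n (B :\: J))
               | J <- enum [set J : {set idx} |
                              (J \subset B) && (1 <= #|J| <= k.-1)%N]] ++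
            [:: Hsp (epsJ k gam finset.set0) n B])
  else
    if n == 1%N then
      span [seq xc (inord j) +
                (- lam0 j / (\sum_(l < d.+1) lam0 l))%:MP | j <- iota 1 d]
    else
      bigsum ([:: mulsp (xJ B) (Vn (epsJ k gam B) d.+1 n)] ++
              [seq mulsp (xJ J) (Hn (epsJ k gam J) #|J| n (B :\: J))
                 | J <- enum [set J : {set idx} |
                                (J \subset B) && (2 <= #|J| <= d)%N]]).

Definition mkset (k : nat) : {set idx} := [set i : idx | (d.+2 - k <= i <= d)%N].
Definition Dset : {set idx} := [set i : idx | (0 < i <= d)%N].

Definition ipk (k : nat) (gam : nat -> R) (lam : R) (lami : nat -> R)
    (lamI : {set idx} -> R) (lam0 : nat -> R) (p q : poly) : R :=
  if k == 1%N then
    \sum_(i : idx | (0 < i <= d)%N)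
       Tint (fun x => xv x i * ev (pd i p) x * ev (pd i q) x * xgam 1 gam x)
    + lam * face_int [set ord_max] (fun x => ev p x * ev q x * xgam 1 gam x)
  else if (k <= d)%N then
    let mk := mkset k in
    Tint (fun x => ev (pdI mk p) x * ev (pdI mk q) x
                   * xv x ord_max ^+ (k - 2) * xgam k gam x)
    + \sum_(I : {set idx} | (I \subset mk) && (1 <= #|I| <= k - 2)%N)
        lamI I * face_int (mk :\: I)
          (fun x => ev (pdI I p) x * ev (pdI I q) x
                    * xv x ord_max ^+ (#|I| - 1) * xgam k gam x)
    + \sum_(i : idx | (0 < i <= d.+1 - k)%N)
        lami i * face_int mk
          (fun x => xv x i * ev (pd i p) x * ev (pd i q) x * xgam k gam x)
    + (if k == d then lam * ev p (ept 1) * ev q (ept 1)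
       else lam * face_int (ord_max |: mk)
                    (fun x => ev p x * ev q x * xgam k gam x))
  else
    Tint (fun x => ev (pdI Dset p) x * ev (pdI Dset q) x
                   * xv x ord_max ^+ (d - 1))
    + \sum_(I : {set idx} | (I \subset Dset) && (1 <= #|I| <= d - 1)%N)
        lamI I * face_int (Dset :\: I)
          (fun x => ev (pdI I p) x * ev (pdI I q) x
                    * xv x ord_max ^+ (#|I| - 1))
    + \sum_(j < d.+1) lam0 j * ev p (ept j) * ev q (ept j).

Definition pos_cond (k : nat) (lam : R) (lami : nat -> R)
    (lamI : {set idx} -> R) (lam0 : nat -> R) : Prop :=
  if (k <= d)%N then
    [/\ 0 < lam,
        (1 < k)%N -> forall i : nat, (1 <= i <= d.+1 - k)%N -> 0 < lami i &
        forall I : {set idx}, I \subset mkset k ->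
          (1 <= #|I| <= k - 2)%N -> 0 < lamI I]
  else
    [/\ forall I : {set idx}, I \subset Dset ->
          (1 <= #|I| <= d - 1)%N -> 0 < lamI I,
        forall j : nat, (j <= d)%N -> 0 <= lam0 j &
        exists j : nat, (j <= d)%N /\ 0 < lam0 j].

Definition is_inner_product (ip : poly -> poly -> R) : Prop :=
  [/\ forall p q, ip p q = ip q p,
      forall (a : R) p q r, ip (a *: p + q) r = a * ip p r + ip q r &
      forall p, p != 0 -> 0 < ip p p].

Definition OPn (ip : poly -> poly -> R) (n : nat) : space :=
  fun p => inPi n p /\ forall q : poly, (msize q <= n)%N -> ip p q = 0.

End Simplex.

(* Main.v *)
(** Write polynomials on the simplex as images under [rho] of homogeneous
    polynomials in barycentric variables X_1, ..., X_{d+1} (plus a dummy X_0 sent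
    to 0), rho (X_1 + ... + X_{d+1}) = 1.  With
      lap e = sum_i X_i d_i^2 + (e_i + 1) d_i,
    the orthogonal polynomials of degree n for the weight prod x_i^(e_i) are the
    images of the homogeneous polynomials of degree n killed by [lap e], even if
    some e_i = -1, where the weight degenerates to a measure on the face x_i = 0.
    Every term of the inner product is a face integral of two derivatives, and
    D_i = d_i - d_{d+1} intertwines [lap e] with the operator for the parameters
    raised by one at i and d+1; hence each term kills pairs [lap e0]-harmonic of
    different degrees, e0 = (gamma, -1, ..., -1), and a Fischer decomposition
    turns this into a description of the orthogonal polynomials.  Definiteness
    follows by downward induction on |I|: the term of I shows that partial^I f,
    which no longer depends on the other coordinates of m_k, vanishes.
    The Rodrigues polynomials span the harmonic polynomials that do not involve
    the variables of S.  Finally, [lap e0] does not mix monomials in which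
    different sets J of the last k variables occur, and X_J h is harmonic for e0
    iff h is harmonic for the parameters raised to 1 on J, which is the
    decomposition defining U_n.  Part (iii) is Green's formula for [lap e]. *)
Require Import Defs.
From mathcomp Require Import all_boot all_order all_algebra.
From mathcomp Require Import ssrcomplements mpoly.
From mathcomp Require Import all_classical all_reals all_analysis.
From mathcomp Require Import measurable_realfun.
From mathcomp Require Import ring lra zify.
Import Order.TTheory GRing.Theory Num.Theory.
Import numFieldNormedType.Exports.
Local Open Scope ring_scope.

Set Implicit Arguments.
Unset Strict Implicit.
Unset Printing Implicit Defensive.

(** * Harmonic polynomials for the operator [lap] *)

Section RisingFactorial.
Variable R : realFieldType.

(** Homogeneous lifts make the degree an eigenvalue of the Euler operator, so two Green formulas
    subtract to orthogonality between degrees. Green's formula is never proved on integrals, where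
    parameters near -1 make boundary terms delicate: integrals are first reduced to moments by Beta
    recursions, and integration by parts becomes the recursion of rising factorials, valid for every
    parameter, -1 included. A degenerate parameter acts through one factor in the coefficients of
    [lap e], (m + 1)(m + 1 + e), which for e = -1 vanishes at m = 0 and so decouples monomials by
    the set of such variables they contain. Splitting off a multiple of [sX] in degree n + 1 needs
    2n + sum (e_i + 1) > 0. For [e0] this fails only for linear forms with k = d + 1, which are then
    all harmonic; there the vertex values no longer separate degrees 1 and 0, and the c_j are fixed
    by asking that the weighted vertex values of x_j + c_j sum to 0. The sets J with |B minus J| >=
    d, where H is {0} by convention, could contribute at most pure powers of one variable, and the
    coefficients of these in a harmonic polynomial vanish. *)

Definition rf (x : R) (k : nat) : R := \prod_(j < k) (x + j%:R).

Lemma rf0 x : rf x 0 = 1. Proof. by rewrite /rf big_ord0. Qed.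

Lemma rfS x k : rf x k.+1 = rf x k * (x + k%:R).
Proof. by rewrite /rf big_ord_recr. Qed.

Lemma rfSl x k : rf x k.+1 = x * rf (x + 1) k.
Proof.
rewrite /rf big_ord_recl addr0; congr (_ * _); apply: eq_bigr => j _.
by rewrite /= /bump /= natrD; ring.
Qed.

Lemma rf_gt0 x k : 0 < x -> 0 < rf x k.
Proof.
by move=> x0; apply: prodr_gt0 => j _; apply: ltr_wpDr; rewrite ?ler0n.
Qed.

End RisingFactorial.

Section LinearForms.
Variables (R : realFieldType) (n : nat).
Local Notation Q := {mpoly R[n]}.
Implicit Types (p q : Q) (m : 'X_{1..n}).

Lemma mpoly_lin_ind (K : Q -> Prop) :
  (forall m, K 'X_[m]) -> (forall c p, K p -> K (c *: p)) ->
  (forall p q, K p -> K q -> K (p + q)) -> forall p, K p.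
Proof.
move=> KX KZ KD p; rewrite [p]mpolyE; elim: (msupp p) => [|m s IHs].
  by rewrite big_nil -(scale0r 'X_[0%MM]); exact/KZ/KX.
by rewrite big_cons; apply: KD => //; exact/KZ/KX.
Qed.

Definition linform (w : 'X_{1..n} -> R) p : R :=
  \sum_(m <- msupp p) p@_m * w m.

(** An index set that depends only on a size bound lets the sums for [p], [q] and [p + q] be added
    term by term; their supports differ. *)
Lemma linformE w p k : (msize p <= k)%N ->
  linform w p = \sum_(m : 'X_{1..n < k}) p@_m * w m.
Proof.
move=> le_pk; set I : subFinType _ := 'X_{1..n < k}.
rewrite /linform (big_mksub I) ?msupp_uniq //=; last first.
  by move=> x /msize_mdeg_lt /leq_trans; apply.
rewrite big_rmcond //= => j /memN_msupp_eq0 ->.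
by rewrite mul0r.
Qed.

Lemma linformD w : {morph linform w : p q / p + q}.
Proof.
move=> p q; set k := maxn (msize p) (msize q).
have le_k : (msize (p + q) <= k)%N by exact: msizeD_le.
rewrite (linformE w le_k) (linformE w (leq_maxl _ _ : _ <= k)%N).
rewrite (linformE w (leq_maxr _ _ : _ <= k)%N) -big_split.
by apply: eq_bigr => m _; rewrite mcoeffD mulrDl.
Qed.

Lemma linformZ w c p : linform w (c *: p) = c * linform w p.
Proof.
rewrite (linformE w (msizeZ_le p c)) (linformE w (leqnn _)) mulr_sumr.
by apply: eq_bigr => m _; rewrite mcoeffZ mulrA.
Qed.

Lemma linform0 w : linform w 0 = 0.
Proof. by rewrite -(scale0r 0) linformZ mul0r. Qed.

Lemma linformN w p : linform w (- p) = - linform w p.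
Proof. by rewrite -scaleN1r linformZ mulN1r. Qed.

Lemma linformB w p q : linform w (p - q) = linform w p - linform w q.
Proof. by rewrite linformD linformN. Qed.

Lemma linform_sum w (I : Type) (r : seq I) (P : pred I) (F : I -> Q) :
  linform w (\sum_(i <- r | P i) F i) = \sum_(i <- r | P i) linform w (F i).
Proof. by apply: big_morph; [exact: linformD|exact: linform0]. Qed.

Lemma linformX w m : linform w 'X_[m] = w m.
Proof. by rewrite /linform msuppX big_seq1 mcoeffX eqxx mul1r. Qed.

Lemma mcoeff_XM i p m :
  ('X_i * p)@_m = if (0 < m i)%N then p@_(m - U_(i))%MM else 0.
Proof.
case: ifPn => mi.
  have le_m : (U_(i) <= m)%MM by rewrite lep1mP -lt0n.
  by rewrite mulrC -{1}(submK le_m) addmC mcoeffMX.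
elim/mpoly_lin_ind: p => [k|c p IH|p q IHp IHq].
- rewrite -mpolyXD mcoeffX; case: eqP => // /mnmP /(_ i) E.
  by move: mi; rewrite -E mnmDE mnm1E eqxx.
- by rewrite -scalerAr mcoeffZ IH mulr0.
- by rewrite mulrDr mcoeffD IHp IHq addr0.
Qed.

Definition lap (e : 'I_n -> R) p : Q :=
  \sum_i ('X_i * p^`M(i)^`M(i) + (e i + 1) *: p^`M(i)).

Lemma lapD e : {morph lap e : p q / p + q}.
Proof.
move=> p q; rewrite /lap -big_split; apply: eq_bigr => i _.
by rewrite !mderivD mulrDr scalerDr addrACA.
Qed.

Lemma lapZ e c p : lap e (c *: p) = c *: lap e p.
Proof.
rewrite /lap scaler_sumr; apply: eq_bigr => i _.
by rewrite !mderivZ scalerDr -scalerAr !scalerA [(e i + 1) * c]mulrC.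
Qed.

Lemma lap0 e : lap e 0 = 0.
Proof. by rewrite -(scale0r 0) lapZ !scale0r. Qed.

Lemma lapN e p : lap e (- p) = - lap e p.
Proof. by rewrite -scaleN1r lapZ scaleN1r. Qed.

Lemma lapB e p q : lap e (p - q) = lap e p - lap e q.
Proof. by rewrite lapD lapN. Qed.

(** For e i = -1 the factor is (m i)(m i + 1), which vanishes when X_i does not occur in m. Most
    arguments about degenerate parameters read off this factor. *)
Lemma mcoeff_lap e p m :
  (lap e p)@_m =
  \sum_i (m i).+1%:R * ((m i)%:R + 1 + e i) * p@_(m + U_(i))%MM.
Proof.
rewrite /lap raddf_sum; apply: eq_bigr => i _ /=.
rewrite mcoeffD mcoeffZ mcoeff_XM !mcoeff_deriv.
case: ifPn => mi; last first.
  by have -> : m i = 0%N by [move: mi; case: (m i)|]; ring.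
rewrite submK ?lep1mP -?lt0n// mnmBE mnm1E eqxx subn1 prednK//.
rewrite -mulrnA -(mulr_natr _ (_ * _)) -(mulr_natr _ (m i).+1) natrM.
by rewrite -(natr1 (m i)); ring.
Qed.

Definition euler p : Q := \sum_i 'X_i * p^`M(i).

Lemma euler_homog k p : p \is k.-homog -> euler p = k%:R *: p.
Proof.
move=> /dhomogP hp; rewrite [in LHS](mpolyE p) [in RHS](mpolyE p) scaler_sumr.
rewrite /euler (eq_bigr (fun i => \sum_(m <- msupp p)
    (p@_m * (m i)%:R) *: 'X_[m])) => [|i _]; last first.
  rewrite raddf_sum mulr_sumr; apply: eq_bigr => m _ /=.
  rewrite mderivZ mderivX -!scalerAr scalerA -mpolyXD.
  have [m0|m0] := posnP (m i); first by rewrite m0 mulr0 !scale0r.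
  by rewrite addmC submK// lep1mP -lt0n.
rewrite exchange_big big_seq [RHS]big_seq; apply: eq_bigr => m /hp <-.
by rewrite -scaler_suml -mulr_sumr -natr_sum -mdegE scalerA mulrC.
Qed.

Definition sX : Q := \sum_i 'X_i.

Lemma dhomogU i : ('X_i : Q) \is 1.-homog.
Proof. by rewrite dhomogX; apply/eqP; exact: mdeg1. Qed.

Lemma sX_homog : sX \is 1.-homog.
Proof. by apply: rpred_sum => i _; exact: dhomogU. Qed.

Lemma mderiv_homog k i p : p \is k.+1.-homog -> p^`M(i) \is k.-homog.
Proof.
move=> /dhomogP hp; apply/dhomogP => m.
rewrite mcoeff_msupp mcoeff_deriv => nz.
suff /hp : (m + U_(i))%MM \in msupp p.
  by rewrite [LHS]mdegD mdeg1 addn1 => -[].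
by rewrite mcoeff_msupp; apply: contraNneq nz => ->; rewrite mul0rn.
Qed.

Lemma dhomog0_const p : p \is 0.-homog -> p = (p@_0%MM)%:MP.
Proof.
move=> hp; apply/mpolyP => m; rewrite mcoeffC.
have [->|m0] := eqVneq m 0%MM; first by rewrite mulr1.
by rewrite mulr0; apply: (dhomog_nemf_coeff hp); rewrite mdeg_eq0.
Qed.

Lemma mderiv_homog0 i p : p \is 0.-homog -> p^`M(i) = 0.
Proof. by move/dhomog0_const => ->; rewrite mderivC. Qed.

Lemma mderivXU i j : ('X_j : Q)^`M(i) = (j == i)%:R%:MP.
Proof.
rewrite mderivX mnm1E; have [->|] := eqVneq j i; last by rewrite scale0r mpolyC0.
by rewrite scale1r -{1}(add0m U_(i)%MM) addmK mpolyX0 mpolyC1.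
Qed.

Lemma mderiv_sum i (I : Type) (r : seq I) (P : pred I) (F : I -> Q) :
  (\sum_(j <- r | P j) F j)^`M(i) = \sum_(j <- r | P j) (F j)^`M(i).
Proof. by rewrite raddf_sum. Qed.

Lemma lap_homog e k p : p \is k.+1.-homog -> lap e p \is k.-homog.
Proof.
move=> hp; apply: rpred_sum => i _; apply: rpredD; last first.
  exact/rpredZ/mderiv_homog.
case: k hp => [|k] hp; last exact/(dhomogM (dhomogU i))/mderiv_homog/mderiv_homog.
by rewrite (mderiv_homog0 i (mderiv_homog i hp)) mulr0 rpred0.
Qed.

Lemma lap_homog0 e p : p \is 0.-homog -> lap e p = 0.
Proof.
move=> hp; rewrite /lap big1// => i _.
by rewrite (mderiv_homog0 i hp) mderiv0 mulr0 scaler0 addr0.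
Qed.

(** An sl2 relation: the commutator of [lap e] with multiplication by [sX] is twice the Euler
    operator plus the sum of the e i + 1, and on degree k the Euler operator is the scalar k. *)
Lemma lap_sX e k p : p \is k.-homog ->
  lap e (sX * p) = sX * lap e p + ((k + k)%:R + \sum_i (e i + 1)) *: p.
Proof.
move=> hp.
have dsX i : sX^`M(i) = 1.
  rewrite /sX raddf_sum (bigD1 i)//= mderivXU eqxx big1 => [|j ij].
    by rewrite addr0 mpolyC1.
  by rewrite mderivXU (negbTE ij) mpolyC0.
have d1 i : (1 : Q)^`M(i) = 0 by rewrite -mpolyC1 mderivC.
(* The two copies of k are turned back into Euler operators, so that the identity holds index by
   index. *)
rewrite natrD 2!scalerDl -!(euler_homog hp) /euler /lap mulr_sumr scaler_suml.
rewrite -!big_split /=; apply: eq_bigr => i _.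
rewrite !mderivM dsX !mderivD !mderivM dsX d1 -!mul_mpolyC; ring.
Qed.

(** Applying [lap e] to the equation and putting t = lap e s gives, by [lap_sX], an equation of the
    same shape for t in degree one less, with right side lap e p and with q increased by 2 deg t +
    sum (e i + 1), hence still positive. Then s = (p - sX t) / q. *)
Lemma lap_Fischer_onto e k (q : R) p : 0 <= \sum_i (e i + 1) -> 0 < q ->
  p \is k.-homog -> exists2 s, s \is k.-homog & sX * lap e s + q *: s = p.
Proof.
move=> c0; elim: k => [|k IHk] in q p *.
  move=> q0 hp; exists (q^-1 *: p); first exact: rpredZ.
  by rewrite lapZ lap_homog0// scaler0 mulr0 add0r scalerA divff ?scale1r// gt_eqF.
move=> q0 hp.
have q'0 : 0 < (k + k)%:R + \sum_i (e i + 1) + q.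
  by rewrite ltr_wpDl// addr_ge0// ler0n.
have [s hs sE] := IHk _ (lap e p) q'0 (lap_homog e hp).
have hs1 : sX * s \is k.+1.-homog by exact: dhomogM sX_homog hs.
exists (q^-1 *: (p - sX * s)); first exact/rpredZ/rpredB.
rewrite lapZ lapB (lap_sX e hs) -sE scalerDl -!mul_mpolyC.
have : q%:MP_[n] * q^-1%:MP = 1 by rewrite -rmorphM divff ?gt_eqF.
by move: (q%:MP_[n]) (q^-1%:MP_[n]) => a b ab; ring: ab.
Qed.

Definition harm e k p : Prop := p \is k.-homog /\ lap e p = 0.

(** By [lap_sX], harmonicity of p - sX s is the equation of [lap_Fischer_onto] with right side lap e
    p and q = 2k + sum (e i + 1); the hypotheses on [e] and [k] make this q positive. *)
Lemma Fischer e k p : 0 <= \sum_i (e i + 1) ->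
  (0 < k)%N || (0 < \sum_i (e i + 1)) ->
  p \is k.+1.-homog -> exists2 s, s \is k.-homog & harm e k.+1 (p - sX * s).
Proof.
move=> c0 kc hp.
have q0 : 0 < (k + k)%:R + \sum_i (e i + 1).
  case/orP: kc => [k0|c1]; last by rewrite ltr_wpDl.
  by rewrite ltr_wpDr// ltr0n addn_gt0 k0.
have [s hs sE] := lap_Fischer_onto c0 q0 (lap_homog e hp).
exists s => //; split; last by rewrite lapB (lap_sX e hs) sE subrr.
exact/rpredB/(dhomogM sX_homog hs).
Qed.

(* Up to the factor rf (sum (e i + 1)) (mdeg m), these are the moments of the
   Dirichlet distribution.  If e i = -1 they vanish as soon as 0 < m i, so that
   Phi e only sees the face x_i = 0. *)
Definition mom (e : 'I_n -> R) m : R := \prod_i rf (e i + 1) (m i).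
Definition Phi e := linform (mom e).

Lemma mom_U e m i : mom e (m + U_(i))%MM = mom e m * (e i + 1 + (m i)%:R).
Proof.
rewrite /mom (bigD1 i)//= (bigD1 i (P := predT))//= mnmDE mnm1E eqxx addn1 rfS.
rewrite (eq_bigr (fun j => rf (e j + 1) (m j))) => [|j ji]; first ring.
by rewrite mnmDE mnm1E eq_sym (negbTE ji) addn0.
Qed.

(** With [mom e] read as the moments of independent gamma variables, this is integration by parts
    against t^(e i) exp(-t). On monomials it is the recursion of the rising factorial, so it needs
    no condition on the parameters. *)
Lemma Phi_ibp e i p : Phi e ('X_i * p^`M(i) + (e i + 1) *: p) = Phi e ('X_i * p).
Proof.
rewrite /Phi; elim/mpoly_lin_ind: p => [m|c p IH|p q IHp IHq].
- rewrite linformD linformZ mderivX -!scalerAr linformZ -!mpolyXD !linformX.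
  rewrite [(U_(i) + m)%MM]addmC mom_U.
  have [m0|m0] := posnP (m i); first by rewrite m0; ring.
  by rewrite addmC submK ?lep1mP -?lt0n//; ring.
- rewrite mderivZ (_ : _ + _ = c *: ('X_i * p^`M(i) + (e i + 1) *: p)).
    by rewrite -scalerAr !linformZ IH.
  by rewrite -!mul_mpolyC; ring.
- rewrite mderivD !mulrDr scalerDr addrACA linformD IHp IHq.
  by rewrite linformD.
Qed.

(** For each i, [Phi_ibp] is applied to q times the i-th partial derivative of p. The Euler term is
    the trace of the factor exp(-t) in the gamma densities. *)
Lemma Phi_green e p q : Phi e (lap e p * q) =
  Phi e (q * euler p) - Phi e (\sum_i 'X_i * p^`M(i) * q^`M(i)).
Proof.
rewrite -[RHS]linformB /lap /euler mulr_suml mulr_sumr -sumrB /Phi !linform_sum.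
apply: eq_bigr => i _.
have := Phi_ibp e i (q * p^`M(i)); rewrite /Phi mderivM => H.
rewrite linformB mulrCA -H -linformB; congr linform.
by rewrite -!mul_mpolyC; ring.
Qed.

(** The gradient term of [Phi_green] is symmetric in p and q, so the two versions of the formula
    differ by (k - l) Phi e (p q), which must be 0. *)
Lemma harm_orth e k l p q : harm e k p -> harm e l q -> k != l -> Phi e (p * q) = 0.
Proof.
move=> [hp Lp] [hq Lq] kl.
have := Phi_green e p q; have := Phi_green e q p.
rewrite Lp Lq !mul0r (euler_homog hp) (euler_homog hq) -!scalerAr /Phi.
rewrite linform0 !linformZ => H1 H2.
have S : \sum_i 'X_i * q^`M(i) * p^`M(i) = \sum_i 'X_i * p^`M(i) * q^`M(i).
  by apply: eq_bigr => i _; ring.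
rewrite S [q * p]mulrC in H1 H2; apply/eqP.
have : (k%:R - l%:R) * linform (mom e) (p * q) == 0 by apply/eqP; lra.
by rewrite mulf_eq0 subr_eq0 eqr_nat (negbTE kl).
Qed.

Definition eU (e : 'I_n -> R) i r : 'I_n -> R :=
  fun j => e j + (j == i)%:R + (j == r)%:R.

Definition Dd i r p : Q := p^`M(i) - p^`M(r).

(** Since d_l X_l = X_l d_l + 1, commuting d_l past [lap e] costs d_l^2. The difference of the
    costs, d_i^2 - d_r^2 = (d_i + d_r)(d_i - d_r), is absorbed by raising the parameters at i and r
    by one. *)
Lemma lap_Dd e i r p : i != r -> lap (eU e i r) (Dd i r p) = Dd i r (lap e p).
Proof.
move=> ir; rewrite /lap [RHS]/Dd !mderiv_sum -sumrB.
have dd j l : (('X_j * p^`M(j)^`M(j) + (e j + 1) *: p^`M(j)))^`M(l) =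
   (j == l)%:R%:MP * p^`M(j)^`M(j) + 'X_j * p^`M(l)^`M(j)^`M(j)
    + (e j + 1) *: p^`M(l)^`M(j).
  rewrite mderivD mderivM mderivZ mderivXU.
  by rewrite [p^`M(j)^`M(j)^`M(l)]mderiv_comm [p^`M(j)^`M(l)]mderiv_comm.
under [RHS]eq_bigr do rewrite !dd.
pose T j := p^`M(i)^`M(j) - p^`M(r)^`M(j).
transitivity (\sum_j ('X_j * (p^`M(i)^`M(j)^`M(j) - p^`M(r)^`M(j)^`M(j))
   + (e j + 1) *: T j) + (\sum_j ((j == i)%:R *: T j) + \sum_j ((j == r)%:R *: T j))).
  rewrite -!big_split; apply: eq_bigr => j _ /=.
  rewrite !mderivB /eU -/(T j) -!mul_mpolyC !mpolyCD; ring.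
have sumd l (F : 'I_n -> Q) : \sum_j ((j == l)%:R *: F j) = F l.
  rewrite (bigD1 l)//= eqxx scale1r big1 ?addr0// => j /negbTE ->.
  exact: scale0r.
rewrite !sumd; transitivity (\sum_j ('X_j * (p^`M(i)^`M(j)^`M(j) - p^`M(r)^`M(j)^`M(j))
   + (e j + 1) *: T j) + (\sum_j ((j == i)%:R *: p^`M(j)^`M(j)) - \sum_j ((j == r)%:R *: p^`M(j)^`M(j)))).
  rewrite !sumd /T [p^`M(r)^`M(i)]mderiv_comm; ring.
rewrite -sumrB -big_split; apply: eq_bigr => j _ /=.
rewrite /T -!mul_mpolyC; ring.
Qed.

(* The Rodrigues step W^-1 D_i (x_i x_r W p), W = prod_j x_j^(e j). *)
Definition raise (e : 'I_n -> R) i r p : Q :=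
  'X_i * 'X_r * Dd i r p + ((e i + 1) *: 'X_r - (e r + 1) *: 'X_i) * p.

Lemma raise_sum e i r (F : 'I_n -> Q) :
  raise e i r (\sum_j F j) = \sum_j raise e i r (F j).
Proof.
rewrite /raise /Dd !mderiv_sum -sumrB !mulr_sumr -big_split; exact: eq_bigr.
Qed.

(** For j other than i and r the j-th summand of [lap] commutes with [raise]; only the summands i
    and r mix, and for their sum the claim is a polynomial identity. *)
Lemma lap_raise e i r p : i != r ->
  lap e (raise e i r p) = raise e i r (lap (eU e i r) p).
Proof.
move=> ir; rewrite /lap raise_sum (bigD1 i)//= (bigD1 r) 1?eq_sym//=.
rewrite [RHS](bigD1 i)//= [X in _ = _ + X](bigD1 r) 1?eq_sym//= !addrA.
have ri : r == i = false by apply: negbTE; rewrite eq_sym.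
have C q j l : q^`M(j)^`M(l) = q^`M(l)^`M(j) by rewrite mderiv_comm.
congr (_ + _); last first.
  apply: eq_bigr => j /andP[/negbTE ji /negbTE jr].
  rewrite /raise /Dd /eU ji jr !addr0 -!mul_mpolyC.
  rewrite !(mderivD, mderivB, mderivN, mderivM, mderivXU, mderivC) ![_ == j]eq_sym ji jr.
  rewrite (C _ i j) (C _ r j) (C _ i j) (C _ r j) !mpolyC0; ring.
rewrite /raise /Dd /eU !eqxx ri (negbTE ir) !addr0 -!mul_mpolyC.
rewrite !(mderivD, mderivB, mderivN, mderivM, mderivXU, mderivC) ri (negbTE ir) !eqxx.
rewrite !(C _ r i) !mpolyC0 !mpolyCD !mpolyC1; ring.
Qed.

Lemma harm_raise e i r k p : i != r -> harm (eU e i r) k p ->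
  harm e k.+1 (raise e i r p).
Proof.
move=> ir [hp Lp]; split; last first.
  rewrite lap_raise// Lp /raise /Dd !mderiv0 subrr; ring.
have hl c c' : c *: 'X_r - c' *: 'X_i \is [in R[n], 1.-homog].
  by apply: rpredB; exact/rpredZ/dhomogU.
apply: rpredD; last exact: (dhomogM (hl _ _) hp).
case: k hp {Lp} => [|k] hp.
  by rewrite /Dd !mderiv_homog0// subrr mulr0 rpred0.
apply: (dhomogM (d := 2) (e := k)); first exact: (dhomogM (dhomogU i) (dhomogU r)).
by apply: rpredB; exact: mderiv_homog.
Qed.

Lemma harm_Dd e i r k p : i != r -> harm e k.+1 p -> harm (eU e i r) k (Dd i r p).
Proof.
move=> ir [hp Lp]; split; last by rewrite lap_Dd// Lp /Dd !mderiv0 subrr.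
by apply: rpredB; exact: mderiv_homog.
Qed.

Lemma harmD e k p q : harm e k p -> harm e k q -> harm e k (p + q).
Proof.
by move=> [hp Lp] [hq Lq]; split; [exact: rpredD|rewrite lapD Lp Lq addr0].
Qed.

Lemma harmZ e k c p : harm e k p -> harm e k (c *: p).
Proof. by move=> [hp Lp]; split; [exact: rpredZ|rewrite lapZ Lp scaler0]. Qed.

Lemma harm_0 e k : harm e k 0.
Proof. by split; [exact: rpred0|exact: lap0]. Qed.

Lemma harm_sum e k (I : Type) (r : seq I) (P : pred I) (F : I -> Q) :
  (forall i, P i -> harm e k (F i)) -> harm e k (\sum_(i <- r | P i) F i).
Proof.
move=> h; elim/big_ind: _ => //; [exact: harm_0|exact: harmD].
Qed.

Lemma harm_coeff e k p m : harm e k p ->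
  \sum_i (m i).+1%:R * ((m i)%:R + 1 + e i) * p@_(m + U_(i))%MM = 0.
Proof. by move=> [_ Lp]; rewrite -mcoeff_lap Lp mcoeff0. Qed.

(* The coefficient of lap e p at m gives p@_(m + U_(r)) from coefficients with
   fewer factors X_r. *)
Lemma harm_eq0 e k r p : 0 < e r + 1 -> harm e k p ->
  (forall m, m r = 0%N -> p@_m = 0) -> p = 0.
Proof.
move=> er hp p0; apply/mpolyP => m; rewrite mcoeff0.
elim: {m}(m r) {-2}m (erefl (m r)) => [|l IHl] m ml; first exact: p0.
have le_m : (U_(r) <= m)%MM by rewrite lep1mP ml.
have m'l : (m - U_(r))%MM r = l by rewrite mnmBE mnm1E eqxx ml subn1.
have := harm_coeff (m - U_(r))%MM hp.
rewrite (bigD1 r)//= big1 => [|i ir]; last first.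
  by rewrite IHl ?mulr0// mnmDE mnm1E (negbTE ir) addn0.
rewrite submK// addr0 => /eqP; rewrite mulf_eq0 mulf_eq0 pnatr_eq0 /=.
case/orP => /eqP // H; exfalso; move: er.
have : 0 <= ((m - U_(r))%MM r)%:R :> R by rewrite ler0n.
lra.
Qed.

(** Read harmonicity at the monomial X_j^k: the contribution of any other X_i carries the factor 1 +
    e i or a coefficient that is zero, which isolates X_j^(k+1). These coefficients are the values
    at the vertices of the simplex. *)
Lemma harm_coeff_pow e k j p : harm e k.+1 p -> e j + k.+1%:R != 0 ->
  (forall i, i != j -> e i = -1 \/ forall m, (0 < m i)%N -> p@_m = 0) ->
  p@_(U_(j) *+ k.+1)%MM = 0.
Proof.
move=> hp ej he; have := harm_coeff (U_(j) *+ k)%MM hp.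
rewrite (bigD1 j)//= big1 => [|i ij]; last first.
  rewrite mulmnE mnm1E eq_sym (negbTE ij) mul0n.
  have [->|/(_ _) ->] := he i ij; first by rewrite add0r subrr mulr0 mul0r.
    by rewrite mulr0.
  by rewrite mnmDE mnm1E eqxx addn1.
rewrite -mulmSr addr0 mulmnE mnm1E eqxx mul1n => /eqP.
by rewrite natr1 [_ + e j]addrC mulf_eq0 mulf_eq0 pnatr_eq0 (negbTE ej) => /eqP.
Qed.

(** In one variable, X (X h)'' = X (X h'' + 2 h'): multiplication by X carries parameter 1 to
    parameter -1. *)
Lemma lap_XJ e e' (J : {set 'I_n}) p :
  (forall i, i \in J -> e i = -1 /\ e' i = 1) ->
  (forall i, i \notin J -> e i = e' i \/ forall m, (0 < m i)%N -> p@_m = 0) ->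
  lap e (p * 'X_[mesym1 J]) = lap e' p * 'X_[mesym1 J].
Proof.
move=> eJ enJ; apply/mpolyP => m.
have cX q l : (q * 'X_[mesym1 J])@_l =
    if (mesym1 J <= l)%MM then q@_(l - mesym1 J)%MM else 0.
  case: ifPn => h; first by rewrite -{1}(submK h) addmC mcoeffMX.
  elim/mpoly_lin_ind: q => [k|c q IH|q q' IHq IHq'].
  - rewrite -mpolyXD mcoeffX; case: eqP => // E; move: h.
    by rewrite -E lem_addl.
  - by rewrite -scalerAl mcoeffZ IH mulr0.
  - by rewrite mulrDl mcoeffD IHq IHq' addr0.
rewrite mcoeff_lap cX mcoeff_lap; case: ifPn => Jm; last first.
  (* If some i of J is absent from m, the i-th term has the factor m i = 0, and every other term is
     read at a monomial that still lacks X_i. *)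
  have [i /andP[iJ mi0]] : exists i, (i \in J) && (m i == 0%N).
    apply/existsP; apply: contraNT Jm => /existsPn H; apply/mnm_lepP => i.
    rewrite mnmE; have := H i; case: (i \in J) => //=; lia.
  rewrite (bigD1 i)//= big1 => [|l li].
    by rewrite (eqP mi0) (eJ i iJ).1 add0r subrr mulr0 mul0r addr0.
  rewrite cX; case: ifPn; last by rewrite mulr0.
  move=> /mnm_lepP/(_ i); rewrite mnmE iJ mnmDE mnm1E (eqP mi0).
  by rewrite (negbTE li).
apply: eq_bigr => i _; rewrite cX ifT; last first.
  by apply: (lepm_trans Jm); rewrite lem_addr.
have Jmi := mnm_lepP Jm i; rewrite mnmE in Jmi.
have -> : (m + U_(i) - mesym1 J = m - mesym1 J + U_(i))%MM.
  by apply/mnmP => l; have := mnm_lepP Jm l; rewrite !(mnmDE, mnmBE); lia.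
rewrite mnmBE mnmE; move: Jmi; have [iJ|iJ] := boolP (i \in J) => /= Jmi.
  have [-> ->] := eJ i iJ; rewrite subn1 prednK//; congr (_ * _).
  by rewrite [(m i).-1%:R + 1]natr1 prednK// -(natr1 (m i)); ring.
rewrite subn0; have [->//|->] := enJ i iJ; first by rewrite !mulr0.
by rewrite mnmDE mnm1E eqxx addn1.
Qed.
End LinearForms.

(** * Beta integrals *)

Section BetaIntegrals.
Local Open Scope classical_set_scope.
Local Open Scope ring_scope.
Variable R : realType.
Notation mu := (@lebesgue_measure R).
Implicit Types (a b s t : R).

Definition bfun a b s t : R := t `^ a * (s - t) `^ b.

Lemma bfun_ge0 a b s t : 0 <= bfun a b s t.
Proof. by rewrite mulr_ge0 ?powR_ge0. Qed.

Lemma is_derive_bfun a b s t : 0 < t -> t < s ->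
  is_derive t (1 : R) (bfun a b s)
    (a * bfun (a - 1) b s t - b * bfun a (b - 1) s t).
Proof.
move=> t0 ts.
have st0 : 0 < s - t by rewrite subr_gt0.
have D2 : is_derive t (1 : R) (fun u => (s - u) `^ b) (- (b * (s - t) `^ (b - 1))).
  have Ds : is_derive t (1 : R) (fun u : R => s - u) (-1).
    by apply: is_derive_eq; rewrite add0r mul1r.
  have Dp := is_derive1_powR b st0.
  have := @is_derive1_comp _ (fun v => v `^ b) (fun u => s - u) _ _ _ Dp Ds.
  by rewrite mulrN1.
have D1 := is_derive1_powR a t0.
apply: is_derive_eq; rewrite /bfun /GRing.scale /=; ring.
Qed.

Lemma bfun_continuous a b s t : 0 < t -> t < s -> {for t, continuous (bfun a b s)}.
Proof.
move=> t0 ts; apply/differentiable_continuous/derivable1_diffP.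
by have [] := is_derive_bfun a b t0 ts.
Qed.

(** The shift by 3 keeps the value at most 1/3, so that the intervals [shrink s n] are nondegenerate
    from n = 0 on. *)
Definition inv3 n : R := n.+3%:R^-1.

Lemma inv3_bounds n : 0 < inv3 n <= 3%:R^-1.
Proof. by rewrite /inv3 invr_gt0 ltr0n lef_pV2 ?posrE ?ltr0n// ler_nat. Qed.

Lemma inv3_le m n : (m <= n)%N -> inv3 n <= inv3 m.
Proof. by move=> mn; rewrite /inv3 lef_pV2 ?posrE ?ltr0n// ler_nat; lia. Qed.

(* The beta integrands are continuous on the open interval only, so the
   fundamental theorem of calculus is applied on these and passed to the limit. *)
Definition shrink s n : set R := `[s * inv3 n, s * (1 - inv3 n)]%classic.

Lemma shrink_bounds s n : 0 < s ->
  [/\ 0 < s * inv3 n, s * inv3 n < s * (1 - inv3 n) & s * (1 - inv3 n) < s].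
Proof.
move=> s0; have /andP[n0 n1] := inv3_bounds n; split; first exact: mulr_gt0.
  by rewrite ltr_pM2l//; lra.
by rewrite gtr_pMr//; lra.
Qed.

Lemma shrink_sub s n : 0 < s -> (shrink s n `<=` `]0, s[)%classic.
Proof.
move=> s0 x; have [H1 H2 H3] := shrink_bounds n s0.
rewrite /shrink /= !in_itv /= => /andP[x1 x2].
by rewrite (lt_le_trans H1 x1) (le_lt_trans x2 H3).
Qed.

Lemma bigcup_shrink s : 0 < s -> (\bigcup_n shrink s n = `]0, s[)%classic.
Proof.
move=> s0; apply/seteqP; split => [x [n _]|x]; first exact: shrink_sub.
rewrite /= in_itv /= => /andP[x0 xs].
have d0 : 0 < Num.min (x / s) (1 - x / s).
  by rewrite lt_min divr_gt0//= subr_gt0 ltr_pdivrMr// mul1r.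
have [n] := ltr_add_invr d0; rewrite add0r lt_min => /andP[n1 n2].
exists n => //; rewrite /shrink /= in_itv /=.
have n3 : inv3 n <= n.+1%:R^-1 by rewrite lef_pV2 ?posrE ?ltr0n// ler_nat; lia.
rewrite -[x](divfK (lt0r_neq0 s0)) [_ / s * s]mulrC !ler_pM2l//.
rewrite (le_trans n3 (ltW n1))/= lerBrDr addrC -lerBrDr.
exact: le_trans n3 (ltW n2).
Qed.

Lemma shrink_nd s : 0 < s -> nondecreasing_seq (shrink s).
Proof.
move=> s0 m n mn; apply/subsetPset => x; rewrite /shrink /= !in_itv /=.
have n3 := inv3_le mn.
move=> /andP[x1 x2]; apply/andP; split.
  by apply: le_trans x1; rewrite ler_pM2l.
by apply: le_trans x2 _; rewrite ler_pM2l// lerD2l lerN2.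
Qed.

Lemma measurable_oo s (f : R -> R) : {in `]0, s[%R, continuous f} ->
  measurable_fun `]0, s[%classic f.
Proof.
move=> cf; apply: open_continuous_measurable_fun; first exact: interval_open.
by move=> x; rewrite inE /= => xs; exact: cf.
Qed.

Lemma cvg_shrink s (f : R -> R) : 0 < s -> {in `]0, s[%R, continuous f} ->
  {in `]0, s[%R, forall t, 0 <= f t} ->
  (\int[mu]_(x in shrink s n) (f x)%:E @[n --> \oo] -->
  \int[mu]_(x in `]0%R, s[) (f x)%:E)%E.
Proof.
move=> s0 cf f0; rewrite -[X in (\int[mu]_(x in X) _)%E](bigcup_shrink s0).
have mf := measurable_oo cf.
apply: ge0_nondecreasing_set_cvg_integral.
- exact: shrink_nd.
- by move=> n; exact: measurable_itv.
- move=> n; apply/measurable_EFinP; apply: measurable_funS mf => //.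
  exact: shrink_sub.
- move=> n x /(shrink_sub s0) /= xs; rewrite lee_fin; exact: f0.
Qed.

Lemma within_shrink s n (f : R -> R) : 0 < s -> {in `]0, s[%R, continuous f} ->
  {within shrink s n, continuous f}.
Proof.
move=> s0 cf; apply/continuous_in_subspaceT => x; rewrite inE => /(shrink_sub s0).
exact: cf.
Qed.

Lemma FTC_shrink s n (f F : R -> R) : 0 < s -> {in `]0, s[%R, continuous f} ->
  (forall x, 0 < x -> x < s -> is_derive x (1 : R) F (f x)) ->
  (\int[mu]_(x in shrink s n) (f x)%:E =
    (F (s * (1 - inv3 n)))%:E - (F (s * inv3 n))%:E)%E.
Proof.
move=> s0 cf dF; have [H1 H2 H3] := shrink_bounds n s0.
have cF x : 0 < x -> x < s -> {for x, continuous F}.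
  move=> x0 xs; apply/differentiable_continuous/derivable1_diffP.
  by have [] := dF x x0 xs.
apply: continuous_FTC2 => //.
- exact: within_shrink.
- split => [x|  |].
  + rewrite in_itv /= => /andP[x1 x2].
    by have [] := dF x (lt_trans H1 x1) (lt_trans x2 H3).
  + exact/cvg_at_right_filter/(cF _ H1 (lt_trans H2 H3)).
  + exact/cvg_at_left_filter/(cF _ (lt_trans H1 H2) H3).
- move=> x; rewrite in_itv /= => /andP[x1 x2].
  have [_] := dF x (lt_trans H1 x1) (lt_trans x2 H3).
  by rewrite derive1E.
Qed.

(** Monotone convergence: the integrals over [shrink s n] are increments of the antiderivative,
    hence bounded by [c]. *)
Lemma integrable_shrink s (f F : R -> R) c : 0 < s -> {in `]0, s[%R, continuous f} ->
  {in `]0, s[%R, forall t, 0 <= f t} ->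
  (forall x, 0 < x -> x < s -> is_derive x (1 : R) F (f x)) ->
  {in `]0, s[%R &, forall t u, F t - F u <= c} ->
  mu.-integrable `]0, s[%classic (EFin \o f).
Proof.
move=> s0 cf f0 dF Fc; apply/integrableP; split.
  by apply/measurable_EFinP; exact: measurable_oo cf.
have -> : (\int[mu]_(x in `]0%R, s[) `|(EFin \o f) x| =
    \int[mu]_(x in `]0%R, s[) (f x)%:E)%E.
  by apply: eq_integral => x; rewrite inE /= => xs; rewrite ger0_norm// f0.
apply: (@le_lt_trans _ _ c%:E); last exact: ltry.
have cv := cvg_shrink s0 cf f0.
rewrite -(cvg_lim (@ereal_hausdorff _) cv); apply: lime_le.
  by apply/cvg_ex; eexists; exact: cv.
apply: nearW => n; rewrite (FTC_shrink n s0 cf dF) -EFinB lee_fin.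
have [H1 H2 H3] := shrink_bounds n s0.
by apply: Fc; rewrite in_itv /= ?H1 ?H3 ?(lt_trans H1 H2) ?(lt_trans H2 H3).
Qed.

Lemma integrable_powl a s : -1 < a -> 0 < s ->
  mu.-integrable `]0, s[%classic (EFin \o (fun t => t `^ a)).
Proof.
move=> a1 s0; have a0 : 0 < a + 1 by lra.
have dF x : 0 < x -> x < s -> is_derive x (1 : R) (fun t => (a + 1)^-1 * t `^ (a + 1)) (x `^ a).
  move=> x0 xs; have D := is_derive1_powR (a + 1) x0.
  apply: is_derive_eq; rewrite /GRing.scale /= addrK mulrA mulVf ?mul1r//.
  exact: lt0r_neq0.
apply: (integrable_shrink (c := (a + 1)^-1 * s `^ (a + 1)) s0 _ _ dF) => [x|x _|x y].
- rewrite in_itv /= => /andP[x0 xs]; apply/differentiable_continuous/derivable1_diffP.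
  by have [] := is_derive1_powR a x0.
- exact: powR_ge0.
- rewrite !in_itv /= => /andP[x0 xs] /andP[y0 ys].
  rewrite -mulrBr ler_pM2l ?invr_gt0// lerBlDr.
  apply: (@le_trans _ _ (s `^ (a + 1))); last by rewrite lerDl powR_ge0.
  by rewrite ge0_ler_powR// ?nnegrE ?ltW.
Qed.

Lemma integrable_powr b s : -1 < b -> 0 < s ->
  mu.-integrable `]0, s[%classic (EFin \o (fun t => (s - t) `^ b)).
Proof.
move=> b1 s0; have b0 : 0 < b + 1 by lra.
have dF x : 0 < x -> x < s -> is_derive x (1 : R) (fun t => - (b + 1)^-1 * bfun 0 (b + 1) s t) ((s - x) `^ b).
  move=> x0 xs; have D := is_derive_bfun 0 (b + 1) x0 xs.
  apply: is_derive_eq; rewrite /GRing.scale /= addrK.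
  rewrite /bfun powRr0 mul0r sub0r mulrNN mul1r mulrA mulVf ?mul1r//.
  exact: lt0r_neq0.
apply: (integrable_shrink (c := (b + 1)^-1 * s `^ (b + 1)) s0 _ _ dF) => [x|x _|x y].
- rewrite in_itv /= => /andP[x0 xs].
  have -> : (fun t => (s - t) `^ b) = bfun 0 b s.
    by apply/funext => t; rewrite /bfun powRr0 mul1r.
  exact: bfun_continuous.
- exact: powR_ge0.
- rewrite !in_itv /= => /andP[x0 xs] /andP[y0 ys].
  rewrite /bfun !powRr0 !mul1r !mulNr opprK addrC -mulrBr ler_pM2l ?invr_gt0//.
  rewrite lerBlDr.
  apply: (@le_trans _ _ (s `^ (b + 1))); last by rewrite lerDl powR_ge0.
  rewrite ge0_ler_powR// ?nnegrE ?ltW// ?subr_gt0//; lra.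
Qed.

Lemma powR_mid a s t : 0 < s -> s / 2 <= t -> t <= s -> t `^ a <= (s / 2) `^ a + s `^ a.
Proof.
move=> s0 st ts; have s20 : 0 < s / 2 by rewrite divr_gt0.
have t0 := lt_le_trans s20 st.
have [a0|/ltW a0] := leP 0 a.
  apply: (@le_trans _ _ (s `^ a)); last by rewrite lerDr powR_ge0.
  by rewrite ge0_ler_powR// nnegrE ltW.
apply: (@le_trans _ _ ((s / 2) `^ a)); last by rewrite lerDl powR_ge0.
rewrite -[a]opprK !(powRN _ (- a)) lef_pV2 ?posrE ?powR_gt0//.
by rewrite ge0_ler_powR ?oppr_ge0// nnegrE ltW.
Qed.

(** On each half of the interval one of the two powers is bounded by its values at the ends of that
    half, so a multiple of t^a + (s - t)^b dominates. *)
Lemma integrable_bfun a b s : -1 < a -> -1 < b -> 0 < s ->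
  mu.-integrable `]0, s[%classic (EFin \o bfun a b s).
Proof.
move=> a1 b1 s0.
pose K := (s / 2) `^ a + s `^ a + ((s / 2) `^ b + s `^ b).
have K0 : 0 <= K by rewrite !addr_ge0 ?powR_ge0.
have m0s : measurable (`]0, s[%classic : set (measurableTypeR R)).
  exact: measurable_itv.
have ig := integrableD m0s
  (integrableZl m0s K (integrable_powl a1 s0))
  (integrableZl m0s K (integrable_powr b1 s0)).
apply: (le_integrable m0s _ _ ig).
- apply/measurable_EFinP; apply: measurable_oo => x.
  by rewrite in_itv /= => /andP[x0 xs]; exact: bfun_continuous.
- move=> t; rewrite /= in_itv /= => /andP[t0 ts].
  rewrite ger0_norm ?bfun_ge0// ger0_norm; last first.
    by rewrite addr_ge0// mulr_ge0// powR_ge0.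
  rewrite lee_fin /bfun; have [h|/ltW h] := leP (s / 2) t.
    rewrite -[leLHS]add0r lerD ?mulr_ge0 ?powR_ge0// ler_wpM2r ?powR_ge0//.
    apply: (le_trans (powR_mid a s0 h (ltW ts))).
    by rewrite lerDl addr_ge0 ?powR_ge0.
  rewrite -[leLHS]addr0 lerD ?mulr_ge0 ?powR_ge0// mulrC ler_wpM2r ?powR_ge0//.
  have h1 : s / 2 <= s - t by lra.
  have h2 : s - t <= s by lra.
  apply: (le_trans (powR_mid b s0 h1 h2)).
  by rewrite lerDr addr_ge0 ?powR_ge0.
Qed.

End BetaIntegrals.

Section BetaFunction.
Variable R : realType.
Local Open Scope classical_set_scope.
Local Open Scope ring_scope.
Notation mu := (@lebesgue_measure R).
Implicit Types (a b s t : R).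

Lemma measurable_oo_itv s : measurable (`]0, s[%classic : set (measurableTypeR R)).
Proof. exact: measurable_itv. Qed.

Lemma measurable_shrink s n : measurable (shrink s n : set (measurableTypeR R)).
Proof. exact: measurable_itv. Qed.

Lemma bfun_oo_continuous a b s : {in `]0, s[%R, continuous (bfun a b s)}.
Proof.
by move=> x; rewrite in_itv /= => /andP[x0 xs]; exact: bfun_continuous.
Qed.

Definition Bt a b : R := \int[mu]_(t in `]0, 1[) bfun a b 1 t.

Lemma cvg_shrink_Rint s (f : R -> R) : 0 < s -> {in `]0, s[%R, continuous f} ->
  {in `]0, s[%R, forall t, 0 <= f t} ->
  mu.-integrable `]0, s[%classic (EFin \o f) ->
  \int[mu]_(x in shrink s n) f x @[n --> \oo] --> \int[mu]_(x in `]0, s[) f x.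
Proof.
move=> s0 cf f0 intf; apply: fine_cvg; rewrite fineK; last first.
  exact: (integrable_fin_num (measurable_oo_itv s) intf).
exact: cvg_shrink.
Qed.

(** The substitution t = s u maps [shrink 1 n] onto [shrink s n], where everything is continuous;
    the identity then passes to the limit. *)
Lemma Rint_bfun a b s : -1 < a -> -1 < b -> 0 < s ->
  \int[mu]_(t in `]0, s[) bfun a b s t = Bt a b * s `^ (a + b + 1).
Proof.
move=> a1 b1 s0.
have H1 := cvg_shrink_Rint s0 (@bfun_oo_continuous a b s)
  (fun t _ => bfun_ge0 a b s t) (integrable_bfun a1 b1 s0).
have H2 := cvg_shrink_Rint (@ltr01 R) (@bfun_oo_continuous a b 1)
  (fun t _ => bfun_ge0 a b 1 t) (integrable_bfun a1 b1 ltr01).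
apply: (cvg_unique _ H1) => //.
suff -> : (fun n => \int[mu]_(x in shrink s n) bfun a b s x) =
  (fun n => (\int[mu]_(x in shrink 1 n) bfun a b 1 x) * s `^ (a + b + 1)).
  exact: cvgMl.
apply/funext => n.
have dD (x : R) : is_derive x (1 : R) (fun x : R => s * x) s.
  by apply: is_derive_eq; rewrite /GRing.scale /= mulr1.
have dF : derive1 (fun x : R => s * x) = cst s.
  by apply/funext => x; rewrite derive1E; have [_ ->] := dD x.
have cF (x : R) : {for x, continuous (fun x : R => s * x)}.
  exact: mulrl_continuous.
have [L1 L2 L3] := shrink_bounds n (@ltr01 R); rewrite !mul1r in L1 L2 L3.
have intf : mu.-integrable (shrink 1 n) (EFin \o bfun a b 1).
  apply: integrableS (integrable_bfun a1 b1 ltr01).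
  - exact: measurable_oo_itv.
  - exact: measurable_shrink.
  - exact: shrink_sub.
rewrite mulrC -(RintegralZl (s `^ (a + b + 1)) (measurable_shrink 1 n) intf).
rewrite /Rintegral; congr fine; rewrite {2}/shrink !mul1r.
have := @integration_by_substitution_increasing R (fun x => s * x) (bfun a b s)
  (inv3 R n) (1 - inv3 R n); rewrite !dF => ->.
- apply: eq_integral => x.
  rewrite inE /= in_itv /= => /andP[x1 x2]; rewrite /bfun /=.
  have x0 : 0 < x by apply: lt_le_trans x1.
  have x3 : 0 < 1 - x by rewrite subr_gt0; apply: le_lt_trans x2 L3.
  congr EFin; rewrite !fctE /cst /bfun /=.
  have -> : s - s * x = s * (1 - x) by ring.
  rewrite !powRM ?ltW// !powRD ?lt0r_neq0 ?implybT// powRr1 ?ltW//; ring.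
- exact: ltW.
- by move=> x y _ _ xy; rewrite ltr_pM2l.
- by move=> x _; exact: cst_continuous.
- by apply: is_cvg_cst.
- by apply: is_cvg_cst.
- split => [x _||].
  + by have [] := dD x.
  + exact/cvg_at_right_filter/cF.
  + exact/cvg_at_left_filter/cF.
- have := @within_shrink R s n _ s0 (@bfun_oo_continuous a b s).
  by rewrite /shrink.
Qed.

Lemma bfunSl a b s t : 0 < t -> bfun (a + 1) b s t = t * bfun a b s t.
Proof.
move=> t0; rewrite /bfun powRD ?lt0r_neq0 ?implybT// powRr1 ?ltW//; ring.
Qed.

Lemma bfunSr a b s t : t < s -> bfun a (b + 1) s t = (s - t) * bfun a b s t.
Proof.
move=> ts; have st : 0 < s - t by rewrite subr_gt0.
rewrite /bfun powRD ?lt0r_neq0 ?implybT// powRr1 ?ltW//; ring.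
Qed.

Lemma Bt_add a b : -1 < a -> -1 < b -> Bt (a + 1) b + Bt a (b + 1) = Bt a b.
Proof.
move=> a1 b1; rewrite /Bt -RintegralD; last 3 first.
- exact: measurable_oo_itv.
- by apply: integrable_bfun => //; lra.
- by apply: integrable_bfun => //; lra.
apply: eq_Rintegral => t; rewrite inE /= in_itv /= => /andP[t0 t1].
by rewrite bfunSl// bfunSr//; ring.
Qed.

Lemma cvg_inv3_powR p : 0 < p -> inv3 R n `^ p @[n --> \oo] --> 0.
Proof.
move=> p0; have /cvg_at_rightP H := powR_cvg0 p0; apply: H; split => [n|].
  by have /andP[] := inv3_bounds R n.
have H := @cvg_harmonic R; rewrite -(cvg_shiftn 2) in H.
suff -> : inv3 R = (fun n => harmonic (n + 2)%N) by exact: H.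
by apply/funext => n; rewrite /inv3 /harmonic /= addn2.
Qed.

(** The difference of the two sides is the integral of the derivative of t^(a+1) (1-t)^(b+1), whose
    boundary values tend to 0. *)
Lemma Bt_swap a b : -1 < a -> -1 < b ->
  (a + 1) * Bt a (b + 1) = (b + 1) * Bt (a + 1) b.
Proof.
move=> a1 b1.
have [a0 b0] : 0 < a + 1 /\ 0 < b + 1 by split; lra.
have ia : mu.-integrable `]0, 1[%classic (EFin \o bfun a (b + 1) 1).
  by apply: integrable_bfun => //; lra.
have ib : mu.-integrable `]0, 1[%classic (EFin \o bfun (a + 1) b 1).
  by apply: integrable_bfun => //; lra.
have H1 := cvg_shrink_Rint (@ltr01 R) (@bfun_oo_continuous a (b + 1) 1)
  (fun t _ => bfun_ge0 _ _ _ t) ia.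
have H2 := cvg_shrink_Rint (@ltr01 R) (@bfun_oo_continuous (a + 1) b 1)
  (fun t _ => bfun_ge0 _ _ _ t) ib.
have {}H1 : (fun n => (a + 1) * \int[mu]_(x in shrink 1 n) bfun a (b + 1) 1 x)
    @ \oo --> (a + 1) * Bt a (b + 1) by rewrite /Bt; apply: cvgMr H1.
have {}H2 : (fun n => (b + 1) * \int[mu]_(x in shrink 1 n) bfun (a + 1) b 1 x)
    @ \oo --> (b + 1) * Bt (a + 1) b by rewrite /Bt; apply: cvgMr H2.
suff H0 : (fun n => (a + 1) * \int[mu]_(x in shrink 1 n) bfun a (b + 1) 1 x -
   (b + 1) * \int[mu]_(x in shrink 1 n) bfun (a + 1) b 1 x) @ \oo --> 0.
  apply/eqP; rewrite -subr_eq0; apply/eqP; exact: (cvg_unique _ (cvgB H1 H2) H0).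
pose G n := bfun (a + 1) (b + 1) 1 (1 - inv3 R n) - bfun (a + 1) (b + 1) 1 (inv3 R n).
have -> : (fun n => (a + 1) * \int[mu]_(x in shrink 1 n) bfun a (b + 1) 1 x -
   (b + 1) * \int[mu]_(x in shrink 1 n) bfun (a + 1) b 1 x) = G.
  apply/funext => n.
  have is_ f : mu.-integrable `]0, 1[%classic f -> mu.-integrable (shrink 1 n) f.
    apply: integrableS; [exact: measurable_oo_itv|exact: measurable_shrink|].
    exact: shrink_sub.
  rewrite -!RintegralZl ?is_//; try exact: measurable_shrink.
  rewrite -RintegralB; last 3 first.
  - exact: measurable_shrink.
  - exact: (integrableZl (measurable_shrink 1 n) (a + 1) (is_ _ ia)).
  - exact: (integrableZl (measurable_shrink 1 n) (b + 1) (is_ _ ib)).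
  pose f x := (a + 1) * bfun a (b + 1) 1 x - (b + 1) * bfun (a + 1) b 1 x.
  have cf : {in `]0, 1[%R, continuous f}.
    by move=> x xi; apply: cvgB; apply: cvgMr; exact: bfun_oo_continuous.
  have dF (x : R) : 0 < x -> x < 1 ->
      is_derive x (1 : R) (bfun (a + 1) (b + 1) 1) (f x).
    move=> x0 x1; have := is_derive_bfun (a + 1) (b + 1) x0 x1.
    by rewrite !addrK.
  by rewrite /Rintegral (FTC_shrink n (@ltr01 R) cf dF) !mul1r.
have K (c p : R) : 0 <= p -> 0 <= c -> c <= 1 -> c `^ p <= 1.
  move=> p0 c0 c1; have <- : 1 `^ p = 1 by rewrite powR1.
  by apply: ge0_ler_powR; rewrite // nnegrE.
have Ga : (fun n => inv3 R n `^ (a + 1) * (1 - inv3 R n) `^ (b + 1)) @ \oo --> 0.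
  apply: (squeeze_cvgr _ (@cvg_cst _ 0 _ \oo _) (cvg_inv3_powR a0)).
  apply: nearW => n; have /andP[n0 n1] := inv3_bounds R n.
  rewrite mulr_ge0 ?powR_ge0//= ler_piMr ?powR_ge0// K//; lra.
have Gb : (fun n => (1 - inv3 R n) `^ (a + 1) * inv3 R n `^ (b + 1)) @ \oo --> 0.
  apply: (squeeze_cvgr _ (@cvg_cst _ 0 _ \oo _) (cvg_inv3_powR b0)).
  apply: nearW => n; have /andP[n0 n1] := inv3_bounds R n.
  rewrite mulr_ge0 ?powR_ge0//= ler_piMl ?powR_ge0// K//; lra.
have H := cvgB Gb Ga; rewrite subrr in H.
suff -> : G = (fun n => (1 - inv3 R n) `^ (a + 1) * inv3 R n `^ (b + 1) -
    inv3 R n `^ (a + 1) * (1 - inv3 R n) `^ (b + 1)) by exact: H.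
apply/funext => n; rewrite /G /bfun /=.
by have -> : 1 - (1 - inv3 R n) = inv3 R n by ring.
Qed.

(** A positive value at t would keep f above f t / 2 on a small interval around t and make the
    integral positive. *)
Lemma Rint_pos s (f : R -> R) : 0 < s -> {in `]0, s[%R, continuous f} ->
  {in `]0, s[%R, forall t, 0 <= f t} ->
  mu.-integrable `]0, s[%classic (EFin \o f) ->
  \int[mu]_(x in `]0, s[) f x = 0 -> {in `]0, s[%R, forall t, f t = 0}.
Proof.
move=> s0 cf f0 intf I0 t ts; apply/eqP; rewrite eq_le f0// andbT leNgt.
apply/negP => ft0.
have /cvgrPdist_lt /(_ _ (divr_gt0 ft0 (ltr0n _ 2))) := cf t ts.
move=> near_t; have ots : nbhs t `]0, s[%classic.
  by apply: open_nbhs_nbhs; split; [exact: interval_open|].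
have [e /= e0 He] : exists2 e : R, 0 < e & forall x, `|t - x| < e ->
    x \in `]0, s[%R /\ f t / 2 < f x.
  have [e /= e0 He] := @filterI _ _ _ _ _ near_t ots.
  exists e => // x xe; have [h1 h2] := He x xe; split => //.
  by move: h1; rewrite /= ltr_distlC => /andP[]; lra.
pose E := `](t - e / 2), (t + e / 2)[%classic : set R.
have sub : E `<=` `]0, s[%classic.
  move=> x; rewrite /E /= in_itv /= => /andP[x1 x2].
  by have [] := He x; rewrite // ltr_distlC; apply/andP; split; lra.
have mE : measurable (E : set (measurableTypeR R)) by exact: measurable_itv.
have mf := measurable_oo cf.
have I0' : (\int[mu]_(x in `]0%R, s[) (f x)%:E)%E = 0%E.
  have := fineK (integrable_fin_num (measurable_oo_itv s) intf).
  by move: I0; rewrite /Rintegral => ->.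
have H1 : (\int[mu]_(x in E) (f x)%:E <= 0)%E.
  rewrite -I0'; apply: (ge0_subset_integral mu mE (measurable_oo_itv s) _ _ sub).
    exact/measurable_EFinP.
  by move=> x xs; rewrite lee_fin f0.
have H2 : (\int[mu]_(x in E) (f t / 2)%:E <= \int[mu]_(x in E) (f x)%:E)%E.
  apply: ge0_le_integral => //.
  - by move=> x _; rewrite lee_fin ltW// divr_gt0.
  - apply/measurable_EFinP; exact: (measurable_funS (measurable_oo_itv s) sub mf).
  - move=> x; rewrite /E /= in_itv /= lee_fin => /andP[x1 x2]; apply/ltW.
    by apply: (He x _).2; rewrite ltr_distlC; apply/andP; split; lra.
have := le_trans H2 H1; rewrite integral_cst//.
rewrite [X in (_ * X)%E](_ : _ = e%:E); last first.
  etransitivity; first exact: lebesgue_measure_itv.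
  rewrite /= lte_fin ifT; last by lra.
  by rewrite -EFinD; congr EFin; lra.
rewrite -EFinM lee_fin leNgt => /negP; apply; apply: mulr_gt0 => //.
exact: divr_gt0.
Qed.

Lemma Bt_gt0 a b : -1 < a -> -1 < b -> 0 < Bt a b.
Proof.
move=> a1 b1; rewrite lt_neqAle Rintegral_ge0 ?andbT => [|x _]; last exact: bfun_ge0.
apply/eqP => /esym B0.
have h : (2^-1 : R) \in `]0, 1[%R.
  by rewrite in_itv /=; apply/andP; split; lra.
have := Rint_pos (@ltr01 R) (@bfun_oo_continuous a b 1) (fun t _ => bfun_ge0 _ _ _ t)
  (integrable_bfun a1 b1 ltr01) B0 h.
apply/eqP/lt0r_neq0; rewrite mulr_gt0 ?powR_gt0//; lra.
Qed.

(** [Bt_add] and [Bt_swap] together give (a + b + 2) Bt (a+1) b = (a + 1) Bt a b, which is iterated;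
    the Gamma function is never introduced. *)
Lemma rf_Bt_l a b p : -1 < a -> -1 < b ->
  Bt (a + p%:R) b * rf (a + b + 2) p = Bt a b * rf (a + 1) p.
Proof.
move=> a1 b1; elim: p => [|p IHp]; first by rewrite addr0 !rf0.
have ap : -1 < a + p%:R by apply: ltr_wpDr.
rewrite -(natr1 p) addrA !rfS mulrA mulrA -IHp.
have A := Bt_add ap b1; have S := Bt_swap ap b1.
have E := congr1 (fun z => rf (a + b + 2) p * z) S; rewrite /= in E.
move: E; rewrite -A; clear; move: (Bt _ _) => u; move: (Bt _ _) => v; move: (rf _ _) => f.
by move=> E; lra.
Qed.

Lemma rf_Bt_r a b q : -1 < a -> -1 < b ->
  Bt a (b + q%:R) * rf (a + b + 2) q = Bt a b * rf (b + 1) q.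
Proof.
move=> a1 b1; elim: q => [|q IHq]; first by rewrite addr0 !rf0.
have bq : -1 < b + q%:R by apply: ltr_wpDr.
rewrite -(natr1 q) addrA !rfS mulrA mulrA -IHq.
have A := Bt_add a1 bq; have S := Bt_swap a1 bq.
have E := congr1 (fun z => rf (a + b + 2) q * z) S; rewrite /= in E.
move: E; rewrite -A; clear; move: (Bt _ _) => u; move: (Bt _ _) => v; move: (rf _ _) => f.
by move=> E; lra.
Qed.

Lemma rfD (x : R) p q : rf x (p + q) = rf x p * rf (x + p%:R) q.
Proof.
elim: q => [|q IHq]; first by rewrite addn0 rf0 mulr1.
by rewrite addnS !rfS IHq natrD; ring.
Qed.

Lemma rf_Bt a b p q : -1 < a -> -1 < b ->
  Bt (a + p%:R) (b + q%:R) * rf (a + 1 + (b + 1)) (p + q) =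
  Bt a b * (rf (a + 1) p * rf (b + 1) q).
Proof.
move=> a1 b1; have bq : -1 < b + q%:R by apply: ltr_wpDr.
have := rf_Bt_l p a1 bq; have := rf_Bt_r q a1 b1.
have -> : a + 1 + (b + 1) = a + b + 2 by ring.
rewrite addnC rfD; have -> : a + (b + q%:R) + 2 = a + b + 2 + q%:R by ring.
move=> H1 H2; rewrite mulrCA H2 mulrA [_ * Bt _ _]mulrC H1; ring.
Qed.

End BetaFunction.

(** * Iterated integrals over simplices *)

Section Dirichlet.
Variable R : realType.
Local Open Scope classical_set_scope.
Local Open Scope ring_scope.
Notation mu := (@lebesgue_measure R).
Implicit Types (s t b x : R) (a y : seq R).

Definition bsum (l : seq (R * (R * R))) s t : R :=
  \sum_(k <- l) k.1 * bfun k.2.1 k.2.2 s t.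

Lemma bsum_cons k l s : bsum (k :: l) s =
  fun t => k.1 * bfun k.2.1 k.2.2 s t + bsum l s t.
Proof. by apply/funext => t; rewrite /bsum big_cons. Qed.

Lemma bsum_continuous l s : {in `]0, s[%R, continuous (bsum l s)}.
Proof.
move=> t ts; elim: l => [|k l IHl].
  rewrite (_ : bsum _ _ = cst 0); first exact: cst_continuous.
  by apply/funext => u; rewrite /bsum big_nil.
by rewrite bsum_cons; apply: cvgD => //; apply: cvgMr; exact: bfun_oo_continuous.
Qed.

Lemma Rint_bsum l s : 0 < s ->
  (forall k, k \in l -> -1 < k.2.1 /\ -1 < k.2.2) ->
  mu.-integrable `]0, s[ (EFin \o bsum l s) /\
  \int[mu]_(t in `]0, s[) bsum l s t =
  \sum_(k <- l) k.1 * Bt k.2.1 k.2.2 * s `^ (k.2.1 + k.2.2 + 1).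
Proof.
move=> s0; elim: l => [|k l IHl] hl.
  rewrite (_ : bsum _ _ = cst 0); last by apply/funext => u; rewrite /bsum big_nil.
  by rewrite big_nil Rintegral_cst ?mul0r//; split=> //; exact: integrable0.
have [k1 k2] := hl k (mem_head _ _).
have [il El] : mu.-integrable `]0, s[ (EFin \o bsum l s) /\
  \int[mu]_(t in `]0, s[) bsum l s t =
  \sum_(k <- l) k.1 * Bt k.2.1 k.2.2 * s `^ (k.2.1 + k.2.2 + 1).
  by apply: IHl => j jl; apply: hl; rewrite in_cons jl orbT.
have ik : mu.-integrable `]0, s[ (EFin \o (fun t => k.1 * bfun k.2.1 k.2.2 s t)).
  exact: (integrableZl (measurable_oo_itv s) k.1 (integrable_bfun k1 k2 s0)).
rewrite bsum_cons; split; first exact: (integrableD (measurable_oo_itv s) ik il).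
rewrite (RintegralD (measurable_oo_itv s) ik il) El big_cons; congr (_ + _).
rewrite (RintegralZl k.1 (measurable_oo_itv s) (integrable_bfun k1 k2 s0)).
by rewrite Rint_bfun// mulrA.
Qed.

(** [sint] integrates over closed intervals, but powers with negative exponents are controlled only
    inside; the endpoints form a null set. *)
Lemma Rint_cc_oo s (g G : R -> R) : {in `]0, s[%R, continuous G} ->
  {in `]0, s[%R, g =1 G} ->
  \int[mu]_(t in `[0, s]) g t = \int[mu]_(t in `]0, s[) G t.
Proof.
move=> cG gG; rewrite /Rintegral; congr fine.
rewrite integral_itv_bndoo; first by apply: eq_integral => t; rewrite inE => /gG ->.
apply/measurable_EFinP; apply: eq_measurable_fun (measurable_oo cG) => t.
by rewrite inE => /gG ->.
Qed.

(** The Dirichlet density: the product of the t_i^(a_i) times (s - sum t_i)^b, written by the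
    recursion of [sint]. Its integral over the simplex of size s is [dirC a b] times s to the power
    [dexp a b]. *)
Fixpoint kern a b s y : R :=
  if a is x :: a' then
    if y is t :: y' then t `^ x * kern a' b (s - t) y' else 0
  else s `^ b.

Definition dexp a b : R := \sum_(x <- a) (x + 1) + b.

Fixpoint dirC a b : R :=
  if a is x :: a' then Bt x (dexp a' b) * dirC a' b else 1.

Fixpoint osim (m : nat) s y : bool :=
  match m, y with
  | 0%N, [::] => 0 < s
  | m'.+1, t :: y' => [&& 0 < t, t < s & osim m' (s - t) y']
  | _, _ => false
  end.

Definition kwf m (k : R * (seq R * R)) :=
  [&& size k.2.1 == m, all (fun x => -1 < x) k.2.1 & -1 < k.2.2].

Definition ksum (l : seq (R * (seq R * R))) s y : R :=
  \sum_(k <- l) k.1 * kern k.2.1 k.2.2 s y.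

Lemma dexp_gt a b : all (fun x => -1 < x) a -> -1 < b -> -1 < dexp a b.
Proof.
move=> ha b1; rewrite /dexp; apply: (@lt_le_trans _ _ b) => //.
rewrite lerDr; elim: a ha => [|x a IHa]; first by rewrite big_nil.
move=> /= /andP[x1 /IHa H]; rewrite big_cons; lra.
Qed.

Lemma dirC_gt0 a b : all (fun x => -1 < x) a -> -1 < b -> 0 < dirC a b.
Proof.
elim: a => //= x a IHa /andP[x1 ha] b1; apply: mulr_gt0; last exact: IHa.
by apply: Bt_gt0 => //; exact: dexp_gt.
Qed.

(* Sums of kernels are stable under fixing the first coordinate (ktail) and under
   integrating out the other ones (khead): this carries the induction on the
   iterated integral. *)
Definition ktail (k : R * (seq R * R)) t : R * (seq R * R) :=
  (k.1 * t `^ head 0 k.2.1, (behead k.2.1, k.2.2)).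

Definition khead (k : R * (seq R * R)) : R * (R * R) :=
  (k.1 * dirC (behead k.2.1) k.2.2, (head 0 k.2.1, dexp (behead k.2.1) k.2.2)).

Lemma kwf_tail m k t : kwf m.+1 k -> kwf m (ktail k t).
Proof.
by case: k => c [[|x a] b] //= /and3P[/= sa /andP[_ ha] b1]; apply/and3P.
Qed.

Lemma ksum_tail m l s t y : all (kwf m.+1) l ->
  ksum l s (t :: y) = ksum [seq ktail k t | k <- l] (s - t) y.
Proof.
move=> wl; rewrite /ksum big_map big_seq [RHS]big_seq; apply: eq_bigr => k /(allP wl).
by case: k => c [[|x a] b] //= _; rewrite mulrA.
Qed.

(** Value and definiteness go through one induction: the value formula shows that the inner integral
    is a combination of beta integrands in the first coordinate, hence continuous and integrable, as
    [Rint_pos] demands. *)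
Lemma sint_ksum m s (l : seq (R * (seq R * R))) (h : seq R -> R) :
  0 < s -> all (kwf m) l -> (forall y, osim m s y -> h y = ksum l s y) ->
  sint m s h = \sum_(k <- l) k.1 * dirC k.2.1 k.2.2 * s `^ dexp k.2.1 k.2.2
  /\ ((forall y, osim m s y -> 0 <= h y) -> 0 <= sint m s h /\
     (sint m s h = 0 -> forall y, osim m s y -> h y = 0)).
Proof.
elim: m => [|m IHm] in s l h *.
  move=> s0 wl hE; split => /=.
    rewrite hE//= /ksum big_seq [RHS]big_seq; apply: eq_bigr => k /(allP wl).
    case: k => c [[|x a] b] //= _.
    by rewrite /dexp big_nil add0r mulr1.
  move=> h0; split => [|H [|//]]; last by [].
  exact: (h0 [::]).
move=> s0 wl hE.
pose g t := sint m (s - t) (fun y => h (t :: y)).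
pose L := [seq khead k | k <- l].
have st t : t \in `]0, s[%R -> [/\ 0 < t, t < s & 0 < s - t].
  by rewrite in_itv /= => /andP[t0 ts]; rewrite subr_gt0.
have wt t : all (kwf m) [seq ktail k t | k <- l].
  by apply/allP => _ /mapP[k /(allP wl) wk ->]; exact: kwf_tail.
have ht t : t \in `]0, s[%R -> forall y, osim m (s - t) y ->
    h (t :: y) = ksum [seq ktail k t | k <- l] (s - t) y.
  move=> /st[t0 ts _] y ym; rewrite hE ?(ksum_tail _ _ _ wl)//=.
  by rewrite t0 ts.
have gE : {in `]0, s[%R, g =1 bsum L s}.
  move=> t ts; have [t0 ts' st0] := st t ts.
  have [E _] := IHm _ _ _ st0 (wt t) (ht t ts).
  rewrite /g E /bsum /L !big_map; apply: eq_bigr => k _ /=.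
  by rewrite /bfun; ring.
have wL k : k \in L -> -1 < k.2.1 /\ -1 < k.2.2.
  move=> /mapP[k' /(allP wl)]; case: k' => c [[|x a] b] //= /and3P[/= _ /andP[x1 ha] b1] ->.
  by split => //=; exact: dexp_gt.
have [iL EL] := Rint_bsum s0 wL.
have E1 : sint m.+1 s h = \int[mu]_(t in `]0, s[) bsum L s t.
  exact: (Rint_cc_oo (@bsum_continuous L s) gE).
split.
  rewrite E1 EL /L big_map big_seq [RHS]big_seq; apply: eq_bigr => k /(allP wl).
  case: k => c [[|x a] b] //= _.
  rewrite -!mulrA; congr (_ * _); rewrite mulrCA !mulrA; congr (_ * _ `^ _).
  by rewrite /dexp big_cons; ring.
move=> h0.
have h0t t : t \in `]0, s[%R -> forall y, osim m (s - t) y -> 0 <= h (t :: y).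
  by move=> /st[t0 ts _] y ym; apply: h0 => /=; rewrite t0 ts.
have g0 : {in `]0, s[%R, forall t, 0 <= bsum L s t}.
  move=> t ts; have [t0 ts' st0] := st t ts; rewrite -gE//.
  by have [_ /(_ (h0t t ts)) []] := IHm _ _ _ st0 (wt t) (ht t ts).
split; first by rewrite E1; apply: Rintegral_ge0 => t; exact: g0.
rewrite E1 => I0 [|t y] //= /and3P[t0 ts ym].
have ti : t \in `]0, s[%R by rewrite in_itv /= t0.
have [_ _ st0] := st t ti.
have [_ /(_ (h0t t ti)) [_ /(_ _ y ym)]] := IHm _ _ _ st0 (wt t) (ht t ti).
apply; rewrite -/(g t) gE//.
exact: (Rint_pos s0 (@bsum_continuous L s) g0 iL I0).
Qed.

End Dirichlet.

(** * Integrals over faces *)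

Lemma osim_size (R : realType) m (s : R) y : osim m s y -> size y = m.
Proof.
by elim: m s y => [|m IHm] s [|t y] //= /and3P[_ _ /IHm ->].
Qed.

Section DirichletMoments.
Variables (R : realType) (T : Type).
Implicit Types (e u : T -> R) (m : T -> nat) (ns : seq T).

(** Dirichlet moments, one coordinate at a time: the remaining coordinates act as a single one with
    their total degree, and [rf_Bt] treats the Beta factor. The index [l] stands for the coordinate
    determined by the others. *)
Lemma dirC_mom e m ns l : all (fun i => -1 < e i) ns -> -1 < e l ->
  dirC [seq e i + (m i)%:R | i <- ns] (e l + (m l)%:R) *
    rf (\sum_(i <- ns) (e i + 1) + (e l + 1)) (\sum_(i <- ns) m i + m l) =
  dirC [seq e i | i <- ns] (e l) *
    (\prod_(i <- ns) rf (e i + 1) (m i) * rf (e l + 1) (m l)).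
Proof.
move=> + el; elim: ns => [|i ns IHns] /=.
  by move=> _; rewrite !big_nil add0r add0n !mul1r.
move=> /andP[ei ens]; rewrite !big_cons.
have dE (f : T -> R) b : dexp [seq f i | i <- ns] b = \sum_(i <- ns) (f i + 1) + b.
  by rewrite /dexp big_map.
rewrite !dE.
have -> : \sum_(i0 <- ns) (e i0 + (m i0)%:R + 1) + (e l + (m l)%:R) =
    \sum_(i <- ns) (e i + 1) + e l + (\sum_(i <- ns) m i + m l)%N%:R.
  rewrite natrD natr_sum (eq_bigr (fun i => e i + 1 + (m i)%:R)) => [|j _]; last ring.
  rewrite big_split /=; ring.
set q := (\sum_(i <- ns) m i + m l)%N in IHns *.
have b1 : -1 < \sum_(i <- ns) (e i + 1) + e l.
  have := dexp_gt (a := [seq e i | i <- ns]) (b := e l); rewrite dE all_map; exact.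
have := rf_Bt (m i) q ei b1.
have -> : e i + 1 + (\sum_(i <- ns) (e i + 1) + e l + 1) =
  e i + 1 + \sum_(i <- ns) (e i + 1) + (e l + 1) by ring.
move=> H; rewrite -addnA -/q mulrAC H.
have := IHns ens; rewrite -addrA => {}IHns.
transitivity (Bt (e i) (\sum_(i <- ns) (e i + 1) + e l) * rf (e i + 1) (m i) *
   (dirC [seq e i + (m i)%:R | i <- ns] (e l + (m l)%:R) *
    rf (\sum_(i <- ns) (e i + 1) + (e l + 1)) q)); first by ring.
by rewrite IHns; ring.
Qed.

Lemma kernE (f : T -> R) u ns b s :
  kern [seq f i | i <- ns] b s [seq u i | i <- ns] =
  \prod_(i <- ns) u i `^ f i * (s - \sum_(i <- ns) u i) `^ b.
Proof.
elim: ns s => [|i ns IHns] s /=; first by rewrite !big_nil mul1r subr0.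
by rewrite IHns !big_cons opprD addrA mulrA.
Qed.

Lemma osimE u ns s : osim (size ns) s [seq u i | i <- ns] =
  all (fun i => 0 < u i) ns && (\sum_(i <- ns) u i < s).
Proof.
elim: ns s => [|i ns IHns] s /=; first by rewrite big_nil.
rewrite IHns big_cons -andbA; congr (_ && _).
rewrite ltrBrDl andbCA; case: (boolP (all _ _)) => //= a.
apply/idP/idP => [/andP[]//|h]; rewrite h andbT.
apply: le_lt_trans h; rewrite lerDl; elim: {IHns} ns a => [|j ns IHns] /=.
  by rewrite big_nil.
by move=> /andP[uj /IHns H]; rewrite big_cons addr_ge0// ltW.
Qed.

End DirichletMoments.

Section Faces.
Variables (R : realType) (d : nat).
Local Notation idx := 'I_d.+2.
Local Notation pt := 'rV[R]_d.
Local Notation Q := {mpoly R[d.+2]}.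
Implicit Types (e : idx -> R) (x : pt) (N I : {set idx}) (F : Q).

Definition ix (j : 'I_d) : idx := inord j.+1.

Lemma ixE j : ix j = j.+1 :> nat.
Proof. by rewrite /ix inordK// ltnS ltnS ltnW. Qed.

Lemma ix_inj : injective ix.
Proof. by move=> i j /(congr1 val) /=; rewrite !ixE => -[/val_inj]. Qed.

Lemma ix_neq0 j : (ix j == ord0) = false.
Proof. by apply/negbTE; rewrite -val_eqE /= ixE. Qed.

Lemma ix_neqM j : (ix j == ord_max) = false.
Proof.
by apply/negbTE; rewrite -val_eqE /= ixE eqSS neq_ltn ltn_ord.
Qed.

Lemma ord0_neqM : (ord0 == ord_max :> idx) = false.
Proof. by []. Qed.

Lemma idx_cases (i : idx) : [\/ i = ord0, i = ord_max | exists j, i = ix j].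
Proof.
have [->|i0] := eqVneq i ord0; first exact: Or31.
have [->|im] := eqVneq i ord_max; first exact: Or32.
apply: Or33; rewrite -!val_eqE /= in i0 im.
have lt_i : (i.-1 < d)%N by have := ltn_ord i; lia.
by exists (Ordinal lt_i); apply: val_inj; rewrite [RHS]ixE /=; lia.
Qed.

Lemma sum_ix (f : 'I_d -> R) j : \sum_(l < d | l.+1 == ix j :> nat) f l = f j.
Proof.
by rewrite ixE (big_pred1 j).
Qed.

Lemma sum_ix0 (V : nmodType) (f : 'I_d -> V) :
  \sum_(l < d | l.+1 == (ord0 : idx) :> nat) f l = 0.
Proof. by rewrite big_pred0. Qed.

Lemma xv0 x : xv x ord0 = 0.
Proof. by rewrite /xv ord0_neqM sum_ix0. Qed.

Lemma xvM x : xv x ord_max = 1 - \sum_(j < d) x ord0 j.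
Proof. by rewrite /xv eqxx. Qed.

Lemma xv_ix x j : xv x (ix j) = x ord0 j.
Proof. by rewrite /xv ix_neqM sum_ix. Qed.

Lemma xv_inj x x' : xv x =1 xv x' -> x = x'.
Proof. by move=> E; apply/rowP => j; rewrite -!xv_ix E. Qed.

Lemma big_idx (V : nmodType) (f : idx -> V) :
  \sum_i f i = f ord0 + \sum_j f (ix j) + f ord_max.
Proof.
rewrite big_ord_recl big_ord_recr /= addrA; congr (_ + _ + _).
- by apply: eq_bigr => j _; congr f; apply: val_inj; rewrite [RHS]ixE.
- by congr f; apply: val_inj.
Qed.

Lemma sum_xv x : \sum_i xv x i = 1.
Proof.
rewrite big_idx xv0 add0r xvM addrC; under [X in _ + X]eq_bigr do rewrite xv_ix.
by rewrite subrK.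
Qed.

Definition relpt N x : Prop :=
  (forall i, i \in N -> 0 < xv x i) /\ (forall i, i \notin N -> xv x i = 0).

Definition weight N e x : R := \prod_(i in N) xv x i `^ e i.

(** Division by the rising factorial of the total turns gamma moments into Dirichlet moments. On
    homogeneous polynomials of one degree it is a common constant, so orthogonality for [Phi e]
    gives orthogonality for [Lam e]. *)
Definition Lam e : Q -> R :=
  linform (fun m => mom e m / rf (\sum_i (e i + 1)) (mdeg m)).

Definition faceN I : {set idx} := [set i | (i != ord0) && (i \notin I)].

Section Chart.
Variables (ns : seq idx) (l : idx) (z : seq R -> pt) (N : {set idx}).
Hypothesis uns : uniq (l :: ns).
Hypothesis NE : N =i l :: ns.
Hypothesis zE : forall u : idx -> R, (forall i, i \in ns -> 0 < u i) ->
  \sum_(i <- ns) u i < 1 -> forall i, xv (z [seq u i | i <- ns]) i =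
    if i == l then 1 - \sum_(i <- ns) u i else if i \in ns then u i else 0.

Let bigN (A : Type) (idx0 : A) (op : Monoid.com_law idx0) (f : idx -> A) :
  \big[op/idx0]_(i in N) f i = op (f l) (\big[op/idx0]_(i <- ns) f i).
Proof.
have -> : \big[op/idx0]_(i in N) f i = \big[op/idx0]_(i in l :: ns) f i.
  by apply: eq_bigl => i; exact: NE.
by rewrite -big_uniq//= big_cons.
Qed.

Lemma chart_relpt (u : idx -> R) : (forall i, i \in ns -> 0 < u i) ->
  \sum_(i <- ns) u i < 1 -> relpt N (z [seq u i | i <- ns]).
Proof.
move=> u0 u1; split => i; rewrite NE in_cons zE//.
  by case: eqP => [_ _|_ /= ins]; [rewrite subr_gt0|rewrite ins u0].
by rewrite negb_or => /andP[/negbTE -> /negbTE ->].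
Qed.

Lemma relpt_chart x : relpt N x ->
  [/\ forall i, i \in ns -> 0 < xv x i, \sum_(i <- ns) xv x i < 1
    & z [seq xv x i | i <- ns] = x].
Proof.
move=> [x0 x1].
have S : xv x l + \sum_(i <- ns) xv x i = 1.
  have := sum_xv x; rewrite (bigID (mem N)) /= [X in _ + X]big1 => [|i /x1//].
  by rewrite addr0 bigN.
have u0 i : i \in ns -> 0 < xv x i by move=> ins; rewrite x0// NE in_cons ins orbT.
have l0 : 0 < xv x l by rewrite x0// NE mem_head.
have u1 : \sum_(i <- ns) xv x i < 1 by rewrite -S ltrDr.
split => //; apply: xv_inj => i; rewrite zE//.
case: eqP => [->|/eqP il]; first by rewrite -S addrK.
by case: ifPn => // ins; rewrite x1// NE in_cons (negbTE il).
Qed.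

Lemma osim_chart y : osim (size ns) 1 y -> exists2 u : idx -> R,
  y = [seq u i | i <- ns] &
  (forall i, i \in ns -> 0 < u i) /\ \sum_(i <- ns) u i < 1.
Proof.
move=> oy; have sy : size y = size ns.
  exact: osim_size oy.
have yE : y = [seq nth 0 y (index i ns) | i <- ns].
  apply: (@eq_from_nth _ 0); rewrite ?size_map// => i; rewrite sy => i_lt.
  rewrite (nth_map l)// index_uniq//.
  by have /andP[] := uns.
exists (fun i => nth 0 y (index i ns)) => //.
by move: oy; rewrite {1}yE osimE => /andP[/allP].
Qed.

Variable e : idx -> R.
Hypothesis eN : forall i, i \in N -> -1 < e i.
Hypothesis eN' : forall i, i \notin N -> e i = -1.

Let mdegN (m : 'X_{1..d.+2}) : all (fun i => (i \in N) || (m i == 0%N)) (enum idx) ->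
  mdeg m = (\sum_(i <- ns) m i + m l)%N.
Proof.
move=> /allP mN; rewrite mdegE (bigID (mem N)) /= [X in (_ + X)%N]big1 => [|i iN].
  by rewrite addn0 bigN addnC.
by have := mN i (mem_enum _ _); rewrite (negbTE iN) => /eqP.
Qed.

(** In the chart every monomial times the weight is a Dirichlet kernel. The index [l] is the
    barycentric coordinate recovered from the others: d + 1 for faces not contained in |x| = 1, the
    last free coordinate otherwise, so that both branches of [face_int] are covered. *)
Lemma chart_sint F (g : pt -> R) :
  (forall x, relpt N x -> g x = F.@[xv x] * weight N e x) ->
  sint (size ns) 1 (fun y => g (z y)) = dirC [seq e i | i <- ns] (e l) * Lam e F /\
  ((forall x, relpt N x -> 0 <= g x) ->
   0 <= sint (size ns) 1 (fun y => g (z y)) /\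
   (sint (size ns) 1 (fun y => g (z y)) = 0 -> forall x, relpt N x -> g x = 0)).
Proof.
move=> gE.
have el : -1 < e l by rewrite eN// NE mem_head.
have ens : all (fun i => -1 < e i) ns.
  by apply/allP => i ins; rewrite eN// NE in_cons ins orbT.
(* Monomials with a variable outside N vanish on the face, and [Lam e] ignores them because e i = -1
   there; their coefficients can be replaced by 0. *)
pose suppN (m : 'X_{1..d.+2}) := all (fun i => (i \in N) || (m i == 0%N)) (enum idx).
pose L := [seq ((if suppN m then F@_m else 0,
   ([seq e i + (m i)%:R | i <- ns], e l + (m l)%:R)) : R * (seq R * R)) | m <- msupp F].
have wL : all (kwf (size ns)) L.
  apply/allP => _ /mapP[m _ ->]; rewrite /kwf /= size_map eqxx /= all_map.
  rewrite ltr_wpDr// andbT; apply/allP => i /(allP ens) /= ei.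
  exact: ltr_wpDr.
have hE y : osim (size ns) 1 y -> g (z y) = ksum L 1 y.
  move=> /osim_chart[u -> [u0 u1]]; rewrite gE; last exact: chart_relpt.
  rewrite /ksum /L big_map mevalE mulr_suml; apply: eq_bigr => m _ /=.
  rewrite kernE -mulrA; set x := z _.
  have xE := zE u0 u1; rewrite -/x in xE.
  have xl : xv x l = 1 - \sum_(i <- ns) u i by rewrite xE eqxx.
  have xn i : i \in ns -> xv x i = u i.
    move=> ins; rewrite xE ins; case: eqP => // il.
    by move: uns; rewrite /= -il ins.
  case: ifPn => [/allP mN|/allPn[i _]]; last first.
    rewrite negb_or => /andP[iN mi]; rewrite (bigD1 i)//= (xE i).
    move: iN; rewrite NE in_cons negb_or => /andP[/negbTE -> /negbTE ->].
    by rewrite expr0n (negbTE mi) !mul0r mulr0.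
  congr (_ * _); rewrite /weight bigN (bigID (mem N)) /=.
  rewrite [X in _ * X * _]big1 => [|i iN]; last first.
    by have := mN i (mem_enum _ _); rewrite (negbTE iN) => /eqP ->.
  rewrite mulr1 bigN xl mulrACA mulrC; congr (_ * _).
    rewrite -big_split; rewrite big_seq [RHS]big_seq; apply: eq_bigr => i ins /=.
    rewrite xn// powRD ?lt0r_neq0 ?implybT ?u0// mulrC powR_mulrn//.
    exact/ltW/u0.
  rewrite powRD ?lt0r_neq0 ?implybT ?subr_gt0// mulrC powR_mulrn//.
  by rewrite subr_ge0 ltW.
have [E1 E2] := sint_ksum ltr01 wL hE; split.
  rewrite E1 /L big_map /Lam /linform mulr_sumr; apply: eq_bigr => m _ /=.
  rewrite powR1 mulr1 /mom.
  have Se : \sum_i (e i + 1) = \sum_(i <- ns) (e i + 1) + (e l + 1).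
    rewrite (bigID (mem N)) /= [X in _ + X]big1 ?addr0 => [|i /eN' ->]; last first.
      by rewrite addNr.
    by rewrite bigN [LHS]addrC.
  have Se0 : 0 < \sum_i (e i + 1).
    have := dexp_gt (a := [seq e i | i <- ns]) (b := e l).
    rewrite Se /dexp big_map all_map => /(_ ens el); lra.
  case: ifPn => [mN|/allPn[i _]]; last first.
    rewrite negb_or => /andP[iN mi]; rewrite (bigD1 i)//= (eN' iN) addNr.
    by case: (m i) mi => // n _; rewrite rfSl !mul0r !mulr0.
  rewrite mulrCA; congr (_ * _).
  rewrite mulrA (eq_bigr (fun i => if i \in N then rf (e i + 1) (m i) else 1)) => [|i _].
    have H := bigN *%R (fun i => rf (e i + 1) (m i)); rewrite /= mulrC in H.
    rewrite -big_mkcond /= H -(dirC_mom m ens el) Se (mdegN mN).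
    by rewrite mulfK// lt0r_neq0// rf_gt0// -Se.
  case: ifPn => // iN; have := allP mN i (mem_enum _ _).
  by rewrite (negbTE iN) => /eqP ->; rewrite rf0.
move=> g0; have [|H1 H2] := E2.
  by move=> _ /osim_chart[u -> [u0 u1]]; apply: g0; exact: chart_relpt.
split => // I0 x /relpt_chart[u0 u1 <-]; apply: (H2 I0); rewrite osimE u1 andbT.
exact/allP.
Qed.

End Chart.
End Faces.

Section FaceIntegrals.
Variables (R : realType) (d : nat).
Local Notation idx := 'I_d.+2.
Local Notation pt := 'rV[R]_d.
Local Notation Q := {mpoly R[d.+2]}.
Implicit Types (e : idx -> R) (x : pt) (I : {set idx}) (F : Q).

Lemma embed_map (fr : seq 'I_d) (v : 'I_d -> R) j :
  embed fr [seq v i | i <- fr] ord0 j = if j \in fr then v j else 0.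
Proof.
rewrite mxE; case: ifPn => // jfr.
by rewrite (nth_map j) ?index_mem// nth_index.
Qed.

Lemma xv_embed (fr : seq 'I_d) (v : 'I_d -> R) i : uniq fr ->
  xv (embed fr [seq v j | j <- fr]) i =
  if i == ord_max then 1 - \sum_(j <- fr) v j
  else \sum_(j <- fr | ix j == i) v j.
Proof.
move=> ufr; case: (idx_cases i) => [->|->|[j ->]].
- by rewrite xv0 ord0_neqM big_pred0// => j; exact: ix_neq0.
- rewrite xvM eqxx; congr (_ - _); rewrite (eq_bigr _ (fun j _ => embed_map fr v j)).
  by rewrite -big_mkcond /= [RHS]big_uniq.
- rewrite xv_ix ix_neqM embed_map; case: ifPn => jfr.
    rewrite big_mkcond (bigD1_seq j)//= eqxx big1 ?addr0// => l lj.
    by rewrite (inj_eq (@ix_inj d)) (negbTE lj).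
  rewrite big_mkcond big_seq big1// => l lfr; rewrite (inj_eq (@ix_inj d)).
  by case: eqP => // lj; rewrite -lj lfr in jfr.
Qed.

Lemma mem_free I j : (j \in Defs.free I) = (ix j \notin I).
Proof. by rewrite mem_filter mem_enum andbT. Qed.

Lemma free_uniq I : uniq (Defs.free I).
Proof. exact/filter_uniq/enum_uniq. Qed.

(** Only the sign of [K], the total mass, matters for orthogonality and definiteness; this is why it
    is left abstract later. *)
Definition face_chart I e (K : R) : Prop :=
  0 < K /\ forall F (g : pt -> R),
  (forall x, relpt (faceN I) x -> g x = F.@[xv x] * weight (faceN I) e x) ->
  face_int I g = K * Lam e F /\
  ((forall x, relpt (faceN I) x -> 0 <= g x) -> 0 <= face_int I g /\
   (face_int I g = 0 -> forall x, relpt (faceN I) x -> g x = 0)).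

Lemma face_chartE I e : faceN I != finset.set0 ->
  (forall i, i \in faceN I -> -1 < e i) ->
  (forall i, i \notin faceN I -> e i = -1) -> exists K, face_chart I e K.
Proof.
move=> N0 eN eN'.
have dirC0 (ns : seq idx) l : faceN I =i l :: ns -> 0 < dirC [seq e i | i <- ns] (e l).
  move=> NE; apply: dirC_gt0; last by rewrite eN// NE mem_head.
  by rewrite all_map; apply/allP => i ins /=; rewrite eN// NE in_cons ins orbT.
have [mI|mI] := boolP (ord_max \in I); last first.
  pose ns := [seq ix j | j <- Defs.free I].
  have uns : uniq (ord_max :: ns).
    rewrite /= map_inj_uniq ?free_uniq ?andbT; last exact: ix_inj.
    by apply/mapP => -[j _ /esym/eqP]; rewrite ix_neqM.
  have NE : faceN I =i ord_max :: ns.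
    move=> i; rewrite inE in_cons; case: (idx_cases i) => [->|->|[j ->]].
    - by rewrite eqxx ord0_neqM; apply/esym/mapP => -[j _ /esym/eqP]; rewrite ix_neq0.
    - by rewrite eqxx mI.
    - by rewrite ix_neq0 ix_neqM mem_map ?mem_free//; exact: ix_inj.
  exists (dirC [seq e i | i <- ns] (e ord_max)); split; first exact: dirC0.
  move=> F g gE; rewrite /face_int mI -(size_map (@ix d) (Defs.free I)).
  apply: (chart_sint uns NE) => // u u0 u1 i.
  rewrite -map_comp xv_embed ?free_uniq// big_map; case: eqP => // _.
  case: ifPn => [/mapP[j jf ->]|ins].
    rewrite big_mkcond (bigD1_seq j) ?free_uniq//= eqxx big1 ?addr0// => l lj.
    by rewrite (inj_eq (@ix_inj d)) (negbTE lj).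
  rewrite big_mkcond big_seq big1// => j jf; case: eqP => // ji.
  by move: ins; rewrite -ji map_f.
rewrite /face_chart /face_int mI /=.
(* Nonemptiness of the face excludes the default value 0 in [face_int]. *)
have : Defs.free I != [::].
  apply: contraNneq N0 => f0; apply/eqP/setP => i; rewrite !inE.
  case: (idx_cases i) => [->|->|[j ->]]; rewrite ?eqxx ?mI ?andbF//.
  by rewrite -mem_free f0 andbF.
have := free_uniq I; have : forall j, j \in Defs.free I = (ix j \notin I) by exact: mem_free.
case/lastP: (Defs.free I) => // fr jl frE; rewrite rcons_uniq => /andP[jlf ufr] _.
pose ns := [seq ix j | j <- fr].
have uns : uniq (ix jl :: ns).
  by rewrite /= map_inj_uniq ?ufr ?andbT ?mem_map//; exact: ix_inj.
have NE : faceN I =i ix jl :: ns.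
  move=> i; rewrite inE in_cons; case: (idx_cases i) => [->|->|[j ->]].
  - rewrite eqxx eq_sym ix_neq0; apply/esym/mapP => -[j _ /esym/eqP].
    by rewrite ix_neq0.
  - rewrite eq_sym ord0_neqM mI eq_sym ix_neqM; apply/esym/mapP => -[j _ /esym/eqP].
    by rewrite ix_neqM.
  - rewrite ix_neq0 -frE mem_rcons in_cons (inj_eq (@ix_inj d)) mem_map//.
    exact: ix_inj.
exists (dirC [seq e i | i <- ns] (e (ix jl))); split; first exact: dirC0.
move=> F g gE; rewrite size_rcons succnK -(size_map (@ix d) fr).
have -> (A : Type) (a b : A) : (if rcons fr jl is [::] then a else b) = b.
  by case: (fr).
pose z (y : seq R) := embed (rcons fr jl) (rcons y (1 - \sum_(t <- y) t)).
have := chart_sint (z := z) uns NE _ eN eN' gE; apply => u u0 u1 i.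
(* On |x| = 1 the last free coordinate takes over the role of x_{d+1}: it is 1 minus the sum of the
   others, and x_{d+1} itself is 0. *)
pose v j := if j == jl then 1 - \sum_(i <- ns) u i else u (ix j).
have -> : z [seq u i | i <- ns] = embed (rcons fr jl) [seq v j | j <- rcons fr jl].
  rewrite /z map_rcons big_map {2}/v eqxx; congr (embed _ (rcons _ _)).
  rewrite -map_comp; apply/eq_in_map => j jf /=; rewrite /v.
  by case: eqP => // jE; rewrite -jE jf in jlf.
have ufr' : uniq (rcons fr jl) by rewrite rcons_uniq jlf.
have Sv : \sum_(j <- fr) v j = \sum_(i <- ns) u i.
  rewrite big_map big_seq [RHS]big_seq; apply: eq_bigr => j jf; rewrite /v.
  by case: eqP => // jE; rewrite -jE jf in jlf.
rewrite xv_embed// -cats1 !big_cat /= !big_cons !big_nil !addr0 Sv {1 3}/v eqxx.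
rewrite [_ == i]eq_sym; case: (eqVneq i ord_max) => [->|im].
  rewrite eq_sym ix_neqM addrC subrK subrr; case: ifPn => // /mapP[j _ /esym/eqP].
  by rewrite ix_neqM.
case: eqP => [->|/eqP il].
  rewrite big_mkcond big_seq big1 ?add0r// => j jf; rewrite (inj_eq (@ix_inj d)).
  by case: eqP => // jE; rewrite -jE jf in jlf.
rewrite addr0; case: ifPn => [/mapP[j jf ->]|ins].
  rewrite big_mkcond (bigD1_seq j)//= eqxx big1 ?addr0 => [|l lj].
    by rewrite /v; case: eqP => // jE; rewrite -jE jf in jlf.
  by rewrite (inj_eq (@ix_inj d)) (negbTE lj).
rewrite big_mkcond big_seq big1// => j jf; case: eqP => // ji.
by move: ins; rewrite -ji map_f.
Qed.

End FaceIntegrals.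

(** * From barycentric variables to Cartesian coordinates *)

Section Barycentric.
Variables (R : realType) (d : nat).
Local Notation idx := 'I_d.+2.
Local Notation pt := 'rV[R]_d.
Local Notation Q := {mpoly R[d.+2]}.
Local Notation poly := {mpoly R[d]}.
Implicit Types (e : idx -> R) (x : pt) (N I J : {set idx}) (F G : Q) (p q : poly).

Definition rho F : poly := mmap (@mpolyC d R) (@xc R d) F.

Lemma rhoD : {morph rho : F G / F + G}. Proof. exact: raddfD. Qed.
Lemma rhoB : {morph rho : F G / F - G}. Proof. exact: raddfB. Qed.
Lemma rhoM : {morph rho : F G / F * G}. Proof. exact: rmorphM. Qed.
Lemma rho0 : rho 0 = 0. Proof. exact: raddf0. Qed.
Lemma rho1 : rho 1 = 1. Proof. exact: rmorph1. Qed.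
Lemma rhoZ c F : rho (c *: F) = c *: rho F.
Proof. by rewrite /rho mmapZ mul_mpolyC. Qed.
Lemma rhoC c : rho c%:MP = c%:MP. Proof. exact: mmapC. Qed.
Lemma rho_exp F k : rho (F ^+ k) = rho F ^+ k. Proof. exact: rmorphXn. Qed.
Lemma rho_sum (T : Type) (r : seq T) (P : pred T) (F : T -> Q) :
  rho (\sum_(i <- r | P i) F i) = \sum_(i <- r | P i) rho (F i).
Proof. exact: raddf_sum. Qed.
Lemma rho_prod (T : Type) (r : seq T) (P : pred T) (F : T -> Q) :
  rho (\prod_(i <- r | P i) F i) = \prod_(i <- r | P i) rho (F i).
Proof. exact: rmorph_prod. Qed.
Lemma rhoXU (i : idx) : rho 'X_i = xc R i.
Proof. by rewrite /rho mmapX mmap1U. Qed.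
Lemma rhoX m : rho 'X_[m] = \prod_i xc R i ^+ m i.
Proof. by rewrite /rho mmapX. Qed.

Lemma xc0 : xc R (ord0 : idx) = 0.
Proof. by rewrite /xc ord0_neqM sum_ix0. Qed.
Lemma xcM : xc R (ord_max : idx) = 1 - \sum_(j < d) 'X_j.
Proof. by rewrite /xc eqxx. Qed.
Lemma xc_ix (j : 'I_d) : xc R (ix j) = 'X_j.
Proof.
rewrite /xc ix_neqM (big_pred1 j)// => l /=.
by rewrite -[nat_of_ord (inord _)]/(nat_of_ord (ix j)) ixE eqSS.
Qed.

Lemma rho_XJ J : rho 'X_[mesym1 J] = xJ R J.
Proof.
rewrite rhoX /xJ [RHS]big_mkcond; apply: eq_bigr => i _.
by rewrite mnmE; case: (i \in J).
Qed.

Lemma rho_sX : rho (@sX R d.+2) = 1.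
Proof.
rewrite /sX rho_sum big_idx !rhoXU xc0 add0r xcM addrC.
by under [X in _ + X]eq_bigr do rewrite rhoXU xc_ix; rewrite subrK.
Qed.

Lemma ev_xc (i : idx) x : ev (xc R i) x = xv x i.
Proof.
rewrite /ev; case: (idx_cases i) => [->|->|[j ->]].
- by rewrite xc0 xv0 meval0.
- rewrite xcM xvM mevalB meval1; congr (_ - _); rewrite raddf_sum.
  by apply: eq_bigr => j _; exact: mevalXU.
- by rewrite xc_ix xv_ix mevalXU.
Qed.

Lemma evZ c p x : ev (c *: p) x = c * ev p x. Proof. exact: mevalZ. Qed.
Lemma evB p q x : ev (p - q) x = ev p x - ev q x. Proof. exact: mevalB. Qed.
Lemma ev_sum (T : Type) (r : seq T) (P : pred T) (F : T -> poly) x :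
  ev (\sum_(i <- r | P i) F i) x = \sum_(i <- r | P i) ev (F i) x.
Proof. exact: raddf_sum. Qed.

Lemma ev_rho F x : ev (rho F) x = F.@[xv x].
Proof.
elim/mpoly_lin_ind: F => [m|c F IH|F G IHF IHG].
- rewrite rhoX mevalX /ev rmorph_prod; apply: eq_bigr => i _ /=.
  by rewrite rmorphXn /= -/(ev _ x) ev_xc.
- by rewrite rhoZ /ev !mevalZ -/(ev _ x) IH.
- by rewrite rhoD /ev !mevalD -!/(ev _ x) IHF IHG.
Qed.

Lemma mderiv1 n i : (1 : {mpoly R[n]})^`M(i) = 0.
Proof. by rewrite -mpolyC1 mderivC. Qed.

Lemma mderiv_xc (i : idx) (j : 'I_d) :
  (xc R i)^`M(j) = (i == ix j)%:R%:MP - (i == ord_max)%:R%:MP.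
Proof.
case: (idx_cases i) => [->|->|[l ->]].
- by rewrite xc0 mderiv0 eq_sym ix_neq0 ord0_neqM subrr.
- rewrite xcM mderivB mderiv1 mderiv_sum eqxx eq_sym ix_neqM; congr (_ - _).
  rewrite (bigD1 j)//= big1 => [|l lj]; last by rewrite mderivXU (negbTE lj).
  by rewrite mderivXU eqxx addr0.
- by rewrite xc_ix mderivXU ix_neqM (inj_eq (@ix_inj d)) mpolyC0 subr0.
Qed.

Lemma Dd_mul n (i r : 'I_n) (F G : {mpoly R[n]}) :
  Dd i r (F * G) = Dd i r F * G + F * Dd i r G.
Proof. by rewrite /Dd !mderivM; ring. Qed.

(** Chain rule: x_{d+1} = 1 - |x| has derivative -1 in every direction. Both sides obey the Leibniz
    rule, so the variables suffice. *)
Lemma rho_deriv F j : (rho F)^`M(j) = rho (Dd (ix j) ord_max F).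
Proof.
pose K F := (rho F)^`M(j) = rho (Dd (ix j) ord_max F).
have K1 : K 1 by rewrite /K rho1 /Dd !mderiv1 subrr rho0.
have KM G H : K G -> K H -> K (G * H).
  rewrite /K => KG KH.
  by rewrite Dd_mul rhoM mderivM [RHS]rhoD !rhoM KG KH.
have KX i : K 'X_i.
  by rewrite /K rhoXU mderiv_xc /Dd !mderivXU rhoB !rhoC.
elim/mpoly_lin_ind: F => [m|c F IH|F G IHF IHG].
- rewrite mpolyXE_id -/(K _); elim/big_ind: _ => // i _.
  by elim: (m i) => [|k IHk]; rewrite ?expr0// exprS; exact: KM.
- by rewrite rhoZ mderivZ IH /Dd !mderivZ -scalerBr rhoZ.
- rewrite rhoD mderivD IHF IHG /Dd -rhoD !mderivD; congr rho; ring.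
Qed.

Lemma pd_ix (j : 'I_d) p : pd (ix j) p = p^`M(j).
Proof.
rewrite /pd (big_pred1 j)// => l /=.
by rewrite -[nat_of_ord (inord _)]/(nat_of_ord (ix j)) ixE eqSS.
Qed.

Lemma pd_rho i F : i != ord0 -> i != ord_max -> pd i (rho F) = rho (Dd i ord_max F).
Proof.
case: (idx_cases i) => [->|->|[j ->]]; rewrite ?eqxx// => _ _.
by rewrite pd_ix rho_deriv.
Qed.

Definition DI I F : Q := foldr (fun i => Dd i ord_max) F (enum I).

Lemma pdI_rho I F : ord0 \notin I -> ord_max \notin I -> pdI I (rho F) = rho (DI I F).
Proof.
move=> I0 IM; rewrite /pdI /DI.
have : all (fun i => (i != ord0) && (i != ord_max)) (enum I).
  apply/allP => i; rewrite mem_enum => iI; apply/andP.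
  by split; [apply: contraNneq I0|apply: contraNneq IM] => <-.
by elim: (enum I) => //= i s IHs /andP[/andP[i0 im] /IHs ->]; rewrite pd_rho.
Qed.

Lemma msize_xc (i : idx) : (msize (xc R i) <= 2)%N.
Proof.
case: (idx_cases i) => [->|->|[j ->]].
- by rewrite xc0 msize0.
- rewrite xcM (leq_trans (msizeD_le _ _))// geq_max -mpolyC1 msizeC msizeN.
  rewrite (leq_trans (leq_b1 _))//= (leq_trans (msize_sum _ _ _))//.
  by apply/bigmax_leqP_seq => j _ _; rewrite msizeX [mdeg _]mdeg1.
- by rewrite xc_ix msizeX [mdeg _]mdeg1.
Qed.

Lemma msizeM_bound p q m k : (msize p <= m.+1)%N -> (msize q <= k.+1)%N ->
  (msize (p * q) <= (m + k).+1)%N.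
Proof.
have [->|p0] := eqVneq p 0; first by rewrite mul0r msize0.
have [->|q0] := eqVneq q 0; first by rewrite mulr0 msize0.
move=> hp hq; rewrite msizeM// -subn1 leq_subLR add1n -addSn -addnS.
exact: leq_add.
Qed.

Lemma inPi_rho k F : F \is k.-homog -> inPi k (rho F).
Proof.
move=> /dhomogP hF; rewrite /inPi (mpolyE F) rho_sum.
apply: (leq_trans (msize_sum _ _ _)); apply/bigmax_leqP_seq => m mF _.
rewrite rhoZ (leq_trans (msizeZ_le _ _))// rhoX -(hF m mF) [X in (_ <= X.+1)%N]mdegE.
apply: (big_ind2 (fun p n => msize p <= n.+1)%N) => [|p n q k'|i _].
- by rewrite -mpolyC1 msizeC; exact: leq_b1.
- exact: msizeM_bound.
- elim: (m i) => [|n IHn]; first by rewrite expr0 -mpolyC1 msizeC leq_b1.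
  by rewrite exprS -add1n; exact: msizeM_bound (msize_xc i) IHn.
Qed.

(** Each monomial is padded to degree k by a power of [sX], which [rho] sends to 1. *)
Lemma homogenize k p : inPi k p -> exists2 F, F \is k.-homog & rho F = p.
Proof.
move=> hp.
pose X (m : 'X_{1..d}) : Q := \prod_j 'X_(ix j) ^+ m j.
exists (\sum_(m <- msupp p) p@_m *: (X m * (@sX R d.+2) ^+ (k - mdeg m))).
  rewrite big_seq; apply: rpred_sum => m mp; apply: rpredZ.
  have mk : (mdeg m <= k)%N.
    by have := leq_trans (msize_mdeg_lt mp) hp; rewrite ltnS.
  rewrite -[X in _ \is X.-homog](subnKC mk); apply: dhomogM; last first.
    by have := dhomogMn (k - mdeg m) (@sX_homog R d.+2); rewrite mul1n.
  rewrite mdegE /X; apply: (big_ind2 (fun (F : Q) n => F \is n.-homog)).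
  - exact: dhomog1.
  - by move=> ? ? ? ?; exact: dhomogM.
  - by move=> j _; have := dhomogMn (m j) (@dhomogU R _ (ix j)); rewrite mul1n.
rewrite rho_sum [RHS]mpolyE; apply: eq_bigr => m _.
rewrite rhoZ rhoM rho_exp rho_sX expr1n mulr1 mpolyXE_id /X rho_prod.
by congr (_ *: _); apply: eq_bigr => j _; rewrite rho_exp rhoXU xc_ix.
Qed.

Lemma Lam_homog e k F : F \is k.-homog -> Lam e F = Phi e F / rf (\sum_i (e i + 1)) k.
Proof.
move=> /dhomogP hF; rewrite /Lam /Phi /linform mulr_suml big_seq [RHS]big_seq.
by apply: eq_bigr => m /hF mk; rewrite [mdeg m]mk mulrA.
Qed.

Lemma Lam_orth e k l F G : harm e k F -> harm e l G -> k != l -> Lam e (F * G) = 0.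
Proof.
move=> hF hG kl; rewrite (Lam_homog _ (dhomogM hF.1 hG.1)).
by rewrite (harm_orth hF hG kl) mul0r.
Qed.

End Barycentric.

(** * Derivatives along lines, and polynomials vanishing on the open simplex *)

Section LineDerivatives.
Variable R : realType.
Local Open Scope classical_set_scope.
Local Open Scope ring_scope.

Lemma is_derive_line n (p : {mpoly R[n]}) (v w : 'I_n -> R) (h : R) :
  is_derive h (1 : R) (fun t : R => p.@[fun i => v i + t * w i])
    ((\sum_i w i *: p^`M(i)).@[fun i => v i + h * w i]).
Proof.
pose K p := is_derive h (1 : R) (fun t : R => p.@[fun i => v i + t * w i])
    ((\sum_i w i *: p^`M(i)).@[fun i => v i + h * w i]).
have E (a b : R) : a *: (b : R^o) = a * b by [].
have K1 : K 1.
  rewrite /K big1 ?meval0 => [|i _]; last by rewrite mderiv1 scaler0.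
  under eq_fun do rewrite meval1.
  exact: is_derive_cst.
have KM q r : K q -> K r -> K (q * r).
  rewrite /K => Kq Kr; under eq_fun do rewrite mevalM.
  apply: is_derive_eq; rewrite !E -!mevalM -mevalD; congr meval.
  rewrite mulr_sumr mulr_sumr -big_split; apply: eq_bigr => i _ /=.
  rewrite mderivM -!mul_mpolyC; ring.
have KX j : K 'X_j.
  rewrite /K (bigD1 j)//= big1 => [|i /negbTE ij]; last first.
    by rewrite mderivXU eq_sym ij mpolyC0 scaler0.
  rewrite mderivXU eqxx mpolyC1 addr0 mevalZ meval1 mulr1.
  under eq_fun do rewrite mevalXU.
  apply: is_derive_eq; rewrite !E; ring.
have KS : forall p, K p.
  apply: mpoly_lin_ind => [m|c q Kq|q r Kq Kr].
  - rewrite mpolyXE_id; elim/big_ind: _ => // i _.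
    by elim: (m i) => [|k IHk]; rewrite ?expr0// exprS; exact: KM.
  - move: Kq; rewrite /K => Kq; under eq_fun do rewrite mevalZ.
    apply: is_derive_eq; rewrite !E -mevalZ scaler_sumr.
    by congr meval; apply: eq_bigr => i _; rewrite mderivZ !scalerA mulrC.
  - move: Kq Kr; rewrite /K => Kq Kr; under eq_fun do rewrite mevalD.
    apply: is_derive_eq; rewrite -mevalD -big_split; congr meval.
    by apply: eq_bigr => i _; rewrite mderivD scalerDr.
exact: KS.
Qed.

Lemma derive_line d (f : 'rV[R]_d -> R) (x v : 'rV[R]_d) :
  'D_v f x = 'D_1 (fun t : R => f (x + t *: v)) 0.
Proof.
rewrite /derive; set F := (X in lim (X @ _)); set G := (X in _ = lim (X @ _)).
suff -> : F = G by [].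
apply/funext => h; rewrite /F /G /= addr0 scale0r addr0 [x + _]addrC.
by have -> : h *: (1 : R^o) = h by exact: mulr1.
Qed.

Lemma near0_mulrl_lt (a b : R) : 0 < b -> \forall t \near (0 : R), t * a < b.
Proof.
move=> b0; have : (fun t : R => t * a) @ (0 : R) --> (0 : R).
  have := @mulrr_continuous R a 0.
  by rewrite /continuous_at mul0r.
by move/cvgr_lt => /(_ b b0).
Qed.

Lemma interior_T_line d (x v : 'rV[R]_d) : interior_T x ->
  \forall t \near (0 : R), interior_T (x + t *: v).
Proof.
move=> [x0 x1].
have H1 : \forall t \near (0 : R), forall j, t * - v ord0 j < x ord0 j.
  apply: (@filter_forall _ _ (fun j t => t * - v ord0 j < x ord0 j) (nbhs (0 : R))) => j.
  exact: near0_mulrl_lt _ (x0 j).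
have H2 := near0_mulrl_lt (\sum_(j < d) v ord0 j) x1.
apply: filterS2 H1 H2 => t h1 h2; split=> [j|].
  by have := h1 j; rewrite !mxE mulrN -subr_gt0 opprK.
have -> : \sum_(j < d) (x + t *: v) ord0 j =
    \sum_(j < d) x ord0 j + t * \sum_(j < d) v ord0 j.
  by rewrite mulr_sumr -big_split; apply: eq_bigr => j _; rewrite !mxE.
by lra.
Qed.

Lemma interior_T_center d : interior_T (\row_(j < d) d.+1%:R^-1 : 'rV[R]_d).
Proof.
have d0 : 0 < d.+1%:R^-1 :> R by rewrite invr_gt0 ltr0n.
split=> [j|]; first by rewrite mxE.
rewrite (eq_bigr (fun=> d.+1%:R^-1)) => [|j _]; last by rewrite mxE.
rewrite sumr_const card_ord -[_ *+ d]mulr_natl subr_gt0.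
by rewrite ltr_pdivrMr ?ltr0n// mul1r ltr_nat.
Qed.

Lemma msize_deriv n (p : {mpoly R[n]}) i : (msize p^`M(i) <= (msize p).-1)%N.
Proof.
rewrite msizeE; apply/bigmax_leqP_seq => m mp _.
have : (m + U_(i))%MM \in msupp p.
  move: mp; rewrite !mcoeff_msupp mcoeff_deriv; apply: contraNneq => ->.
  by rewrite mul0rn.
by move/msize_mdeg_lt; rewrite mdegD mdeg1 addn1; case: (msize p).
Qed.

(** The partial derivatives also vanish on the open simplex, hence are 0 by induction on the size; p
    is then constant, and its value at the centre is 0. *)
Lemma interior_eq0 d (p : {mpoly R[d]}) :
  (forall x, interior_T x -> ev p x = 0) -> p = 0.
Proof.
have [n] := ubnP (msize p); elim: n p => // n IHn p pn p0.
have dp j : p^`M(j) = 0.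
  have [->|pz] := eqVneq p 0; first by rewrite mderiv0.
  apply: IHn.
    apply: (leq_ltn_trans (msize_deriv p j)); move: pn pz.
    by rewrite -msize_poly_eq0; case: (msize p).
  move=> x xT; pose w (i : 'I_d) : R := (i == j)%:R.
  have [_] := is_derive_line p (fun i => x ord0 i) w 0.
  rewrite (@near_eq_derive _ _ _ _ (cst 0)); last first.
    have := @interior_T_line _ x (\row_i w i) xT.
    apply: filterS => t /p0; rewrite /ev /= => <-.
    by apply: meval_eq => i; rewrite !mxE.
  rewrite derive_cst => /esym; rewrite /ev => H; rewrite -[RHS]H.
  rewrite (bigD1 j)//= /w eqxx scale1r big1 ?addr0 => [|i /negbTE ->]; last exact: scale0r.
  by apply: meval_eq => i; rewrite mul0r addr0.
have pC : p = (p@_0%MM)%:MP.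
  apply/mpolyP => m; rewrite mcoeffC; have [->|m0] := eqVneq m 0%MM; first by rewrite mulr1.
  have [i mi] : exists i, (0 < m i)%N.
    apply/existsP; apply: contraNT m0 => /existsPn H; apply/eqP/mnmP => i.
    by rewrite mnm0E; have := H i; lia.
  have := congr1 (mcoeff (m - U_(i))%MM) (dp i).
  rewrite mcoeff_deriv mcoeff0 submK ?lep1mP -?lt0n// => /eqP.
  by rewrite mulrn_eq0 /= mulr0 => /eqP.
have := p0 _ (interior_T_center d); rewrite pC /ev mevalC => ->.
by rewrite mpolyC0.
Qed.

End LineDerivatives.

(** * Rodrigues polynomials *)

Section FreeOf.
Variables (R : realFieldType) (n : nat).
Implicit Types (p q : {mpoly R[n]}) (N : {set 'I_n}).

Definition supported N p : Prop := forall j, j \notin N -> p^`M(j) = 0.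

Lemma supportedP N p : supported N p <->
  (forall (m : 'X_{1..n}) j, j \notin N -> (0 < m j)%N -> p@_m = 0).
Proof.
split=> [h m j jN mj|h j jN].
  have := congr1 (mcoeff (m - U_(j))%MM) (h j jN).
  rewrite mcoeff_deriv mcoeff0 submK ?lep1mP -?lt0n// => /eqP.
  by rewrite mulrn_eq0 /= => /eqP.
apply/mpolyP => m; rewrite mcoeff_deriv mcoeff0 (h _ j jN) ?mul0rn//.
by rewrite mnmDE mnm1E eqxx addn1.
Qed.

Lemma supportedD N p q : supported N p -> supported N q -> supported N (p + q).
Proof. by move=> hp hq j jN; rewrite mderivD hp// hq// addr0. Qed.

Lemma supportedZ N c p : supported N p -> supported N (c *: p).
Proof. by move=> hp j jN; rewrite mderivZ hp// scaler0. Qed.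

Lemma supported0 N : supported N 0.
Proof. by move=> j _; rewrite mderiv0. Qed.

Lemma supported_sum N (I : Type) (r : seq I) (P : pred I) (F : I -> {mpoly R[n]}) :
  (forall i, P i -> supported N (F i)) -> supported N (\sum_(i <- r | P i) F i).
Proof.
by move=> h; elim/big_ind: _ => //; [exact: supported0|exact: supportedD].
Qed.

Lemma supported_raise N e i r p : i \in N -> r \in N -> supported N p ->
  supported N (raise e i r p).
Proof.
move=> iN rN hp j jN.
have ji : (i == j) = false by apply: contraNF jN => /eqP <-.
have jr : (r == j) = false by apply: contraNF jN => /eqP <-.
have C q l k : q^`M(l)^`M(k) = q^`M(k)^`M(l) by rewrite mderiv_comm.
rewrite /raise /Dd -!mul_mpolyC.
rewrite !(mderivD, mderivB, mderivN, mderivM, mderivXU, mderivC) ji jr.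
by rewrite (C _ i j) (C _ r j) (hp j jN) !mderiv0 !mpolyC0; ring.
Qed.

(** Directions are listed with multiplicity. The outermost operator uses [e], the inner ones the
    parameters raised by the operators outside them. *)
Fixpoint rods e r (s : seq 'I_n) : {mpoly R[n]} :=
  if s is i :: s' then raise e i r (rods (eU e i r) r s') else 1.

Fixpoint eUs (e : 'I_n -> R) r (s : seq 'I_n) : 'I_n -> R :=
  if s is i :: s' then eUs (eU e i r) r s' else e.

Lemma eUsE e r s j : r \notin s ->
  eUs e r s j = e j + (count_mem j s)%:R + (if j == r then (size s)%:R else 0).
Proof.
elim: s e => [|i s IHs] e /=; first by rewrite addr0 if_same addr0.
rewrite in_cons negb_or => /andP[ri rs]; rewrite IHs// /eU natrD [j == i]eq_sym.
have [->|_] := eqVneq j r; last by rewrite !addr0; ring.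
by rewrite [i == r]eq_sym (negbTE ri) -(natr1 (size s)) /=; ring.
Qed.

Lemma harm_rods e r s : r \notin s -> harm e (size s) (rods e r s).
Proof.
elim: s e => [|i s IHs] e /=.
  move=> _; split; first exact: dhomog1.
  exact/lap_homog0/dhomog1.
rewrite in_cons negb_or => /andP[ri rs]; apply: harm_raise; last exact: IHs.
by rewrite eq_sym.
Qed.

Lemma supported_rods N e r s : {subset s <= N} -> r \in N -> supported N (rods e r s).
Proof.
move=> + rN; elim: s e => [|i s IHs] e sN /=.
  by move=> j _; rewrite -mpolyC1 mderivC.
apply: supported_raise => //; first exact/sN/mem_head.
by apply: IHs => j js; apply: sN; rewrite in_cons js orbT.
Qed.

(** Modulo X_r, [raise e i r] is multiplication by -(e r + 1) X_i, and the parameter at r stays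
    above -1 along the recursion, so the product of these scalars is nonzero. *)
Lemma rods_lead e r s : r \notin s -> -1 < e r ->
  exists k G, k != 0 /\ rods e r s = k *: 'X_[\sum_(i <- s) U_(i)] + 'X_r * G.
Proof.
elim: s e => [|i s IHs] e /=.
  by move=> _ _; exists 1, 0; rewrite oner_neq0 big_nil mpolyX0 mulr0 addr0 scale1r.
rewrite in_cons negb_or => /andP[ri rs] er.
have er' : -1 < eU e i r r.
  by rewrite /eU eqxx (negbTE ri) addr0; apply: ltr_wpDr.
have [k [G [k0 ->]]] := IHs _ rs er'.
set M := 'X_[_]; exists (- (e r + 1) * k).
exists ('X_i * Dd i r (k *: M + 'X_r * G) + (e i + 1) *: (k *: M + 'X_r * G)
  - (e r + 1) *: ('X_i * G)); split.
  by rewrite mulf_neq0// oppr_eq0; apply: lt0r_neq0; lra.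
rewrite big_cons mpolyXD -/M /raise -!mul_mpolyC rmorphM /= rmorphN /=; ring.
Qed.

End FreeOf.

Section Rodrigues.
Variables (R : realType) (d : nat).
Local Open Scope classical_set_scope.
Local Open Scope ring_scope.
Local Notation idx := 'I_d.+2.
Local Notation pt := 'rV[R]_d.
Local Notation Q := {mpoly R[d.+2]}.
Local Notation poly := {mpoly R[d]}.
Variable S : {set idx}.
Hypothesis S_small : (#|S| < d)%N.
Hypothesis S0 : ord0 \notin S.
Let r := rch S.
Let A := Aset S.
Let N := faceN S.

Lemma gt0_idx (i : idx) : (0 < i)%N = (i != ord0).
Proof. by rewrite lt0n. Qed.

Lemma rch_in : r \in N.
Proof.
rewrite /r /rch; case: ifPn => mS; first by rewrite inE mS andbT.
set s := seq.filter _ _.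
suff : head ord_max s \in s by rewrite mem_filter inE gt0_idx => /andP[].
have : s != [::].
  apply: contraTneq S_small => s0; rewrite -leqNgt.
  have : [set: idx]%SET \subset ord0 |: S.
    apply/fintype.subsetP => i _; rewrite !inE; case: eqVneq => //= i0.
    apply: contraT => iS; have : i \in s by rewrite mem_filter gt0_idx i0 iS mem_enum.
    by rewrite s0.
  move/subset_leq_card; rewrite cardsT card_ord cardsU1 S0 => h; lia.
by case: s => //= i s _; exact: mem_head.
Qed.

Lemma rchM : r = ord_max \/ ord_max \in S.
Proof.
have [mS|mS] := boolP (ord_max \in S); first by right.
by left; rewrite /r /rch mS.
Qed.

Lemma AsetE : A = N :\ r.
Proof.
by apply/setP => i; rewrite !inE gt0_idx andbC -andbA andbC -!andbA andbC -!andbA.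
Qed.

Lemma in_Aset i : i \in A -> [/\ i \in N, i != r, i != ord0 & i != ord_max].
Proof.
rewrite AsetE !inE => /and3P[ir i0 iS]; rewrite i0 iS ir; split => //.
have [rM|mS] := rchM; first by rewrite -rM.
by apply: contraNneq iS => ->.
Qed.

Lemma NE : N = r |: A.
Proof. by rewrite AsetE finset.setD1K// rch_in. Qed.

Definition wdir i j : R := (j == i)%:R - (j == r)%:R.

Lemma xv_line (x : pt) t i j : i \in A ->
  xv (x + t *: (dirv R i - dirv R r)) j = xv x j + t * wdir i j.
Proof.
move=> /in_Aset[iN ir i0 iM].
have r0 : r != ord0 by have := rch_in; rewrite inE => /andP[].
have dv k l : dirv R k ord0 l = (ix l == k)%:R.
  by rewrite mxE -(ixE l).
case: (idx_cases j) => [->|->|[l ->]].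
- by rewrite !xv0 /wdir ![ord0 == _]eq_sym (negbTE i0) (negbTE r0) subrr mulr0 addr0.
- rewrite !xvM /wdir.
  have Sd k : k != ord0 -> \sum_(l < d) (dirv R k) ord0 l = (k != ord_max)%:R.
    case: (idx_cases k) => [->|->|[l ->]]; rewrite ?eqxx// => _.
      by rewrite big1// => l _; rewrite dv ix_neqM.
    rewrite ix_neqM (bigD1 l)//= dv eqxx big1 ?addr0// => l' l'l.
    by rewrite dv (inj_eq (@ix_inj d)) (negbTE l'l).
  have -> : \sum_(l < d) (x + t *: (dirv R i - dirv R r)) ord0 l =
     \sum_(l < d) x ord0 l + t * (1 - (r != ord_max)%:R).
    have Si : \sum_(l < d) (dirv R i) ord0 l = 1 by rewrite Sd// iM.
    rewrite -(Sd r r0) -[X in _ * (X - _)]Si.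
    rewrite -sumrB mulr_sumr -big_split; apply: eq_bigr => l _.
    by rewrite !mxE.
  rewrite ![ord_max == _]eq_sym (negbTE iM); case: (r == ord_max) => /=; ring.
- by rewrite !xv_ix !mxE -!(ixE l) /wdir.
Qed.

Lemma interior_xv (x : pt) i : interior_T x -> i != ord0 -> 0 < xv x i.
Proof.
move=> [x0 x1]; case: (idx_cases i) => [->|->|[j ->]]; rewrite ?eqxx// => _.
- by rewrite xvM.
- by rewrite xv_ix.
Qed.

(** Here the algebraic [raise] meets the analytic derivative; the powers are differentiable because
    all coordinates are positive on the open simplex. *)
Lemma Dop_weight e i (G : Q) (f : pt -> R) : i \in A ->
  (forall x, interior_T x -> f x = weight N (eU e i r) x * G.@[xv x]) ->
  forall x, interior_T x -> Dop S i f x = weight N e x * (raise e i r G).@[xv x].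
Proof.
move=> iA fE x xT; have [iN ir i0 iM] := in_Aset iA.
have rN : r \in N by exact: rch_in.
have r0 : r != ord0 by move: rN; rewrite inE => /andP[].
rewrite /Dop derive_line -/r; set v := dirv R i - dirv R r.
have xi := interior_xv xT i0; have xr := interior_xv xT r0.
(* The factors at indices other than i and r are constant along the line. *)
pose C := \prod_(j in N :\ r :\ i) xv x j `^ e j.
have wE (y : pt) (e' : idx -> R) : (forall j, j \in N :\ r :\ i -> xv y j `^ e' j = xv x j `^ e j) ->
    weight N e' y = C * (xv y i `^ e' i * xv y r `^ e' r).
  have iNr : i \in N :\ r by rewrite finset.in_setD1 ir iN.
  move=> h; rewrite /weight (big_setD1 r rN) /= (big_setD1 i iNr) /=.
  by rewrite (eq_bigr _ h) -/C; ring.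
pose g t := C * ((xv x i + t) `^ (e i + 1) * (xv x r - t) `^ (e r + 1)) *
   G.@[fun j => xv x j + t * wdir i j].
transitivity ('D_(1 : R) g (0 : R)).
  apply: near_eq_derive.
  apply: filterS (interior_T_line v xT) => t tT; rewrite fE// /g.
  have H j : xv (x + t *: v) j = xv x j + t * wdir i j by exact: xv_line.
  rewrite wE => [|j]; last first.
    rewrite !inE H /eU /wdir => /and4P[/negbTE -> /negbTE -> _ _].
    by rewrite subrr mulr0 !addr0.
  rewrite !H /eU /wdir !eqxx [r == i]eq_sym (negbTE ir) !addr0 subr0 sub0r mulr1 mulrN1.
  by congr (_ * _); apply: meval_eq => j; rewrite H.
have D1 : is_derive (0 : R) (1 : R) (fun t => (xv x i + t) `^ (e i + 1)) ((e i + 1) * xv x i `^ (e i)).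
  have Ds : is_derive (0 : R) (1 : R) (fun t : R => xv x i + t) 1.
    by apply: is_derive_eq; ring.
  have xi0 : 0 < xv x i + 0 by rewrite addr0.
  have Dp := is_derive1_powR (e i + 1) xi0.
  have := @is_derive1_comp _ (fun v => v `^ (e i + 1)) (fun t => xv x i + t) _ _ _ Dp Ds.
  by rewrite mulr1 addr0 addrK.
have D2 : is_derive (0 : R) (1 : R) (fun t => (xv x r - t) `^ (e r + 1)) (- ((e r + 1) * xv x r `^ (e r))).
  have Ds : is_derive (0 : R) (1 : R) (fun t : R => xv x r - t) (-1).
    by apply: is_derive_eq; ring.
  have xr0 : 0 < xv x r - 0 by rewrite subr0.
  have Dp := is_derive1_powR (e r + 1) xr0.
  have := @is_derive1_comp _ (fun v => v `^ (e r + 1)) (fun t => xv x r - t) _ _ _ Dp Ds.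
  by rewrite mulrN1 subr0 addrK.
have D3 := is_derive_line G (xv x) (wdir i) 0.
have Dg : is_derive (0 : R) (1 : R) g (weight N e x * (raise e i r G).@[xv x]).
  have E (a b : R) : a *: (b : R^o) = a * b by [].
  apply: is_derive_eq; rewrite !E.
  have ev0 (p : Q) : p.@[fun j => xv x j + 0 * wdir i j] = p.@[xv x].
    by apply: meval_eq => j; rewrite mul0r addr0.
  rewrite !ev0.
  have -> : \sum_j wdir i j *: G^`M(j) = Dd i r G.
    rewrite (bigD1 i)//= (bigD1 r) 1?eq_sym//= /wdir !eqxx (negbTE ir) [r == i]eq_sym (negbTE ir).
    rewrite big1 => [|j /andP[/negbTE -> /negbTE ->]]; last by rewrite subrr scale0r.
    by rewrite subr0 sub0r scale1r scaleN1r addr0.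
  rewrite (wE x e)// addr0 subr0 /raise; move: (Dd i r G) => DG; rewrite mevalD !mevalM mevalB !mevalZ !mevalXU.
  rewrite !powRD ?lt0r_neq0 ?implybT// !powRr1 ?ltW//; ring.
by have [_ ->] := Dg.
Qed.

Variable eps : nat -> R.
Hypothesis eps1 : forall i : idx, i \in N -> -1 < eps i.
Let e (i : idx) : R := eps i.

Definition rodseq m (mv : {ffun idx -> 'I_m.+1}) : seq idx :=
  flatten [seq nseq (mv i) i | i <- enum A].

Lemma count_rodseq m (mv : {ffun idx -> 'I_m.+1}) i :
  count_mem i (rodseq mv) = if i \in A then (mv i : nat) else 0%N.
Proof.
rewrite /rodseq -mem_enum; have := enum_uniq A; elim: (enum A) => //= j s IHs.
move=> /andP[js /IHs]; rewrite count_cat count_nseq /= in_cons => ->.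
have [->|ij] := eqVneq i j; first by rewrite (negbTE js) /= mul1n addn0.
by rewrite mul0n.
Qed.

Lemma rodseq_sub m (mv : {ffun idx -> 'I_m.+1}) : {subset rodseq mv <= A}.
Proof.
move=> i; rewrite -has_pred1 has_count count_rodseq.
by case: ifP.
Qed.

Lemma rch_notin m (mv : {ffun idx -> 'I_m.+1}) : r \notin rodseq mv.
Proof. by apply/negP => /rodseq_sub; rewrite AsetE !inE eqxx. Qed.

Lemma size_rodseq m (mv : {ffun idx -> 'I_m.+1}) : mindex S mv -> size (rodseq mv) = m.
Proof.
move=> /andP[/forallP h /eqP hm]; rewrite -[RHS]hm.
rewrite size_flatten /shape -map_comp sumnE big_map big_enum /= [RHS](bigID (mem A)) /= [X in _ = (_ + X)%N]big1 ?addn0.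
  by apply: eq_bigr => i _; rewrite size_nseq.
by move=> i iA; have := h i; rewrite iA => /eqP.
Qed.

Lemma Dop_seq (s : seq idx) e' (f : pt -> R) : {subset s <= A} ->
  (forall x, interior_T x -> f x = weight N (eUs e' r s) x) ->
  forall x, interior_T x ->
    foldr (fun i g => Dop S i g) f s x = weight N e' x * (rods e' r s).@[xv x].
Proof.
elim: s e' => [|i s IHs] e' sA fE x xT /=; first by rewrite fE// meval1 mulr1.
apply: Dop_weight => //; first exact/sA/mem_head.
by apply: IHs => // j js; apply: sA; rewrite in_cons js orbT.
Qed.

Lemma foldr_iter (T U : Type) (D : T -> U -> U) (k : T -> nat) (f : U) (s : seq T) :
  foldr (fun i g => iter (k i) (D i) g) f s =
  foldr D f (flatten [seq nseq (k i) i | i <- s]).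
Proof.
elim: s => //= i s ->; rewrite foldr_cat; elim: (k i) => //= l ->.
by [].
Qed.

Lemma Rod_rho m (mv : {ffun idx -> 'I_m.+1}) x : mindex S mv -> interior_T x ->
  Rod eps S mv x = ev (rho (rods e r (rodseq mv))) x.
Proof.
move=> hmv xT; rewrite /Rod foldr_iter -/(rodseq mv) -/A.
rewrite (Dop_seq (e' := e)) => //; [|exact: rodseq_sub|move=> {xT}x xT].
  rewrite ev_rho mulrA /weight -/r -/A -NE -big_split big1 ?mul1r// => i iN /=.
  have i0 : i != ord0 by move: iN; rewrite inE => /andP[].
  by rewrite -powRD ?addNr ?powRr0// lt0r_neq0 ?implybT// interior_xv.
have rA : r \notin A by rewrite AsetE !inE eqxx.
rewrite /weight NE big_setU1//= mulrC; congr (_ * _).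
  rewrite eUsE ?rch_notin// eqxx size_rodseq// count_rodseq (negbTE rA) addr0.
  by [].
apply: eq_bigr => i iA; rewrite eUsE ?rch_notin// count_rodseq iA.
have -> : (i == r) = false by apply: contraTF iA => /eqP ->.
by rewrite addr0.
Qed.

Definition mnm_of m (mv : {ffun idx -> 'I_m.+1}) : 'X_{1..d.+2} :=
  [multinom (mv i : nat) | i < d.+2].

Lemma rods_coeff m (mv : {ffun idx -> 'I_m.+1}) : mindex S mv ->
  exists2 k : R, k != 0 & forall a : 'X_{1..d.+2}, a r = 0%N ->
    (rods e r (rodseq mv))@_a = k * (mnm_of mv == a)%:R.
Proof.
move=> hmv; have [k [G [k0 ->]]] := rods_lead (e := e) (rch_notin mv) (eps1 rch_in).
exists k => // a ar; rewrite mcoeffD mcoeffZ mcoeffX mcoeff_XM ar /= addr0.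
congr (_ * (_ == _)%:R); apply/mnmP => i; rewrite mnm_sumE mnmE.
have -> : (\sum_(j <- rodseq mv) U_(j)%MM i)%N = count_mem i (rodseq mv).
  by elim: (rodseq mv) => [|j s IHs]; rewrite ?big_nil// big_cons IHs mnm1E.
rewrite count_rodseq; case: ifPn => // iA.
by move/andP: hmv => [/forallP/(_ i)]; rewrite iA => /eqP.
Qed.

(** For the converse, modulo X_r each Rodrigues polynomial is a nonzero multiple of one monomial. A
    combination of them therefore matches all coefficients of F without X_r, and [harm_eq0] shows
    that the difference is 0. *)
Lemma HspP m (p : poly) : Hsp eps m S p <->
  exists F, [/\ harm e m F, supported N F & p = rho F].
Proof.
rewrite /Hsp leqNgt S_small /=; split.
  move=> [c pE]; pose F := \sum_(mv | mindex S mv) c mv *: rods e r (@rodseq m mv).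
  exists F; split.
  - apply: harm_sum => mv hmv; apply: harmZ; rewrite -[X in harm e X _](size_rodseq hmv).
    exact/harm_rods/rch_notin.
  - apply: supported_sum => mv _; apply: supportedZ; apply: supported_rods.
      by move=> i /rodseq_sub /in_Aset[].
    exact: rch_in.
  - apply/eqP; rewrite -subr_eq0; apply/eqP/interior_eq0 => x xT.
    rewrite evB pE// /F rho_sum ev_sum -sumrB big1// => mv hmv /=.
    by rewrite (Rod_rho hmv xT) rhoZ evZ subrr.
move=> [F [hF sF ->]].
(* The pivot: the coefficient of a Rodrigues polynomial at its own monomial. *)
pose kap (mv : {ffun idx -> 'I_m.+1}) := (rods e r (rodseq mv))@_(mnm_of mv).
exists [ffun mv => F@_(mnm_of mv) / kap mv] => x xT.
pose G := F - \sum_(mv | mindex S mv) (F@_(mnm_of mv) / kap mv) *: rods e r (@rodseq m mv).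
suff G0 : G = 0.
  have FE : F = \sum_(mv | mindex S mv) (F@_(mnm_of mv) / kap mv) *: rods e r (@rodseq m mv).
    by apply: subr0_eq; exact: G0.
  rewrite [in LHS]FE rho_sum ev_sum; apply: eq_bigr => mv hmv /=.
  by rewrite ffunE (Rod_rho hmv xT) rhoZ evZ.
have er : 0 < e r + 1 by have := eps1 rch_in; rewrite /e; lra.
apply: (harm_eq0 (e := e) (k := m) er).
  apply: harmD => //; rewrite -scaleN1r; apply: harmZ; apply: harm_sum => mv hmv.
  apply: harmZ; rewrite -[X in harm e X _](size_rodseq hmv).
  exact/harm_rods/rch_notin.
move=> a ar; rewrite mcoeffB raddf_sum /=.
have mr mv : mindex S mv -> @mnm_of m mv r = 0%N.
  move=> /andP[/forallP/(_ r) + _]; rewrite -/A AsetE !inE eqxx /= mnmE => /eqP; exact.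
rewrite (eq_bigr (fun mv => if mnm_of mv == a then F@_a else 0)) => [|mv hmv]; last first.
  have [k k0 kE] := rods_coeff hmv.
  rewrite mcoeffZ /kap !kE ?mr// eqxx; case: eqP => [->|_]; last by rewrite !mulr0.
  by rewrite !mulr1 divfK.
rewrite -big_mkcondr /=; have [Fa|Fa] := eqVneq F@_a 0.
  by rewrite Fa big1 ?subrr.
have am : mdeg a = m by apply: (dhomogP _ _ _ hF.1); rewrite mcoeff_msupp.
have aN j : j \notin N -> a j = 0%N.
  move=> jN; apply/eqP; rewrite -leqn0 leqNgt; apply: contraNN Fa => aj.
  by have /supportedP/(_ a j jN aj) -> := sF.
have a_lt i : (a i < m.+1)%N by rewrite ltnS -am mdegE (bigD1 i)//= leq_addr.
(* Only the multi-index a itself contributes at a; it is admissible since a avoids r and F involves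
   only the variables of N. *)
pose mv : {ffun idx -> 'I_m.+1} := [ffun i => Ordinal (a_lt i)].
rewrite (big_pred1 mv) ?subrr// => mv' /=; apply/andP/eqP => [[_ /eqP aE]|->].
  by apply/ffunP => i; apply: val_inj; rewrite ffunE /= -aE mnmE.
split; last by apply/eqP/mnmP => i; rewrite mnmE ffunE.
apply/andP; split; last first.
  by apply/eqP; rewrite -[RHS]am mdegE; apply: eq_bigr => i _; rewrite ffunE.
apply/forallP => i; apply/implyP; rewrite -/A AsetE !inE ffunE /= negb_and negbK.
case/orP => [/eqP ->|iN]; first by rewrite ar.
by rewrite aN// inE.
Qed.

End Rodrigues.

(** * Orthogonality-preserving forms *)

Section Forms.
Variables (R : realType) (d : nat).
Local Notation idx := 'I_d.+2.
Local Notation pt := 'rV[R]_d.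
Local Notation Q := {mpoly R[d.+2]}.
Local Notation poly := {mpoly R[d]}.
Implicit Types (e : idx -> R) (x : pt) (I N : {set idx}) (F G : Q) (p q : poly)
  (b : poly -> poly -> R).

Definition linear_form b := forall (a : R) p q r, b (a *: p + q) r = a * b p r + b q r.

Lemma rho_onto p : exists F, rho F = p.
Proof.
have [|F _ FE] := @homogenize R d (msize p) p; first exact: leqnSn.
by exists F.
Qed.

Lemma form0l b q : linear_form b -> b 0 q = 0.
Proof. by move=> bl; have := bl (-1) 0 0 q; rewrite scaler0 addr0; lra. Qed.

Lemma formDl b p q r : linear_form b -> b (p + q) r = b p r + b q r.
Proof. by move=> bl; have := bl 1 p q r; rewrite scale1r mul1r. Qed.

(** If p = h + q is orthogonal to lower degrees, then 0 = b p q = b q q, and definiteness gives q =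
    0. *)
Lemma OP_char b n (H : poly -> Prop) :
  (forall p q, b p q = b q p) -> linear_form b -> (forall p, p != 0 -> 0 < b p p) ->
  (forall p, H p -> inPi n p) ->
  (forall p, inPi n p -> exists h q, [/\ H h, (msize q <= n)%N & p = h + q]) ->
  (forall h q, H h -> (msize q <= n)%N -> b h q = 0) ->
  forall p, H p <-> OPn b n p.
Proof.
move=> bC bl b0 Hn Hdec Horth p; split=> [Hp|[pn po]].
  by split; [exact: Hn|move=> q; exact: Horth].
have [h [q [Hh qn pE]]] := Hdec p pn.
have [q0|/b0] := eqVneq q 0; first by rewrite pE q0 addr0.
have := po q qn; rewrite pE formDl// (Horth h q Hh qn) add0r => ->.
by rewrite ltxx.
Qed.

(** For [e0] the alternatives are k <= d and k = d + 1. In the second one every linear form is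
    harmonic, which replaces [Fischer] where its constant is 0. *)
Definition tame e := 0 < \sum_i (e i + 1) \/ forall i, e i = -1.

Lemma tame_ge0 e : tame e -> 0 <= \sum_i (e i + 1).
Proof.
by case=> [/ltW//|h]; rewrite big1// => i _; rewrite h addNr.
Qed.

(** The Fischer remainder sX s has image rho s, of lower degree, because rho sX = 1. *)
Lemma harm_decomp e n p : tame e -> inPi n p ->
  exists F q, [/\ harm e n F, (msize q <= n)%N & p = rho F + q].
Proof.
move=> te pn; have [F hF FE] := homogenize pn.
case: n pn hF => [|n] pn hF.
  exists F, 0; rewrite addr0 FE msize0; split=> //; split=> //.
  exact: lap_homog0.
have [|h] := boolP ((0 < n)%N || (0 < \sum_i (e i + 1))).
  move=> /(Fischer (tame_ge0 te)) /(_ hF) [s hs hG].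
  exists (F - sX R d.+2 * s), (rho s); split => //; first exact: inPi_rho.
  by rewrite rhoB rhoM rho_sX mul1r FE subrK.
(* The case of degree 1 with sum (e i + 1) = 0: all parameters are -1, so [lap e] reduces to second
   derivatives and kills F. *)
exists F, 0; rewrite addr0 FE msize0; split=> //; split=> //.
move: h hF; rewrite negb_or -eqn0Ngt => /andP[/eqP -> e0] hF.
have eN i : e i = -1 by case: te => //; rewrite (negbTE e0).
rewrite /lap big1// => i _.
by rewrite (mderiv_homog0 i (mderiv_homog i hF)) eN addNr scale0r mulr0 addr0.
Qed.

Lemma harm_orth_ext e b p n : tame e -> linear_form b -> (forall p q, b p q = b q p) ->
  (forall m G, (m < n)%N -> harm e m G -> b p (rho G) = 0) ->
  forall q, (msize q <= n)%N -> b p q = 0.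
Proof.
move=> te bl bC; elim: n => [|n IHn] h q qn.
  have -> : q = 0 by apply/eqP; rewrite -msize_poly_eq0; rewrite leqn0 in qn.
  by rewrite bC form0l.
have [G [q' [hG qn' ->]]] := harm_decomp te qn.
rewrite bC formDl// ![b _ p]bC (h n G)// IHn ?addr0// => m H mn.
by apply: h; exact: ltnW.
Qed.

(** Only semidefiniteness is asked, since single terms of the inner product may be degenerate; the
    conditions survive nonnegative combinations, so each term is treated alone. [n0] is the degree
    from which orthogonality holds. *)
Definition good n0 e b := [/\ forall p q, b p q = b q p, linear_form b,
  forall p, 0 <= b p p &
  forall n m F G, (n0 <= n)%N -> (m < n)%N -> harm e n F -> harm e m G ->
    b (rho F) (rho G) = 0].

Lemma good_OP n0 e b n : good n0 e b -> tame e -> (forall p, p != 0 -> 0 < b p p) ->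
  (n0 <= n)%N ->
  forall p, (exists2 F, harm e n F & p = rho F) <-> OPn b n p.
Proof.
move=> [bC bl _ bo] te b0 n0n; apply: OP_char => //.
- by move=> p [F [hF _] ->]; exact: inPi_rho.
- move=> p /(harm_decomp te)[F [q [hF qn ->]]].
  by exists (rho F), q; split=> //; exists F.
- move=> h q [F hF ->]; apply: (harm_orth_ext te bl bC) => m G mn hG.
  exact: (bo n m).
Qed.

Lemma goodD n0 e b b' : good n0 e b -> good n0 e b' ->
  good n0 e (fun p q => b p q + b' p q).
Proof.
move=> [bC bl b0 bo] [bC' bl' b0' bo']; split.
- by move=> p q; rewrite bC bC'.
- by move=> a p q r; rewrite bl bl'; ring.
- by move=> p; rewrite addr_ge0.
- by move=> n m F G n0n mn hF hG; rewrite (bo n m)// (bo' n m)// addr0.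
Qed.

Lemma goodZ n0 e b c : 0 <= c -> good n0 e b -> good n0 e (fun p q => c * b p q).
Proof.
move=> c0 [bC bl b0 bo]; split.
- by move=> p q; rewrite bC.
- by move=> a p q r; rewrite bl; ring.
- by move=> p; rewrite mulr_ge0.
- by move=> n m F G n0n mn hF hG; rewrite (bo n m)// mulr0.
Qed.

Lemma good0 n0 e : good n0 e (fun _ _ => 0).
Proof. by split => // a p q r; rewrite mulr0 addr0. Qed.

Lemma good_sum n0 e (T : Type) (r : seq T) (P : pred T) (b : T -> poly -> poly -> R) :
  (forall i, P i -> good n0 e (b i)) -> good n0 e (fun p q => \sum_(i <- r | P i) b i p q).
Proof.
move=> h; elim: r => [|i r IHr].
  have -> : (fun p q => \sum_(i <- [::] | P i) b i p q) = (fun _ _ => 0).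
    by apply/funext => p; apply/funext => q; rewrite big_nil.
  exact: good0.
have -> : (fun p q => \sum_(i <- i :: r | P i) b i p q) =
   (fun p q => (if P i then b i p q else 0) + \sum_(i <- r | P i) b i p q).
  apply/funext => p; apply/funext => q; rewrite big_cons.
  by case: (P i); rewrite ?add0r.
by apply: goodD => //; case: (boolP (P i)) => [/h//|_]; exact: good0.
Qed.

Lemma good_point n0 e x :
  (forall n F, (n0 <= n)%N -> (0 < n)%N -> harm e n F -> ev (rho F) x = 0) ->
  good n0 e (fun p q => ev p x * ev q x).
Proof.
move=> h; split.
- by move=> p q; rewrite mulrC.
- by move=> a p q r; rewrite /ev mevalD mevalZ; ring.
- by move=> p; rewrite -expr2 sqr_ge0.
- move=> n m F G n0n mn hF _; rewrite (h n F)// ?mul0r//.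
  exact: leq_ltn_trans mn.
Qed.

Definition faceform I (W : pt -> R) p q := face_int I (fun x => ev p x * ev q x * W x).

Section FaceForm.
Variables (I : {set idx}) (e : idx -> R) (W : pt -> R).
Hypothesis N0 : faceN I != finset.set0.
Hypothesis eN : forall i, i \in faceN I -> -1 < e i.
Hypothesis eN' : forall i, i \notin faceN I -> e i = -1.
Hypothesis WE : forall x, relpt (faceN I) x -> W x = weight (faceN I) e x.

Lemma faceform_rho : exists2 K, 0 < K &
  forall F G, faceform I W (rho F) (rho G) = K * Lam e (F * G).
Proof.
have [K [K0 hK]] := face_chartE N0 eN eN'; exists K => // F G.
by apply: (hK _ _ _).1 => x xr; rewrite !ev_rho mevalM WE.
Qed.

Lemma faceformC p q : faceform I W p q = faceform I W q p.
Proof.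
have [K _ hK] := faceform_rho.
have [F <-] := rho_onto p; have [G <-] := rho_onto q.
by rewrite !hK mulrC [F * G]mulrC mulrC.
Qed.

Lemma faceform_linear : linear_form (faceform I W).
Proof.
move=> a p q r; have [K _ hK] := faceform_rho.
have [F <-] := rho_onto p; have [G <-] := rho_onto q; have [H <-] := rho_onto r.
rewrite -rhoZ -rhoD !hK mulrDl -scalerAl /Lam linformD linformZ; ring.
Qed.

Let weight_gt0 x : relpt (faceN I) x -> 0 < weight (faceN I) e x.
Proof. by move=> [x0 _]; apply: prodr_gt0 => i /x0 ?; exact: powR_gt0. Qed.

Lemma faceform_ge0 p : 0 <= faceform I W p p /\
  (faceform I W p p = 0 -> forall x, relpt (faceN I) x -> ev p x = 0).
Proof.
have [K [K0 hK]] := face_chartE N0 eN eN'; have [F FE] := rho_onto p.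
have gE x : relpt (faceN I) x ->
    ev p x * ev p x * W x = (F * F).@[xv x] * weight (faceN I) e x.
  by move=> xr; rewrite -FE !ev_rho mevalM WE.
have [|H1 H2] := (hK _ _ gE).2.
- move=> x xr; rewrite gE// mevalM -expr2 mulr_ge0 ?sqr_ge0// ltW//.
  exact: weight_gt0.
- split => // /H2 H x xr; have /eqP := H x xr.
  rewrite WE// mulf_eq0 (gt_eqF (weight_gt0 xr)) orbF mulf_eq0 orbb.
  by move/eqP.
Qed.

Lemma faceform_const c : faceform I W c%:MP c%:MP = 0 -> c = 0.
Proof.
have [K K0 hK] := faceform_rho.
rewrite -[c%:MP](rhoC d) hK -rmorphM /= -[(c * c)%:MP]mulr1 mul_mpolyC /Lam linformZ.
rewrite -mpolyX0 linformX mdeg0 rf0 divr1 /mom big1 => [|i _]; last by rewrite mnm0E rf0.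
rewrite mulr1 => /eqP; rewrite mulf_eq0 (gt_eqF K0) /= mulf_eq0 orbb.
by move/eqP.
Qed.

Lemma faceform_vanish p q : (forall x, relpt (faceN I) x -> ev p x = 0) ->
  faceform I W p q = 0.
Proof.
move=> p0; have [K [K0 hK]] := face_chartE N0 eN eN'.
(* The integrand vanishes on the relative interior of the face, so the zero polynomial represents
   it. *)
rewrite /faceform (hK 0 _ _).1 ?/Lam ?linform0 ?mulr0// => x xr.
by rewrite p0// meval0 !mul0r.
Qed.

Lemma good_face n0 e0 (T : poly -> poly) (D : Q -> Q) :
  (forall a p q, T (a *: p + q) = a *: T p + T q) ->
  (forall F, T (rho F) = rho (D F)) ->
  (forall n m F G, (m < n)%N -> harm e0 n F -> harm e0 m G -> Lam e (D F * D G) = 0) ->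
  good n0 e0 (fun p q => faceform I W (T p) (T q)).
Proof.
move=> Tl TD Do; split.
- by move=> p q; exact: faceformC.
- by move=> a p q r; rewrite Tl faceform_linear.
- by move=> p; have [] := faceform_ge0 (T p).
- move=> n m F G _ mn hF hG; have [K _ hK] := faceform_rho.
  by rewrite !TD hK (Do n m)// mulr0.
Qed.

End FaceForm.

Lemma pd_linear (i : idx) : i != ord0 -> i != ord_max ->
  forall (a : R) p q, pd i (a *: p + q) = a *: pd i p + pd i q.
Proof.
case: (idx_cases i) => [->|->|[j ->]]; rewrite ?eqxx// => _ _ a p q.
by rewrite !pd_ix mderivD mderivZ.
Qed.

Definition inner I := (ord0 \notin I) /\ (ord_max \notin I).

Lemma inner_in I i : inner I -> i \in I -> i != ord0 /\ i != ord_max.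
Proof. by move=> [h1 h2] iI; split; [apply: contraNneq h1|apply: contraNneq h2] => <-. Qed.

Lemma pdI_linear I : inner I ->
  forall (a : R) p q, pdI I (a *: p + q) = a *: pdI I p + pdI I q.
Proof.
move=> Ii a p q; have : {subset enum I <= I} by move=> i; rewrite mem_enum.
rewrite /pdI; elim: (enum I) => //= i s IHs sI.
have [i0 iM] := inner_in Ii (sI i (mem_head _ _)).
rewrite IHs ?pd_linear// => j js; apply: sI; rewrite in_cons js orbT //.
Qed.

(** Each of the #|I| operators in [DI I] raises the parameter at its own index and at d + 1. *)
Definition eD e I : idx -> R := fun j => e j + (j \in I)%:R + (j == ord_max)%:R * #|I|%:R.

Lemma harm_DI e I n F : inner I -> harm e n F ->
  harm (eD e I) (n - #|I|) (DI I F) /\ ((n < #|I|)%N -> DI I F = 0).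
Proof.
move=> [_ IM] hF.
pose eDs (s : seq idx) j := e j + (j \in s)%:R + (j == ord_max)%:R * (size s)%:R.
have -> : eD e I = eDs (enum I).
  by apply/funext => j; rewrite /eD /eDs mem_enum -cardE.
rewrite /DI cardE; have := enum_uniq I.
have : ord_max \notin enum I by rewrite mem_enum.
elim: (enum I) => [|i s IHs] /=.
  move=> _ _; rewrite subn0; split => //.
  have -> // : eDs [::] = e by apply/funext => j; rewrite /eDs mulr0 !addr0.
rewrite in_cons negb_or eq_sym => /andP[iM sM] /andP[i_s us].
have [hs s0] := IHs sM us; set G := foldr _ _ _ in hs s0 *.
have [ns|ns] := leqP n (size s).
  have G0 : Dd i ord_max G = 0.
    have : G \is 0.-homog by move: hs.1; have -> : (n - size s)%N = 0%N by lia.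
    by move=> G0; rewrite /Dd !mderiv_homog0// subrr.
  rewrite G0; split => //; exact: harm_0.
split; last by move=> nl; exfalso; move: nl ns; rewrite ltnS leqNgt => /negP.
have nE : (n - size s)%N = (n - (size s).+1).+1 by lia.
rewrite nE in hs; have := harm_Dd iM hs.
have -> // : eU (eDs s) i ord_max = eDs (i :: s).
apply/funext => j; rewrite /eU /eDs in_cons /= -natr1.
have [->|ji] := eqVneq j i; last by case: (j == ord_max) => /=; ring.
by rewrite (negbTE i_s) (negbTE iM) /=; ring.
Qed.

Lemma Lam_DI e I n m F G : inner I -> (m < n)%N -> harm e n F -> harm e m G ->
  Lam (eD e I) (DI I F * DI I G) = 0.
Proof.
move=> Ii mn hF hG; have [hF' F0] := harm_DI Ii hF; have [hG' G0] := harm_DI Ii hG.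
have [mI|Im] := ltnP m #|I|; first by rewrite G0// mulr0 /Lam linform0.
by apply: (Lam_orth hF' hG'); lia.
Qed.

Lemma Lam_Dd e i n m F G : i != ord_max -> (m < n)%N -> harm e n F -> harm e m G ->
  Lam (eU e i ord_max) (Dd i ord_max F * Dd i ord_max G) = 0.
Proof.
move=> iM mn hF hG; case: n mn hF => // n mn hF.
case: m mn hG => [|m] mn hG.
  by rewrite /Dd !(mderiv_homog0 _ hG.1) subrr mulr0 /Lam linform0.
by apply: (Lam_orth (harm_Dd iM hF) (harm_Dd iM hG)); lia.
Qed.

(** Setting the coordinates of Z to 0 leaves the value of p unchanged and can only increase 1 - |x|,
    so an interior point is projected into the relative interior of the face. *)
Lemma face_eq0 Z p : inner Z -> (forall i, i \in Z -> pd i p = 0) ->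
  (forall x, relpt (faceN Z) x -> ev p x = 0) -> p = 0.
Proof.
move=> Zi dp p0; apply: interior_eq0 => x xT.
pose x' : pt := \row_j (if ix j \in Z then 0 else x ord0 j).
have x'r : relpt (faceN Z) x'.
  have xge j : 0 <= x ord0 j by apply/ltW/xT.1.
  split=> i; rewrite inE; case: (idx_cases i) => [->|->|[j ->]]; rewrite ?eqxx//=.
  - move=> _; rewrite xvM; apply: (lt_le_trans xT.2); rewrite lerD2l lerN2.
    by apply: ler_sum => j _; rewrite mxE; case: ifP.
  - by rewrite xv_ix mxE ix_neq0 /= => /negbTE ->; exact: xT.1.
  - by rewrite xv0.
  - by rewrite Zi.2.
  - by rewrite xv_ix mxE ix_neq0 /= negbK => ->.
rewrite -(p0 x' x'r) /ev !mevalE big_seq [RHS]big_seq; apply: eq_bigr => m mp.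
congr (_ * _); apply: eq_bigr => j _; rewrite mxE; case: ifPn => // jZ.
suff -> : m j = 0%N by [].
apply/eqP; rewrite -leqn0 leqNgt; apply: contraTN mp => mj.
have sp : supported [set j | ix j \notin Z] p.
  by move=> l; rewrite inE negbK => /dp; rewrite pd_ix.
by rewrite mcoeff_msupp negbK; apply/eqP/((supportedP _ _).1 sp m j) => //; rewrite inE jZ.
Qed.

Lemma pd_const p : (forall i : idx, i != ord0 -> i != ord_max -> pd i p = 0) ->
  p = (p@_0%MM)%:MP.
Proof.
move=> dp; have sp : supported finset.set0 p.
  by move=> j _; rewrite -pd_ix dp ?ix_neq0 ?ix_neqM.
apply/mpolyP => m; rewrite mcoeffC; have [->|m0] := eqVneq m 0%MM; first by rewrite mulr1.
have [i mi] : exists i, (0 < m i)%N.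
  apply/existsP; apply: contraNT m0 => /existsPn H; apply/eqP/mnmP => i.
  by rewrite mnm0E; have := H i; lia.
by rewrite mulr0; apply: ((supportedP _ _).1 sp m i) => //; rewrite inE.
Qed.

Lemma pdC (i j : idx) p : i != ord0 -> i != ord_max -> j != ord0 -> j != ord_max ->
  pd i (pd j p) = pd j (pd i p).
Proof.
case: (idx_cases i) => [->|->|[a ->]]; rewrite ?eqxx// => _ _.
case: (idx_cases j) => [->|->|[c ->]]; rewrite ?eqxx// => _ _.
by rewrite !pd_ix mderiv_comm.
Qed.

(** [pdI] differentiates in the order of [enum], which need not start with i; partial derivatives
    have to be permuted. *)
Lemma pdI_setU1 I i p : inner (i |: I) -> i \notin I -> pdI (i |: I) p = pd i (pdI I p).
Proof.
move=> Ui iI; rewrite /pdI.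
have : perm_eq (enum (i |: I)) (i :: enum I).
  apply: uniq_perm; rewrite ?enum_uniq//= ?mem_enum ?iI ?enum_uniq// => j.
  by rewrite in_cons !mem_enum !inE.
have : all (fun i => (i != ord0) && (i != ord_max)) (enum (i |: I)).
  by apply/allP => j; rewrite mem_enum => /(inner_in Ui)[-> ->].
set s := enum _; set t := i :: _ => sI st.
have -> : pd i (foldr (@pd R d) p (enum I)) = foldr (@pd R d) p t by [].
have mem_pd (u : seq idx) j : all (fun i => (i != ord0) && (i != ord_max)) u -> j \in u ->
    foldr (@pd R d) p u = pd j (foldr (@pd R d) p (rem j u)).
  elim: u => //= a u IHu /andP[/andP[a0 aM] au]; rewrite in_cons eq_sym.
  have [->//|aj /= ju] := eqVneq a j.
  rewrite (IHu au ju) /=; have /andP[j0 jM] := allP au j ju.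
  by rewrite pdC.
have : all (fun i => (i != ord0) && (i != ord_max)) t by rewrite -(perm_all _ st).
move: t st sI; clearbody s; elim: s => [|j s IHs] t.
  by rewrite perm_sym => /perm_nilP ->.
move=> st /= /andP[_ as_] at_.
have jt : j \in t by rewrite -(perm_mem st) mem_head.
rewrite (mem_pd t j)//; congr pd; apply: IHs => //.
  by rewrite -(perm_cons j); apply: (perm_trans st); exact: perm_to_rem.
by apply/allP => a /mem_rem /(allP at_).
Qed.

End Forms.

(** * The inner product *)

Section InnerProduct.
Variables (R : realType) (d k : nat) (gam : nat -> R) (lam : R)
    (lami : nat -> R) (lamI : {set 'I_d.+2} -> R) (lam0 : nat -> R).
Hypotheses (d2 : (2 <= d)%N) (k1 : (1 <= k <= d.+1)%N).
Hypothesis gam1 : forall i : nat, (1 <= i <= d.+1 - k)%N -> -1 < gam i.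
Local Notation idx := 'I_d.+2.
Local Notation pt := 'rV[R]_d.
Local Notation Q := {mpoly R[d.+2]}.
Local Notation poly := {mpoly R[d]}.
Implicit Types (x : pt) (I N : {set idx}) (F G : Q) (p q : poly) (i j : idx).
Local Notation ip := (@ipk R d k gam lam lami lamI lam0).

Let mk : {set idx} := Defs.mkset d k.

Definition low_idx i := (0 < i <= d.+1 - k)%N.

Local Notation low := low_idx.

Definition e0 i : R := if low i then gam i else -1.

Lemma k_gt0 : (0 < k)%N. Proof. by case/andP: k1. Qed.
Lemma k_le : (k <= d.+1)%N. Proof. by case/andP: k1. Qed.

Lemma low0 : low ord0 = false. Proof. by []. Qed.

Lemma lowM : low ord_max = false.
Proof. by rewrite /low_idx /=; apply/negbTE; have := k_gt0; lia. Qed.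

Lemma mk0 : (ord0 \in mk) = false.
Proof. by rewrite inE; apply/negbTE; have := k_le => /=; lia. Qed.

Lemma mkM : (ord_max \in mk) = false.
Proof. by rewrite inE /=; apply/negbTE; lia. Qed.

Lemma mkE i : (i \in mk) = [&& i != ord0, i != ord_max & ~~ low i].
Proof.
rewrite inE -!val_eqE /low_idx /=; have := ltn_ord i; have := k_gt0; have := k_le.
lia.
Qed.

Lemma low_neq i : low i -> [/\ i != ord0, i != ord_max & i \notin mk].
Proof.
move=> li; rewrite mkE li !andbF; split => //.
  by apply: contraTneq li => ->.
by apply: contraTneq li => ->; rewrite lowM.
Qed.

Lemma card_ge n a : (a <= n)%N -> #|[set i : 'I_n | (a <= i)%N]| = (n - a)%N.
Proof.
move=> an; rewrite -sum1_card (eq_bigl (fun i : 'I_n => predT (val i) && (a <= val i)%N)).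
  by have <- := @big_geq_mkord _ 0%N addn a n predT (fun=> 1%N); rewrite sum_nat_const_nat muln1.
by move=> i; rewrite inE.
Qed.

Lemma card_B : #|Bset d k| = k.
Proof. by rewrite card_ge ?subKn//; have := k_le; lia. Qed.

Lemma BE : Bset d k = ord_max |: mk.
Proof.
apply/setP => i; rewrite !inE -val_eqE /=; have := ltn_ord i.
by have := k_gt0; lia.
Qed.

Lemma card_mk : #|mk| = k.-1.
Proof. by have := card_B; rewrite BE cardsU1 mkM /= => <-. Qed.

Lemma inner_mk I : I \subset mk -> inner I.
Proof.
move=> /fintype.subsetP Imk; split; apply/negP => /Imk; first by rewrite mk0.
by rewrite mkM.
Qed.

Lemma e0_low i : low i -> e0 i = gam i. Proof. by rewrite /e0 => ->. Qed.
Lemma e0_nlow i : ~~ low i -> e0 i = -1. Proof. by rewrite /e0 => /negbTE ->. Qed.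
Lemma gam_low i : low i -> -1 < gam i. Proof. exact: gam1. Qed.

Lemma xgamE x : xgam k gam x = \prod_i (if low i then xv x i `^ gam i else 1).
Proof. by rewrite /xgam big_mkcond. Qed.

(* A form of the inner product uniform in k: cI mk = 1, and ci = 1 for k = 1,
   stand for the terms that carry no parameter lambda. *)
Definition WI I x := xv x ord_max ^+ (#|I| - 1) * xgam k gam x.
Definition Wi i x := xv x i * xgam k gam x.
Definition TI I p q := faceform (mk :\: I) (WI I) (pdI I p) (pdI I q).
Definition Ti i p q := faceform mk (Wi i) (pd i p) (pd i q).
Definition TL p q := faceform (ord_max |: mk) (xgam k gam) p q.
Definition cI I := if I == mk then 1 else lamI I.
Definition ci i := if k == 1%N then 1 else lami i.
Definition Tlast p q :=
  if (k < d)%N then lam * TL p q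
  else if k == d then lam * (ev p (ept R d 1) * ev q (ept R d 1))
  else \sum_(j < d.+1) lam0 j * (ev p (ept R d j) * ev q (ept R d j)).

Definition rangeI I := (I \subset mk) && (1 <= #|I| <= k.-1)%N.

Definition ip_sum p q :=
  \sum_(I | rangeI I) cI I * TI I p q + \sum_(i | low i) ci i * Ti i p q + Tlast p q.

Lemma faceformE I W (p q : poly) g : (forall x, g x = ev p x * ev q x * W x) ->
  face_int I g = faceform I W p q.
Proof. by move=> h; congr face_int; apply/funext. Qed.

Lemma sum_rangeI (f : {set idx} -> R) : (1 < k)%N ->
  \sum_(I | rangeI I) cI I * f I =
  f mk + \sum_(I : {set idx} | (I \subset mk) && (1 <= #|I| <= k - 2)%N) lamI I * f I.
Proof.
move=> k2; rewrite (bigD1 mk) /=; last first.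
  by rewrite /rangeI fintype.subxx card_mk leqnn andbT; lia.
rewrite /cI eqxx mul1r; congr (_ + _).
have E I : rangeI I && (I != mk) = (I \subset mk) && (1 <= #|I| <= k - 2)%N.
  rewrite /rangeI; case: (boolP (I \subset mk)) => //= Imk.
  have := subset_leq_card Imk; rewrite card_mk => Ik.
  have [->|Ine] := eqVneq I mk; first by rewrite card_mk; lia.
  have : (#|I| < k.-1)%N.
    by rewrite -card_mk proper_card// finset.properEneq Ine.
  by move: #|I| => c; lia.
rewrite (eq_bigl _ _ E); apply: eq_bigr => I /andP[_ Ik].
have [IE|//] := eqVneq I mk.
by exfalso; move: Ik; rewrite IE card_mk; lia.
Qed.

Lemma ipkE p q : ip p q = ip_sum p q.
Proof.
rewrite /ipk /ip_sum; have [k1'|k1'] := eqVneq k 1%N.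
  have -> : \sum_(I | rangeI I) cI I * TI I p q = 0.
    by apply: big1 => I /andP[_]; rewrite k1' /=; lia.
  rewrite add0r.
  have mkE0 : mk = finset.set0.
    by apply/eqP; rewrite -cards_eq0 card_mk k1'.
  congr (_ + _); last first.
    have kd : (k < d)%N by rewrite k1'.
    rewrite /Tlast kd; apply: (congr1 (fun z => lam * z)).
    by rewrite /TL mkE0 finset.setU0; apply: faceformE => x; rewrite k1'.
  have lowE i : low i = (0 < i <= d)%N by rewrite /low_idx k1' subn1.
  rewrite (eq_bigl _ _ lowE); apply: eq_bigr => i _.
  rewrite /ci k1' eqxx mul1r /Ti mkE0; apply: faceformE => x.
  by rewrite /Wi k1'; ring.
have k2 : (1 < k)%N by have := k_gt0; lia.
rewrite (sum_rangeI (fun I => TI I p q) k2).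
(* The leading integral over the whole simplex is the term of I = [mk], for which no coordinate is
   set to 0; its exponent k - 2 is #|mk| - 1. *)
have TmkE : TI mk p q = faceform finset.set0 (WI mk) (pdI mk p) (pdI mk q).
  by rewrite /TI finset.setDv.
have [kd|kd] := leqP k d.
  rewrite /Tlast -/mk; congr (_ + _ + _ + _).
  - rewrite TmkE; apply: faceformE => x; rewrite /WI card_mk -subn1 -subnDA; ring.
  - apply: eq_bigr => I _; congr (_ * _); apply: faceformE => x.
    by rewrite /WI; ring.
  - apply: eq_bigr => i _; congr (_ * _); first by rewrite /ci (negbTE k1').
    by apply: faceformE => x; rewrite /Wi; ring.
  - have [->|kd'] := eqVneq k d; first by rewrite ltnn; ring.
    by rewrite ltn_neqAle kd' kd; congr (_ * _); apply: faceformE.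
have kE : k = d.+1 by have := k_le; lia.
have DE : Dset d = mk by apply/setP => i; rewrite !inE; have := ltn_ord i; lia.
have lowF i : low i = false by rewrite /low_idx kE subnn; case: (i : nat).
have xgam1 x : xgam k gam x = 1.
  by rewrite xgamE; apply: big1 => i _; rewrite lowF.
rewrite DE; have -> : \sum_(i | low i) ci i * Ti i p q = 0.
  by apply: big1 => i; rewrite lowF.
rewrite addr0 /Tlast ltnNge (ltnW kd) /= (gtn_eqF kd); congr (_ + _ + _).
- rewrite TmkE; apply: faceformE => x; rewrite /WI card_mk xgam1 kE -subn1.
  by rewrite subSS subn0; ring.
- have -> : (k - 2 = d - 1)%N by lia.
  apply: eq_bigr => I _; congr (_ * _); apply: faceformE => x.
  by rewrite /WI xgam1; ring.
- by apply: eq_bigr => j _; ring.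
Qed.

Lemma weight_prod N e x : weight N e x = \prod_i (if i \in N then xv x i `^ e i else 1).
Proof. by rewrite /weight big_mkcond. Qed.

Lemma in_faceN I i : (i \in faceN I) = (i != ord0) && (i \notin I).
Proof. by rewrite inE. Qed.

Lemma faceNE I : I \subset mk -> forall i,
  (i \in faceN (mk :\: I)) = [|| i == ord_max, low i | i \in I].
Proof.
move=> /fintype.subsetP Imk i; rewrite in_faceN finset.in_setD.
case: (boolP (i \in I)) => [/Imk|iI]; first by rewrite mkE => /and3P[-> _ _]; rewrite !orbT.
rewrite mkE /= orbF; case: (eqVneq i ord0) => [->|_] /=; first by rewrite low0.
by rewrite negb_and !negbK.
Qed.

Lemma faceI_max I : faceN (mk :\: I) != finset.set0.
Proof.
by apply/set0Pn; exists ord_max; rewrite in_faceN finset.in_setD mkM andbF.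
Qed.

Section RangeI.
Variable I : {set idx}.
Hypotheses (Imk : I \subset mk) (I1 : (0 < #|I|)%N).

Let IL i : i \in I -> [/\ i != ord0, i != ord_max & ~~ low i].
Proof. by move=> iI; move/fintype.subsetP: Imk => /(_ i iI); rewrite mkE => /and3P. Qed.

(** Raising gives #|I| - 1 at d + 1, 0 on I and leaves gamma on the low indices: all above -1, and
    exactly the exponents in [WI I]. *)
Lemma eD_gt i : i \in faceN (mk :\: I) -> -1 < eD e0 I i.
Proof.
rewrite faceNE// /eD => /or3P[/eqP ->|li|iI].
- rewrite eqxx mul1r e0_nlow ?lowM// (negbTE (inner_mk Imk).2).
  by rewrite addr0 ltrDl ltr0n.
- have [_ /negbTE -> _] := low_neq li; rewrite mul0r addr0 e0_low//.
  by apply: ltr_wpDr; [exact: ler0n|exact: gam_low].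
- have [_ /negbTE -> nl] := IL iI; rewrite iI mul0r addr0 e0_nlow//.
  by rewrite ltrDl.
Qed.

Lemma eD_out i : i \notin faceN (mk :\: I) -> eD e0 I i = -1.
Proof.
rewrite faceNE// !negb_or => /and3P[/negbTE iM nl /negbTE iI].
by rewrite /eD iM iI e0_nlow// mul0r !addr0.
Qed.

Lemma WI_weight x : relpt (faceN (mk :\: I)) x ->
  WI I x = weight (faceN (mk :\: I)) (eD e0 I) x.
Proof.
move=> [x0 _]; rewrite /WI weight_prod xgamE (bigD1 ord_max)//= lowM mul1r.
rewrite [RHS](bigD1 ord_max)//= faceNE// eqxx /=; congr (_ * _).
  rewrite /eD eqxx mul1r e0_nlow ?lowM// (negbTE (inner_mk Imk).2) addr0.
  have xM : 0 < xv x ord_max by apply: x0; rewrite faceNE// eqxx.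
  rewrite -powR_mulrn ?ltW//; congr (_ `^ _); rewrite natrB//; ring.
apply: eq_bigr => i iM; rewrite faceNE// (negbTE iM) /=.
case: (boolP (low i)) => li /=.
  rewrite /eD (negbTE iM) mul0r addr0 e0_low//.
  case: (boolP (i \in I)) => [/IL[_ _]|_]; first by rewrite li.
  by rewrite addr0.
case: (boolP (i \in I)) => // iI.
by rewrite /eD iI (negbTE iM) mul0r addr0 e0_nlow// addNr powRr0.
Qed.

Lemma good_TI n0 : good n0 e0 (TI I).
Proof.
apply: (good_face (faceI_max I) eD_gt eD_out WI_weight n0 (D := DI I)).
- exact/pdI_linear/inner_mk.
- by move=> F; apply: pdI_rho; have [] := inner_mk Imk.
- by move=> n m F G; exact/Lam_DI/inner_mk.
Qed.

Lemma TI_zero p : TI I p p = 0 ->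
  forall x, relpt (faceN (mk :\: I)) x -> ev (pdI I p) x = 0.
Proof. exact: (faceform_ge0 (faceI_max I) eD_gt eD_out WI_weight _).2. Qed.

End RangeI.

Section RangeLow.
Variable i : idx.
Hypothesis li : low i.

Let faceN_mk : faceN mk = faceN (mk :\: finset.set0).
Proof. by rewrite finset.setD0. Qed.

Let mkNE j : (j \in faceN mk) = (j == ord_max) || low j.
Proof. by rewrite faceN_mk faceNE ?finset.sub0set// inE orbF. Qed.

Lemma face_mk0 : faceN mk != finset.set0.
Proof. by rewrite faceN_mk faceI_max. Qed.

Lemma eU_gt j : j \in faceN mk -> -1 < eU e0 i ord_max j.
Proof.
have [_ iM _] := low_neq li.
rewrite mkNE /eU => /orP[/eqP ->|lj].
  by rewrite eqxx e0_nlow ?lowM// eq_sym (negbTE iM) addr0 ltrDl.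
by rewrite -addrA; apply: ltr_wpDr; rewrite ?e0_low ?gam_low ?addr_ge0.
Qed.

Lemma eU_out j : j \notin faceN mk -> eU e0 i ord_max j = -1.
Proof.
rewrite mkNE negb_or => /andP[/negbTE jM nl]; rewrite /eU jM e0_nlow//.
have -> : (j == i) = false by apply: contraNF nl => /eqP ->.
by rewrite !addr0.
Qed.

(** The factor x_i of the integrand is the increment of gamma_i, and at d + 1 the raised parameter
    is 0. *)
Lemma Wi_weight x : relpt (faceN mk) x -> Wi i x = weight (faceN mk) (eU e0 i ord_max) x.
Proof.
move=> [x0 _]; have [_ iM _] := low_neq li.
have xi : 0 < xv x i by apply: x0; rewrite mkNE li orbT.
rewrite /Wi weight_prod xgamE (bigD1 i)//= li [RHS](bigD1 i)//= mkNE li orbT mulrA.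
congr (_ * _).
  rewrite /eU eqxx (negbTE iM) addr0 e0_low// powRD ?lt0r_neq0 ?implybT//.
  by rewrite powRr1 ?ltW// mulrC.
apply: eq_bigr => j ji; rewrite mkNE /eU (negbTE ji) addr0.
have [->|jM] := eqVneq j ord_max; first by rewrite lowM /= e0_nlow ?lowM// addNr powRr0.
by case: ifPn => // lj; rewrite e0_low// addr0.
Qed.

Lemma good_Ti n0 : good n0 e0 (Ti i).
Proof.
have [i0 iM _] := low_neq li.
apply: (good_face face_mk0 eU_gt eU_out Wi_weight n0 (D := Dd i ord_max)).
- exact: pd_linear.
- by move=> F; exact: pd_rho.
- by move=> n m F G; exact: Lam_Dd.
Qed.

Lemma Ti_zero p : Ti i p p = 0 ->
  forall x, relpt (faceN mk) x -> ev (pd i p) x = 0.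
Proof. exact: (faceform_ge0 face_mk0 eU_gt eU_out Wi_weight _).2. Qed.

End RangeLow.

Section LastFace.
Hypothesis kd : (k <= d)%N.

Lemma low1 : low (inord 1).
Proof. by rewrite /low_idx inordK//; lia. Qed.

Let BNE j : (j \in faceN (ord_max |: mk)) = low j.
Proof.
rewrite in_faceN in_setU1 mkE; have [->|j0] := eqVneq j ord0; first by rewrite low0.
by have [->|jM] := eqVneq j ord_max; rewrite ?lowM//= negbK.
Qed.

Lemma face_B0 : faceN (ord_max |: mk) != finset.set0.
Proof. by apply/set0Pn; exists (inord 1); rewrite BNE low1. Qed.

Lemma e0_gt j : j \in faceN (ord_max |: mk) -> -1 < e0 j.
Proof. by rewrite BNE => lj; rewrite e0_low// gam_low. Qed.

Lemma e0_out j : j \notin faceN (ord_max |: mk) -> e0 j = -1.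
Proof. by rewrite BNE; exact: e0_nlow. Qed.

Lemma W_weight x : relpt (faceN (ord_max |: mk)) x ->
  xgam k gam x = weight (faceN (ord_max |: mk)) e0 x.
Proof.
move=> _; rewrite weight_prod xgamE; apply: eq_bigr => j _; rewrite BNE.
by case: ifPn => // lj; rewrite e0_low.
Qed.

Lemma good_TL n0 : good n0 e0 TL.
Proof.
apply: (good_face face_B0 e0_gt e0_out W_weight n0 (T := id) (D := id)) => //.
by move=> n m F G mn hF hG; apply: (Lam_orth hF hG); lia.
Qed.

Lemma TL_const c : TL c%:MP c%:MP = 0 -> c = 0.
Proof. exact: (faceform_const face_B0 e0_gt e0_out W_weight). Qed.

Lemma TL_vanish p q : (forall x, relpt (faceN (ord_max |: mk)) x -> ev p x = 0) ->
  TL p q = 0.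
Proof. exact: (faceform_vanish _ face_B0 e0_gt e0_out). Qed.

End LastFace.

(** The vertex e_0 = 0 is the one where x_{d+1} = 1, hence [ord_max] for j = 0. *)
Definition vtx (j : nat) : idx := if j == 0%N then ord_max else inord j.

Lemma xv_ept (j : nat) : (j <= d)%N -> forall i, xv (ept R d j) i = (i == vtx j)%:R.
Proof.
move=> jd i; rewrite /vtx.
have S : \sum_(l < d) (ept R d j) ord0 l = (j != 0%N)%:R.
  case: j jd => [|j] jd.
    by rewrite big1// => l _; rewrite mxE.
  rewrite (bigD1 (Ordinal jd))//= mxE eqxx big1 ?addr0// => l lj.
  by rewrite mxE eqSS -[l == j :> nat]/(l == Ordinal jd) (negbTE lj).
case: (idx_cases i) => [->|->|[l ->]].
- rewrite xv0; case: j jd S => [|j] jd _ //=.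
  have jd' : (j.+1 < d.+2)%N by exact: leqW.
  by rewrite -val_eqE /= inordK.
- rewrite xvM S; case: j jd S => [|j] jd _; first by rewrite /= eqxx subr0.
  have jd' : (j.+1 < d.+2)%N by exact: leqW.
  by rewrite subrr -val_eqE /= inordK// gtn_eqF.
- rewrite xv_ix mxE; case: j jd S => [|j] jd _.
    by rewrite (ix_neqM l : (ix l == (if 0%N == 0%N then ord_max else _)) = false).
  have jd' : (j.+1 < d.+2)%N by exact: leqW.
  suff -> : (ix l == (if j.+1 == 0%N then ord_max else inord j.+1)) = (l.+1 == j.+1) by [].
  by rewrite -val_eqE [val (ix l)]ixE [val _]inordK.
Qed.

Lemma meval_vtx n F (v : idx -> R) i : F \is n.-homog -> v =1 (fun j => (j == i)%:R) ->
  F.@[v] = F@_(U_(i) *+ n)%MM.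
Proof.
move=> /dhomogP hF vE; rewrite mevalE.
rewrite (eq_big_seq (fun m => if m == (U_(i) *+ n)%MM then F@_m else 0)) => [|m mF].
  have [iF|iF] := boolP ((U_(i) *+ n)%MM \in msupp F).
    rewrite (bigD1_seq _ iF (msupp_uniq F)) /= eqxx big1 ?addr0// => m /negbTE ->//.
  rewrite (memN_msupp_eq0 iF) big_seq big1// => m mF.
  by case: eqP => // mE; rewrite -mE mF in iF.
have [->|mi] := eqVneq m (U_(i) *+ n)%MM.
  rewrite big1 ?mulr1// => j _; rewrite vE mulmnE mnm1E eq_sym.
  by case: eqP => _; rewrite ?expr1n// mul0n expr0.
suff [j ji mj] : exists2 j, j != i & (0 < m j)%N.
  by rewrite (bigD1 j)//= vE (negbTE ji) expr0n gtn_eqF// mul0r mulr0.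
apply/exists_inP; apply: contraNT mi => /exists_inPn H.
have m0 j : j != i -> m j = 0%N.
  by move=> ji; apply/eqP; rewrite -leqn0 leqNgt; apply: H.
apply/eqP/mnmP => j; rewrite mulmnE mnm1E eq_sym.
have [->|ji] := eqVneq j i; last by rewrite m0// mul0n.
rewrite mul1n -(hF m mF) [RHS]mdegE (bigD1 i)//= big1 ?addn0// => l /m0 //.
Qed.

Lemma harm_vtx n F i : harm e0 n F -> (0 < n)%N -> e0 i + n%:R != 0 ->
  (forall j, j != i -> e0 j = -1 \/ forall m : 'X_{1..d.+2}, (0 < m j)%N -> F@_m = 0) ->
  F@_(U_(i) *+ n)%MM = 0.
Proof. by case: n => // n hF _; exact: harm_coeff_pow. Qed.

Lemma ev_vtx n F (j : nat) : (j <= d)%N -> harm e0 n F -> (0 < n)%N ->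
  e0 (vtx j) + n%:R != 0 -> (forall i, i != vtx j -> ~~ low i) ->
  ev (rho F) (ept R d j) = 0.
Proof.
move=> jd hF n0 en nl; rewrite ev_rho (meval_vtx hF.1 (xv_ept jd)) (harm_vtx hF)//.
by move=> i /nl li; left; rewrite e0_nlow.
Qed.

(* For k = d + 1 the evaluations at the vertices do not annihilate the harmonic
   polynomials of degree 1: orthogonality only starts in degree 2. *)
Definition min_deg := if (k <= d)%N then 0%N else 2%N.

Lemma good_Tlast : pos_cond k lam lami lamI lam0 -> good min_deg e0 Tlast.
Proof.
rewrite /pos_cond /min_deg; have [kd|kd] := leqP k d => -[]; last first.
  move=> _ l0 _.
  have -> : Tlast = fun p q => \sum_(j < d.+1) lam0 j * (ev p (ept R d j) * ev q (ept R d j)).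
    apply/funext => p; apply/funext => q.
    by rewrite /Tlast ltnNge (ltnW kd) (gtn_eqF kd).
  have nl i : ~~ low i by rewrite /low_idx; lia.
  apply: good_sum => j _; apply: goodZ; first by apply: l0; rewrite -ltnS.
  apply: good_point => n F n2 n1 hF; apply: (ev_vtx _ hF) => //; first by rewrite -ltnS.
  by rewrite e0_nlow// addrC subr_eq0 pnatr_eq1; lia.
move=> lam_gt0 _ _; have [kd'|kd'] := ltnP k d.
  have -> : Tlast = fun p q => lam * TL p q.
    by apply/funext => p; apply/funext => q; rewrite /Tlast kd'.
  by apply: goodZ; [exact: ltW|exact: good_TL].
have kE : k = d by lia.
have -> : Tlast = fun p q => lam * (ev p (ept R d 1) * ev q (ept R d 1)).
  by apply/funext => p; apply/funext => q; rewrite /Tlast ltnNge kd' kE eqxx.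
apply: goodZ; first exact: ltW.
apply: good_point => n F _ n1 hF; apply: (ev_vtx _ hF) => //.
- exact: ltnW.
- rewrite e0_low ?low1//; apply: lt0r_neq0; have := gam_low (low1 kd).
  have : 1 <= n%:R :> R by rewrite ler1n.
  by move: (gam _) => g; lra.
- move=> i; apply: contraNN; rewrite /low_idx kE -val_eqE /= inordK//.
  by rewrite subSnn; lia.
Qed.

Lemma cI_gt0 I : pos_cond k lam lami lamI lam0 -> rangeI I -> 0 < cI I.
Proof.
move=> h /andP[Imk I1]; rewrite /cI; case: ifPn => // ImkN.
have IC : (#|I| < k.-1)%N by rewrite -card_mk proper_card// finset.properEneq ImkN.
move: h; rewrite /pos_cond; case: ifPn => kd [h1 h2 h3]; [apply: h3|apply: h1] => //.
- by lia.
- suff -> : Dset d = mk by [].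
  by apply/setP => i; rewrite !inE; have := ltn_ord i; have := k_le; lia.
- by have := k_le; lia.
Qed.

Lemma ci_gt0 i : pos_cond k lam lami lamI lam0 -> low i -> 0 < ci i.
Proof.
rewrite /pos_cond /ci /low_idx => h li; case: ifPn => // k1'.
move: h; case: ifPn => kd [h1 h2 h3]; last by exfalso; lia.
by apply: h2 => //; have := k_gt0; lia.
Qed.

Lemma good_ipU : pos_cond k lam lami lamI lam0 -> good min_deg e0 ip_sum.
Proof.
move=> h; apply: goodD; last exact: good_Tlast.
apply: goodD; apply: good_sum => i ri; apply: goodZ.
- exact/ltW/cI_gt0.
- by case/andP: ri => Imk /andP[I1 _]; exact: good_TI.
- exact/ltW/ci_gt0.
- exact: good_Ti.
Qed.

Lemma Tlast_const c : pos_cond k lam lami lamI lam0 -> Tlast c%:MP c%:MP = 0 -> c = 0.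
Proof.
rewrite /pos_cond /Tlast; have [kd|kd] := leqP k d => -[]; last first.
  move=> _ l0 [j0 [j0d lj0]]; rewrite ltnNge (ltnW kd) (gtn_eqF kd) /=.
  under eq_bigr => j _ do rewrite /ev !mevalC.
  rewrite -mulr_suml => /eqP; rewrite mulf_eq0 mulf_eq0 orbb gt_eqF; first by move/eqP.
  have j0d' : (j0 < d.+1)%N by [].
  rewrite (bigD1 (Ordinal j0d'))//=; apply: ltr_pwDl => //.
  by apply: sumr_ge0 => j _; apply: l0; rewrite -ltnS.
move=> lam_gt0 _ _; case: ifPn => [kd' /eqP|kd'].
  by rewrite mulf_eq0 gt_eqF//= => /eqP /(TL_const kd).
have -> : k == d by apply/eqP; lia.
by rewrite /ev !mevalC => /eqP; rewrite mulf_eq0 gt_eqF//= mulf_eq0 orbb => /eqP.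
Qed.

Lemma ipU_eq0 p : pos_cond k lam lami lamI lam0 -> ip_sum p p = 0 -> p = 0.
Proof.
move=> pos.
have TI0 I : rangeI I -> 0 <= cI I * TI I p p.
  move=> rI; apply: mulr_ge0; first exact/ltW/cI_gt0.
  by case/andP: rI => Imk /andP[I1 _]; have [] := good_TI Imk I1 0.
have Ti0 i : low i -> 0 <= ci i * Ti i p p.
  move=> li; apply: mulr_ge0; first exact/ltW/ci_gt0.
  by have [] := good_Ti li 0.
have Tl0 : 0 <= Tlast p p by have [] := good_Tlast pos.
have A0 : 0 <= \sum_(I | rangeI I) cI I * TI I p p by exact: sumr_ge0.
have B0 : 0 <= \sum_(i | low i) ci i * Ti i p p by exact: sumr_ge0.
move=> /eqP; rewrite paddr_eq0 ?addr_ge0// paddr_eq0//.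
move=> /andP[/andP[/eqP A /eqP B] /eqP C].
(* [n] bounds the number of elements of [mk] outside I, which turns the downward induction on I into
   an ordinary one. *)
have pdI0 n I : I \subset mk -> (#|mk :\: I| < n)%N -> (0 < #|I|)%N -> pdI I p = 0.
  elim: n I => // n IHn I Imk In I1.
  have rI : rangeI I by rewrite /rangeI Imk I1 -card_mk subset_leq_card.
  have TIz : TI I p p = 0.
    have /eqP := psumr_eq0P TI0 A rI.
    by rewrite mulf_eq0 gt_eqF ?cI_gt0//= => /eqP.
  have Zi : inner (mk :\: I) by apply: inner_mk; exact: subsetDl.
  apply: (face_eq0 Zi); last exact: TI_zero.
  (* Adding to I an index i of [mk] outside it yields a derivative already known to be 0, so the
     derivative for I does not depend on x_i. *)
  move=> i; rewrite finset.in_setD => /andP[iI imk].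
  have Uk : i |: I \subset mk by rewrite finset.subUset finset.sub1set imk.
  rewrite -pdI_setU1//; last exact: inner_mk.
  apply: IHn => //; last by rewrite cardsU1 iI.
  apply: (leq_trans _ (In : #|mk :\: I| <= n)%N); apply: proper_card; apply/properP; split.
    by apply: finset.setDS; exact: finset.subsetUr.
  by exists i; rewrite !finset.in_setD ?finset.setU11 ?iI.
have pdmk i : i \in mk -> pd i p = 0.
  move=> imk; have -> : pd i p = pdI [set i] p by rewrite /pdI enum_set1.
  by apply: (pdI0 #|mk :\: [set i]|.+1); rewrite ?finset.sub1set ?cards1.
have pdlow i : low i -> pd i p = 0.
  move=> li; have [i0 iM _] := low_neq li.
  have Tiz : Ti i p p = 0.
    have /eqP := psumr_eq0P Ti0 B li.
    by rewrite mulf_eq0 gt_eqF ?ci_gt0//= => /eqP.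
  (* p no longer depends on the coordinates of [mk], and neither does its derivative along a low
     index; vanishing on the face is enough. *)
  apply: (face_eq0 (inner_mk (fintype.subxx mk))); last exact: Ti_zero.
  move=> j jmk; have /and3P[j0 jM _] : [&& j != ord0, j != ord_max & ~~ low j] by rewrite -mkE.
  by rewrite pdC// pdmk// /pd big1// => l _; rewrite mderiv0.
have pE : p = (p@_0%MM)%:MP.
  apply: pd_const => i i0 iM; have [/pdlow//|nl] := boolP (low i).
  by apply: pdmk; rewrite mkE i0 iM.
by rewrite pE in C *; rewrite (Tlast_const pos C).
Qed.

Lemma ip_inner : pos_cond k lam lami lamI lam0 -> is_inner_product ip.
Proof.
move=> pos; have [bC bl b0 _] := good_ipU pos; split.
- by move=> p q; rewrite !ipkE bC.
- by move=> a p q r; rewrite !ipkE bl.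
- move=> p pn; rewrite ipkE lt_def b0 andbT.
  by apply: contra pn => /eqP /(ipU_eq0 pos) ->.
Qed.

End InnerProduct.

(** * The spaces of orthogonal polynomials *)

Section Spaces.
Variables (R : realType) (d : nat).
Local Notation poly := {mpoly R[d]}.
Implicit Types (p q : poly) (A : Defs.space R d) (l : seq (Defs.space R d)).

Lemma bigsum_cat l l' p : bigsum (l ++ l') p <-> sumsp (bigsum l) (bigsum l') p.
Proof.
elim: l p => [|A l IHl] p /=.
  split=> [h|[a [b [-> [h ->]]]]]; last by rewrite add0r.
  by exists 0, p; rewrite add0r.
split=> [[a [b [Aa [/IHl [c [e [lc [le ->]]]] ->]]]]|].
  exists (a + c), e; rewrite addrA; split=> //; exists a, c; split=> //.
move=> [_ [e [[a [c [Aa [lc ->]]]] [le ->]]]]; exists a, (c + e); rewrite addrA.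
by do 2!split=> //; apply/IHl; exists c, e.
Qed.

Lemma bigsum1 A p : bigsum [:: A] p <-> A p.
Proof.
split=> [[a [b [Aa [-> ->]]]]|Ap]; first by rewrite addr0.
by exists p, 0; rewrite addr0.
Qed.

Lemma bigsum_map (T : eqType) (s : seq T) (A : T -> Defs.space R d) (f : T -> poly) :
  (forall t, t \in s -> A t (f t)) -> bigsum [seq A t | t <- s] (\sum_(t <- s) f t).
Proof.
elim: s => [|t s IHs] h; first by rewrite big_nil.
rewrite big_cons; exists (f t), (\sum_(t <- s) f t); split; first by apply: h; exact: mem_head.
by split=> //; apply: IHs => u us; apply: h; rewrite in_cons us orbT.
Qed.

Lemma bigsum_map_closed (P : poly -> Prop) (T : eqType) (s : seq T) (A : T -> Defs.space R d) :
  P 0 -> (forall p q, P p -> P q -> P (p + q)) ->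
  (forall t, t \in s -> forall p, A t p -> P p) ->
  forall p, bigsum [seq A t | t <- s] p -> P p.
Proof.
move=> P0 PD; elim: s => [|t s IHs] h p /=; first by move=> ->.
move=> [a [b [Aa [sb ->]]]]; apply: PD; first by apply: (h t) => //; exact: mem_head.
by apply: IHs sb => u us; apply: h; rewrite in_cons us orbT.
Qed.

End Spaces.

Section Orthogonal.
Variables (R : realType) (d : nat).
Local Notation idx := 'I_d.+2.
Local Notation Q := {mpoly R[d.+2]}.
Local Notation poly := {mpoly R[d]}.
Implicit Types (i : idx) (F G : Q) (p q : poly).

Lemma harm_ext (e e' : idx -> R) m F :
  (forall i, e i = e' i \/ F^`M(i) = 0) -> harm e m F -> harm e' m F.
Proof.
move=> h [hF lF]; split=> //; rewrite -[RHS]lF; apply: eq_bigr => i _.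
by case: (h i) => [->//|->]; rewrite !scaler0.
Qed.

(* Parameters at the dummy index 0 are junk; -1 is the value that makes the
   moment functional ignore X_0, in accordance with rho 'X_0 = 0. *)
Definition off0 (e : idx -> R) i : R := if i == ord0 then -1 else e i.

(** [Vsp] is by definition [OPn] for the form of the empty set I. With all parameters above -1 this
    form is definite, and [good_OP] applies. *)
Lemma VspP (eps : nat -> R) m p : (0 < d)%N ->
  (forall i : idx, i != ord0 -> -1 < eps i) ->
  Vsp eps m p <-> exists2 F, harm (off0 (fun i => eps i)) m F & p = rho F.
Proof.
move=> d0 eps1; set e := off0 _.
have NE i : (i \in faceN finset.set0) = (i != ord0) by rewrite in_faceN inE andbT.
have N0 : @faceN d finset.set0 != finset.set0.
  by apply/set0Pn; exists ord_max; rewrite NE.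
have eN i : i \in faceN finset.set0 -> -1 < e i.
  by rewrite NE /e /off0 => i0; rewrite (negbTE i0) eps1.
have eN' i : i \notin faceN finset.set0 -> e i = -1.
  by rewrite NE negbK /e /off0 => ->.
have WE x : relpt (faceN finset.set0) x -> Wt eps x = weight (faceN finset.set0) e x.
  move=> _; rewrite /weight /Wt; apply: eq_big => i; first by rewrite NE lt0n.
  by rewrite lt0n => i0; rewrite /e /off0 (negbTE (i0 : i != ord0)).
have gd : good 0 e (faceform finset.set0 (Wt eps)).
  apply: (good_face N0 eN eN' WE 0 (T := id) (D := id)) => //.
  by move=> n n' F G mn hF hG; apply: (Lam_orth hF hG); lia.
have te : tame e.
  left; rewrite (bigD1 ord_max)//= ltr_pwDl//.
    by have := eps1 ord_max isT; rewrite /e /off0 /=; lra.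
  apply: sumr_ge0 => i _; rewrite /e /off0; case: eqVneq => [_|/eps1]; lra.
rewrite -[Vsp eps m p]/(OPn (faceform finset.set0 (Wt eps)) m p).
apply: iff_sym; apply: (good_OP gd te) => // q qn.
have [_ _ b0 _] := gd; rewrite lt_def b0 andbT; apply: contra qn => /eqP.
move=> /(faceform_ge0 N0 eN eN' WE q).2 h; apply/eqP.
apply: (face_eq0 (Z := finset.set0)) => //; first by split; rewrite inE.
by move=> i; rewrite inE.
Qed.

End Orthogonal.

(** * Splitting harmonic polynomials by the set of degenerate variables *)

Section Splitting.
Variables (R : realType) (d k : nat) (gam : nat -> R).
Hypotheses (d2 : (2 <= d)%N) (k1 : (1 <= k <= d.+1)%N).
Hypothesis gam1 : forall i : nat, (1 <= i <= d.+1 - k)%N -> -1 < gam i.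
Local Notation idx := 'I_d.+2.
Local Notation Q := {mpoly R[d.+2]}.
Local Notation poly := {mpoly R[d]}.
Local Notation low := (@low_idx d k).
Local Notation e0 := (@e0 R d k gam).
Local Notation B := (Bset d k).
Implicit Types (J : {set idx}) (F G h : Q) (p q : poly) (i j : idx) (m : 'X_{1..d.+2}).

Lemma in_B i : (i \in B) = (i != ord0) && ~~ low i.
Proof.
rewrite BE// in_setU1 mkE//; have [->|iM] := eqVneq i ord_max; last by [].
by rewrite lowM.
Qed.

Lemma subB J i : J \subset B -> i \in J -> [/\ i \in B, i != ord0 & ~~ low i].
Proof. by move=> /fintype.subsetP JB /JB iB; have := iB; rewrite {1}in_B => /andP[i0 li]; split. Qed.

Definition eJ J : idx -> R := fun i => epsJ k gam J i.

Lemma eJ_low J i : low i -> eJ J i = gam i.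
Proof. by rewrite /eJ /epsJ => /andP[_ ->]. Qed.

Lemma eJ_B J i : i \in B -> eJ J i = (i \in J)%:R.
Proof.
rewrite /eJ /epsJ in_B /low_idx -lt0n => /andP[-> /= /negbTE ->].
case: ifPn => [/exists_inP[j jJ /eqP /val_inj <-]|/exists_inP h]; first by rewrite jJ.
by case: (boolP (i \in J)) => // iJ; case: h; exists i.
Qed.

Lemma eJ_gt J i : i \in faceN (B :\: J) -> -1 < eJ J i.
Proof.
rewrite in_faceN finset.in_setD => /andP[i0]; rewrite negb_and negbK => iJ.
have [li|li] := boolP (low i); first by rewrite eJ_low// gam1.
have iB : i \in B by rewrite in_B i0.
by rewrite eJ_B//; move: iJ; rewrite iB orbF => -> /=; lra.
Qed.

Lemma lap_e0_XJ J h : J \subset B ->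
  (forall i m, i \in B :\: J -> (0 < m i)%N -> h@_m = 0) ->
  lap e0 (h * 'X_[mesym1 J]) = lap (off0 (eJ J)) h * 'X_[mesym1 J].
Proof.
move=> JB h0; apply: lap_XJ => i iJ.
  have [iB i0 li] := subB JB iJ.
  by rewrite e0_nlow// /off0 (negbTE i0) eJ_B// iJ.
have [iB|] := boolP (i \in B); first by right=> m; apply: h0; rewrite finset.in_setD iJ.
rewrite in_B negb_and !negbK => iB; left.
have [i0|i0] := eqVneq i ord0; first by rewrite i0 /off0 e0_nlow.
by rewrite (negbTE i0) /= in iB; rewrite /off0 (negbTE i0) e0_low// eJ_low.
Qed.

Definition rharm n p := exists2 F, harm e0 n F & p = rho F.

Lemma rharm0 n : rharm n 0.
Proof. by exists 0; rewrite ?rho0//; exact: harm_0. Qed.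

Lemma rharmD n p q : rharm n p -> rharm n q -> rharm n (p + q).
Proof. by move=> [F hF ->] [G hG ->]; exists (F + G); [exact: harmD|rewrite rhoD]. Qed.

Lemma mesym1_homog J : ('X_[mesym1 J] : Q) \is #|J|.-homog.
Proof. by rewrite -(mdeg_mesym1 J) dhomogX. Qed.

Lemma part_harm J n h : J \subset B -> (#|J| <= n)%N ->
  (forall i m, i \in B :\: J -> (0 < m i)%N -> h@_m = 0) ->
  harm (off0 (eJ J)) (n - #|J|) h -> rharm n (xJ R J * rho h).
Proof.
move=> JB Jn h0 [hh lh]; exists (h * 'X_[mesym1 J]); last first.
  by rewrite rhoM rho_XJ mulrC.
split; last by rewrite lap_e0_XJ// lh mul0r.
by rewrite -[X in X.-homog](subnK Jn) dhomogM// mesym1_homog.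
Qed.

Lemma Hn_harm J n p : J \subset B -> (#|B :\: J| < d)%N ->
  mulsp (xJ R J) (Hn (epsJ k gam J) #|J| n (B :\: J)) p -> rharm n p.
Proof.
move=> JB Sd [a [+ ->]]; rewrite /Hn; case: ifPn => [Jn|_ ->]; last first.
  by rewrite mulr0; exact: rharm0.
have S0 : ord0 \notin B :\: J by rewrite finset.in_setD in_B eqxx andbF.
move=> /(HspP Sd S0 (@eJ_gt J))[h [hh sh ->]].
apply: part_harm => //.
  by move=> i m iS; apply: ((supportedP _ _).1 sh); rewrite in_faceN iS andbF.
apply: harm_ext hh => i; rewrite /off0; case: eqVneq => [->|_]; last by left.
by right; apply: sh; rewrite in_faceN.
Qed.

Lemma Vn_harm n p : mulsp (xJ R B) (Vn (epsJ k gam B) #|B| n) p -> rharm n p.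
Proof.
move=> [a [+ ->]]; rewrite /Vn; case: ifPn => [Jn|_ ->]; last first.
  by rewrite mulr0; exact: rharm0.
have e1 i : i != ord0 -> -1 < epsJ k gam B i.
  by move=> i0; apply: eJ_gt; rewrite in_faceN finset.setDv i0 inE.
move=> /(VspP _ _ _ e1)[|h hh ->]; first exact: ltnW.
by apply: part_harm => // i m; rewrite finset.setDv inE.
Qed.

(** The dummy index 0 counts as degenerate; parts whose type contains it are killed by [rho]. *)
Definition typ m : {set idx} := [set i | ~~ low i & (0 < m i)%N].
Definition pJ J F : Q := \sum_(m <- msupp F | typ m == J) F@_m *: 'X_[m].
Definition hJ J F : Q := \sum_(m <- msupp F | typ m == J) F@_m *: 'X_[m - mesym1 J].

Lemma mcoeff_pJ J F m : (pJ J F)@_m = if typ m == J then F@_m else 0.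
Proof.
rewrite /pJ raddf_sum big_mkcond /=; set c := RHS.
have E u : (if typ u == J then (F@_u *: 'X_[u])@_m else 0) = if u == m then c else 0.
  rewrite mcoeffZ mcoeffX; have [->|um] := eqVneq u m; first by rewrite mulr1.
  by rewrite mulr0 if_same.
rewrite (eq_bigr _ (fun u _ => E u)); have [mF|mF] := boolP (m \in msupp F).
  rewrite (bigD1_seq _ mF (msupp_uniq F)) /= eqxx big1 ?addr0//.
  by move=> u /negbTE ->.
rewrite big_seq big1 /c ?(memN_msupp_eq0 mF) ?if_same// => u uF.
by case: eqP => // um; rewrite -um uF in mF.
Qed.

Lemma typ_le m : (mesym1 (typ m) <= m)%MM.
Proof.
apply/mnm_lepP => i; rewrite mnmE inE. by case: (m i) => [|a]; rewrite ?andbF//=; case: (~~ _).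
Qed.

Lemma pJE J F : pJ J F = hJ J F * 'X_[mesym1 J].
Proof.
rewrite /pJ /hJ mulr_suml; apply: eq_bigr => m /eqP <-.
by rewrite -scalerAl -mpolyXD submK// typ_le.
Qed.

Lemma pJ_sum F : F = \sum_J pJ J F.
Proof.
apply/mpolyP => m; rewrite raddf_sum (bigD1 (typ m))//= mcoeff_pJ eqxx big1 ?addr0//.
by move=> J; rewrite mcoeff_pJ eq_sym => /negbTE ->.
Qed.

(* The operator couples exponents of the same type only: for a variable of
   parameter -1, the factor (m i) (m i + e0 i) vanishes at m i = 1. *)
Lemma lap_pJ J F : lap e0 F = 0 -> lap e0 (pJ J F) = 0.
Proof.
move=> lF; apply/mpolyP => m; rewrite mcoeff0.
have typU i : low i || (0 < m i)%N -> typ (m + U_(i))%MM = typ m.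
  move=> h; apply/setP => j; rewrite !inE mnmDE mnm1E.
  have [<-|_] := eqVneq i j; last by rewrite addn0.
  by case/orP: h => [->//|h]; rewrite h addn_gt0 h.
have cz i : ~~ (low i || (0 < m i)%N) -> (m i)%:R + 1 + e0 i = 0 :> R.
  rewrite negb_or lt0n negbK => /andP[li /eqP ->].
  by rewrite e0_nlow// add0r subrr.
have [tm|tm] := eqVneq (typ m) J.
  have := congr1 (mcoeff m) lF; rewrite mcoeff0 !mcoeff_lap => {2}<-.
  apply: eq_bigr => i _; rewrite mcoeff_pJ.
  have [h|/cz ->] := boolP (low i || (0 < m i)%N); last by rewrite !(mulr0, mul0r).
  by rewrite typU// tm eqxx.
rewrite mcoeff_lap big1// => i _; rewrite mcoeff_pJ.
have [h|/cz ->] := boolP (low i || (0 < m i)%N); last by rewrite !(mulr0, mul0r).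
by rewrite typU// (negbTE tm) mulr0.
Qed.

Lemma supp_hJ J F : J \subset B -> supported (faceN (B :\: J)) (hJ J F).
Proof.
move=> JB; rewrite /hJ big_seq_cond; apply: supported_sum => m /andP[_ /eqP tm].
apply: supportedZ; apply/supportedP => u j; rewrite in_faceN negb_and negbK => jN uj.
rewrite mcoeffX; case: eqP => // uE; move: uj; rewrite -uE mnmBE mnmE.
case/orP: jN => [/eqP ->|].
  have [t0|t0] := boolP (ord0 \in J); first by have [_ /eqP] := subB JB t0.
  by move: t0; rewrite -tm inE low0 /= -eqn0Ngt => /eqP ->.
rewrite negbK finset.in_setD => /andP[jJ]; rewrite in_B => /andP[_ lj].
by move: jJ; rewrite -{1}tm inE lj /= -eqn0Ngt => /eqP ->.
Qed.

(** Every monomial of type J is divisible by X_J, and [hJ J F] avoids the other degenerate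
    variables, so [lap_e0_XJ] applies to the quotient; X_J is then cancelled. *)
Lemma harm_hJ J n F : J \subset B -> harm e0 n F ->
  harm (off0 (eJ J)) (n - #|J|) (hJ J F) /\ ((n < #|J|)%N -> hJ J F = 0).
Proof.
move=> JB [hF lF].
have deg m : m \in msupp F -> typ m == J -> (mdeg (m - mesym1 J) + #|J|)%N = n.
  move=> mF /eqP tm; rewrite -[in LHS](mdeg_mesym1 J) -mdegD submK -?tm ?typ_le//.
  by move/dhomogP: hF => /(_ m mF).
split; last first.
  move=> nJ; rewrite /hJ big_seq_cond big1// => m /andP[mF tm].
  by have := deg m mF tm; lia.
split.
  rewrite /hJ big_seq_cond; apply: rpred_sum => m /andP[mF tm].
  apply: rpredZ; have <- : mdeg (m - mesym1 J) = (n - #|J|)%N.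
    by have := deg m mF tm; lia.
  by rewrite dhomogX.
have := lap_pJ J lF; rewrite pJE lap_e0_XJ//.
  have XN : ('X_[mesym1 J] : Q) != 0.
    apply/eqP => /(congr1 (mcoeff (mesym1 J)))/eqP.
    by rewrite mcoeffX eqxx mcoeff0 oner_eq0.
  by move=> /eqP; rewrite mulf_eq0 (negbTE XN) orbF => /eqP.
move=> i m iS; apply: ((supportedP _ _).1 (supp_hJ F JB)).
by rewrite in_faceN iS andbF.
Qed.

Lemma rho_pJ0 J F : ~~ (J \subset B) -> rho (pJ J F) = 0.
Proof.
move=> /subsetPn[i iJ]; rewrite in_B negb_and !negbK => /orP[/eqP i0|li].
  by rewrite pJE rhoM rho_XJ /xJ (bigD1 i)//= i0 xc0 mul0r mulr0.
rewrite /pJ big_pred0 ?rho0// => m; apply/negbTE; apply: contraTneq iJ => <-.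
by rewrite inE li.
Qed.

Lemma rho_split F : rho F = \sum_(J : {set idx} | J \subset B) rho (pJ J F).
Proof.
rewrite {1}[F]pJ_sum rho_sum (bigID (fun J : {set idx} => J \subset B))/=.
by rewrite [X in _ + X]big1 ?addr0// => J; exact: rho_pJ0.
Qed.

Lemma harm_Hn J n F : J \subset B -> (#|B :\: J| < d)%N -> harm e0 n F ->
  mulsp (xJ R J) (Hn (epsJ k gam J) #|J| n (B :\: J)) (rho (pJ J F)).
Proof.
move=> JB Sd hF; have [hh h0] := harm_hJ JB hF.
exists (rho (hJ J F)); rewrite pJE rhoM rho_XJ mulrC; split=> //.
rewrite /Hn; case: leqP => [Jn|/h0 ->]; last by rewrite rho0.
have S0 : ord0 \notin B :\: J by rewrite finset.in_setD in_B eqxx andbF.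
apply/(HspP Sd S0 (@eJ_gt J)); exists (hJ J F); split=> //; last exact: supp_hJ.
apply: harm_ext hh => i; rewrite /off0; case: eqVneq => [->|_]; last by left.
by right; apply: supp_hJ => //; rewrite in_faceN.
Qed.

Lemma harm_Vn n F : harm e0 n F ->
  mulsp (xJ R B) (Vn (epsJ k gam B) #|B| n) (rho (pJ B F)).
Proof.
move=> hF; have [hh h0] := harm_hJ (fintype.subxx B) hF.
exists (rho (hJ B F)); rewrite pJE rhoM rho_XJ mulrC; split=> //.
rewrite /Vn; case: leqP => [Jn|/h0 ->]; last by rewrite rho0.
have e1 i : i != ord0 -> -1 < epsJ k gam B i.
  by move=> i0; apply: eJ_gt; rewrite in_faceN finset.setDv i0 inE.
by apply/(VspP _ _ (ltnW d2) e1); exists (hJ B F).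
Qed.

(** X_i^n is the only monomial of type J left, and [harm_vtx] removes it. This settles the sets J
    whose space H is {0} by convention. *)
Lemma pJ_eq0 J n F i : harm e0 n F -> (0 < n)%N -> e0 i + n%:R != 0 ->
  (forall j, j != i -> ~~ low j && (j \notin J)) -> pJ J F = 0.
Proof.
move=> hF n_gt0 en nl; apply/mpolyP => m; rewrite mcoeff_pJ mcoeff0.
case: eqP => // tm; have [mF|/memN_msupp_eq0//] := boolP (m \in msupp F).
have m0 j : j != i -> m j = 0%N.
  by move=> /nl /andP[lj]; rewrite -tm inE lj /= -eqn0Ngt => /eqP.
have mn : mdeg m = n by have /dhomogP := hF.1; exact.
have -> : m = (U_(i) *+ n)%MM.
  apply/mnmP => j; rewrite mulmnE mnm1E eq_sym; have [->|ji] := eqVneq j i.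
    by rewrite mul1n -mn mdegE (bigD1 i)//= big1 ?addn0.
  by rewrite m0.
apply: harm_vtx hF n_gt0 en _ => j /nl /andP[lj _].
by left; exact: e0_nlow.
Qed.

Lemma UspP lam0 n p : (if (k <= d)%N then 0 < n else 1 < n)%N ->
  Usp k gam lam0 n p <-> rharm n p.
Proof.
move=> nk; have n_gt0 : (0 < n)%N by case: ifP nk => // _; exact: ltnW.
have BC := card_B d2 k1.
have SC J : J \subset B -> #|B :\: J| = (k - #|J|)%N.
  by move=> JB; rewrite cardsD (finset.setIidPr JB) BC.
have JC J : J \subset B -> J != B -> (#|J| < k)%N.
  by move=> JB JnB; rewrite -BC proper_card// finset.properEneq JnB.
rewrite /Usp gtn_eqF//; move: nk; case: ifPn => kd nk; last first.
  have kE : d.+1 = k by have := k_le k1; lia.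
  have VE : Vn (epsJ k gam B) d.+1 n = Vn (epsJ k gam B) #|B| n by rewrite BC kE.
  rewrite gtn_eqF// bigsum_cat VE; split.
    move=> [a [b [/bigsum1 Va [Sb ->]]]]; apply: rharmD; first exact: Vn_harm.
    apply: (bigsum_map_closed _ _ _ Sb); [exact: rharm0|exact: rharmD|].
    move=> J; rewrite mem_enum inE => /and3P[JB J2 _] q; apply: Hn_harm => //.
    by rewrite SC//; lia.
  move=> [F hF ->]; rewrite rho_split (bigD1 B)//=.
  rewrite (bigID (fun J : {set idx} => (1 < #|J|)%N))/= [X in _ + (_ + X)]big1 ?addr0.
    exists (rho (pJ B F)).
    exists (\sum_(J <- enum [set J : {set idx} | (J \subset B) && (1 < #|J| <= d)%N]) rho (pJ J F)).
    split; [|split].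
    - by apply/bigsum1; exact: harm_Vn.
    - apply: bigsum_map => J; rewrite mem_enum inE => /and3P[JB J2 _].
      by apply: harm_Hn => //; rewrite SC//; apply: leq_ltn_trans (leq_sub2l k J2) _; lia.
    - rewrite big_enum; congr (_ + _); apply: eq_bigl => J; rewrite inE.
      have [JB|//] := boolP (J \subset B); have [->|JnB] := eqVneq J B.
        by rewrite BC; lia.
      by have := JC J JB JnB; rewrite /=; move: #|J| => c; lia.
  move=> J /andP[/andP[JB _]]; rewrite -leqNgt => J1.
  (* A singleton leaves its own variable; for the empty set any index serves, and the dummy 0 is
     taken. *)
  have [i Ji] : exists i, J \subset [set i].
    have [->|/set0Pn[i iJ]] := eqVneq J finset.set0.
      by exists ord0; rewrite finset.sub0set.
    by exists i; apply/fintype.subsetP => j jJ; rewrite inE; apply/eqP/(card_le1_eqP J1).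
  have nl j : ~~ low j by rewrite /low_idx -kE; lia.
  rewrite (@pJ_eq0 J n F i)// ?rho0//.
    by rewrite e0_nlow// addrC subr_eq0 pnatr_eq1; lia.
  move=> j ji; rewrite nl /=; apply: contra ji => /(fintype.subsetP Ji).
  by rewrite inE.
have VE : Vn (epsJ k gam B) k n = Vn (epsJ k gam B) #|B| n by rewrite BC.
rewrite !bigsum_cat VE; split.
  move=> [a [b [/bigsum1 Va [+ ->]]]]; rewrite bigsum_cat => -[e [c [Se [/bigsum1 Hc ->]]]].
  apply: rharmD; first exact: Vn_harm.
  apply: rharmD.
    apply: (bigsum_map_closed _ _ _ Se); [exact: rharm0|exact: rharmD|].
    move=> J; rewrite mem_enum inE => /and3P[JB J1 _] q; apply: Hn_harm => //.
    by rewrite SC//; lia.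
  have [kd'|kd'] := ltnP k d.
    apply: (@Hn_harm finset.set0); rewrite ?finset.sub0set ?finset.setD0 ?BC//.
    exists c; rewrite /Hn cards0 subn0 leq0n ?finset.setD0; split=> //.
    by rewrite /xJ big_set0 mul1r.
  by move: Hc; rewrite /Hsp BC kd' => ->; exact: rharm0.
move=> [F hF ->]; rewrite rho_split (bigD1 B)//= (bigD1 finset.set0)/=; last first.
  by rewrite finset.sub0set eq_sym -finset.card_gt0 BC (k_gt0 k1).
exists (rho (pJ B F)).
exists (\sum_(J <- enum [set J : {set idx} | (J \subset B) && (0 < #|J| <= k.-1)%N]) rho (pJ J F)
   + rho (pJ finset.set0 F)).
split; [|split].
- by apply/bigsum1; exact: harm_Vn.
- apply/bigsum_cat; exists (\sum_(J <- enum [set J : {set idx} | (J \subset B) && (0 < #|J| <= k.-1)%N]) rho (pJ J F)), (rho (pJ finset.set0 F)); split; [|split=> //].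
    apply: bigsum_map => J; rewrite mem_enum inE => /and3P[JB J2 _].
    by apply: harm_Hn => //; rewrite SC//; apply: leq_ltn_trans (leq_sub2l k J2) _; lia.
  apply/bigsum1; have [kd'|kd'] := ltnP k d.
    have := @harm_Hn finset.set0 n F; rewrite finset.sub0set finset.setD0 BC => /(_ isT kd' hF).
    move=> [q [+ ->]]; rewrite /Hn cards0 subn0 leq0n.
    by rewrite /xJ big_set0 mul1r.
  (* For k = d the set B has d elements and the last summand is {0}. The part without degenerate
     variables is a multiple of X_1^n, and it vanishes because gamma_1 + n is not 0. *)
  rewrite /Hsp BC kd' (@pJ_eq0 finset.set0 n F (inord 1)) ?rho0//.
    have l1 := low1 d2 k1 kd; rewrite e0_low//; apply: lt0r_neq0; have := gam1 l1.
    have : 1 <= n%:R :> R by rewrite ler1n.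
    by move: (gam _) => g; lra.
  move=> j; rewrite inE andbT; apply: contraNN; rewrite /low_idx -val_eqE /= inordK//.
  by lia.
- rewrite big_enum [X in _ = _ + X]addrC; congr (_ + (_ + _)); apply: eq_bigl => J; rewrite inE.
  have [JB|//] := boolP (J \subset B); rewrite -card_gt0.
  have [->|JnB] := eqVneq J B; first by rewrite BC; have := k_gt0 k1; lia.
  by have := JC J JB JnB; rewrite /= andbC; move: #|J| => c; lia.
Qed.

End Splitting.

(** * Identification of the orthogonal spaces, degree one for k = d + 1, and part (iii) *)

Section MainTheorem.
Variables (R : realType) (d k : nat) (gam : nat -> R) (lam : R)
    (lami : nat -> R) (lamI : {set 'I_d.+2} -> R) (lam0 : nat -> R).
Hypotheses (d2 : (2 <= d)%N) (k1 : (1 <= k <= d.+1)%N).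
Hypothesis gam1 : forall i : nat, (1 <= i <= d.+1 - k)%N -> -1 < gam i.
Local Notation idx := 'I_d.+2.
Local Notation Q := {mpoly R[d.+2]}.
Local Notation poly := {mpoly R[d]}.
Local Notation low := (@low_idx d k).
Local Notation e0 := (@e0 R d k gam).
Local Notation ip := (@ipk R d k gam lam lami lamI lam0).
Local Notation ipU := (@ip_sum R d k gam lam lami lamI lam0).
Implicit Types (F G h : Q) (p q : poly) (i : idx).

Lemma tame_e0 : tame e0.
Proof.
have [kd|kd] := leqP k d; last first.
  by right=> i; apply: e0_nlow; rewrite /low_idx; lia.
left; rewrite (bigD1 (inord 1))//= ltr_pwDl//.
  by rewrite e0_low ?low1//; have := gam1 (low1 d2 k1 kd); lra.
apply: sumr_ge0 => i _; have [li|li] := boolP (low i).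
  by rewrite e0_low//; have := gam1 li; lra.
by rewrite e0_nlow// addNr.
Qed.

Lemma inPi0 p : inPi 0 p <-> p = (p@_0%MM)%:MP.
Proof.
split=> [|->]; last by rewrite /inPi msizeC; case: (_ != _).
by rewrite /inPi => /msize1_polyC.
Qed.

Lemma span1P p : Defs.span [:: 1] p <-> p = (p@_0%MM)%:MP.
Proof.
split=> [[c ->]|pE]; last first.
  by exists [:: p@_0%MM]; rewrite big_ord1 /= -mul_mpolyC mulr1.
by rewrite big_ord1 /= -mul_mpolyC mulr1 mcoeffC eqxx mulr1.
Qed.

Lemma OPn_harm n p : pos_cond k lam lami lamI lam0 -> (min_deg d k <= n)%N ->
  rharm k gam n p <-> OPn ip n p.
Proof.
move=> pos n0n; have -> : ip = ipU.
  by apply/funext => q; apply/funext => r; rewrite ipkE.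
apply: (good_OP (good_ipU d2 k1 gam1 pos) tame_e0) => // q qn.
have [_ _ b0 _] := good_ipU d2 k1 gam1 pos; rewrite lt_def b0 andbT.
by apply: contra qn => /eqP /(ipU_eq0 d2 k1 gam1 pos) ->.
Qed.

Section DegreeOne.
Hypothesis kd : (d < k)%N.
Hypothesis pos : pos_cond k lam lami lamI lam0.

Let S := \sum_(l < d.+1) lam0 l.
Let gen (j : 'I_d) : poly := 'X_j + (- lam0 j.+1 / S)%:MP.

Let S_gt0 : 0 < S.
Proof.
move: pos; rewrite /pos_cond leqNgt kd /= => -[_ l0 [j [jd lj]]].
have jd' : (j < d.+1)%N by [].
rewrite /S (bigD1 (Ordinal jd'))//= ltr_pwDl// sumr_ge0// => i _.
by apply: l0; rewrite -ltnS.
Qed.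

Lemma span_gen p :
  Defs.span [seq xc R (inord j : idx) + (- lam0 j / S)%:MP | j <- iota 1 d] p <->
  exists c : 'I_d -> R, p = \sum_j c j *: gen j.
Proof.
have nthE (j : 'I_d) :
    [seq xc R (inord j : idx) + (- lam0 j / S)%:MP | j <- iota 1 d]`_j = gen j.
  rewrite (nth_map 0%N) ?size_iota// nth_iota// add1n /gen.
  by rewrite -[inord _]/(ix j) xc_ix.
rewrite /Defs.span size_map size_iota; split=> [[c ->]|[c ->]].
  by exists (fun j : 'I_d => c`_j); apply: eq_bigr => j _; rewrite nthE.
exists [seq c j | j <- enum 'I_d]; apply: eq_bigr => j _; rewrite nthE.
by rewrite (nth_map j) ?size_enum_ord// nth_ord_enum.
Qed.

Let e0N i : e0 i = -1.
Proof. by apply: e0_nlow; rewrite /low_idx; lia. Qed.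

Let genF (j : 'I_d) : Q := 'X_(ix j) - (lam0 j.+1 / S) *: sX R d.+2.

Let genE j : gen j = rho (genF j).
Proof. by rewrite rhoB rhoZ rhoXU xc_ix rho_sX /gen mulNr mpolyCN -mul_mpolyC mulr1. Qed.

Let genF_harm j : harm e0 1 (genF j).
Proof.
have hF : genF j \is 1.-homog.
  by apply: rpredB; [exact: dhomogU|apply: rpredZ; exact: sX_homog].
split=> //; rewrite /lap big1// => i _; rewrite e0N addNr scale0r addr0.
by rewrite (mderiv_homog0 i (mderiv_homog i hF)) mulr0.
Qed.

(** The derivative terms vanish since both lifts are harmonic, of degrees 1 and 0. The vertex terms
    add up to c times lambda - S lambda / S, with lambda the weight of the vertex e_{j+1}: this is
    the origin of the constants c_j. *)
Let gen_orth j c : ipU (gen j) c%:MP = 0.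
Proof.
have hC : harm e0 0 (c%:MP : Q).
  have h : (c%:MP : Q) \is 0.-homog by rewrite -[c%:MP]mulr1 mul_mpolyC rpredZ// dhomog1.
  by split=> //; exact: lap_homog0.
have T0 : Tlast k gam lam lam0 (gen j) c%:MP = 0.
  have dk : (k < d)%N = false by lia.
  rewrite /Tlast dk (gtn_eqF kd) /ev.
  have E (l : 'I_d.+1) : lam0 l * ((gen j).@[fun t : 'I_d => ept R d l ord0 t] *
      c%:MP.@[fun t : 'I_d => ept R d l ord0 t]) =
      (lam0 l * (j.+1 == l)%:R) * c + lam0 l * (- lam0 j.+1 / S * c).
    by rewrite /gen mevalD mevalXU !mevalC mxE; ring.
  rewrite (eq_bigr _ (fun l _ => E l)) big_split /= -!mulr_suml -/S.
  have jd : (j.+1 < d.+1)%N by rewrite ltnS.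
  rewrite (bigD1 (Ordinal jd))//= eqxx big1 => [|l lj]; last first.
    suff -> : (j.+1 == l) = false by rewrite mulr0.
    by apply/negbTE; rewrite eq_sym; exact: lj.
  have := S_gt0; move: (S) => s s0; rewrite /= addr0 mulr1.
  by field; exact: lt0r_neq0.
rewrite /ip_sum T0 addr0 [X in _ + X]big1 => [|i]; last first.
  by rewrite /low_idx; lia.
rewrite addr0 big1// => I /andP[Imk /andP[I1 _]].
have [_ _ _ o] := good_TI d2 k1 gam1 Imk I1 0.
by rewrite genE -(rhoC d) (o 1%N 0%N) ?mulr0.
Qed.

Lemma UspP1 p : Usp k gam lam0 1 p <-> OPn ip 1 p.
Proof.
have -> : ip = ipU.
  by apply/funext => q; apply/funext => r; rewrite ipkE.
rewrite /Usp /= leqNgt kd /=; have [bC bl b0 _] := good_ipU d2 k1 gam1 pos.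
have cE q : (msize q <= 1)%N -> q = (q@_0%MM)%:MP by exact: msize1_polyC.
apply: OP_char => //.
- move=> q qn; rewrite lt_def b0 andbT.
  by apply: contra qn => /eqP /(ipU_eq0 d2 k1 gam1 pos) ->.
- move=> q /span_gen[c ->]; under eq_bigr => j _ do rewrite genE -rhoZ.
  rewrite -rho_sum; apply: inPi_rho; apply: rpred_sum => j _; apply: rpredZ.
  exact: (genF_harm j).1.
(* h has the same linear part as q, so q - h is constant. *)
- move=> q q1; pose h := \sum_j q@_U_(j) *: gen j.
  exists h, (q - h); split; [by apply/span_gen; exists (fun j => q@_U_(j))| |by rewrite addrC subrK].
  have hE : h = \sum_j q@_U_(j) *: 'X_j + (\sum_j q@_U_(j) * (- lam0 j.+1 / S))%:MP.
    rewrite rmorph_sum -big_split /=; apply: eq_bigr => j _.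
    by rewrite /gen scalerDr -!mul_mpolyC -mpolyCM.
  suff -> : q - h = (q@_0%MM - \sum_j q@_U_(j) * (- lam0 j.+1 / S))%:MP.
    by rewrite msizeC; case: (_ != _).
  rewrite hE mpolyCB opprD addrA; congr (_ - _); apply/eqP; rewrite subr_eq; apply/eqP.
  apply/mpolyP => m; rewrite mcoeffD mcoeffC raddf_sum /=.
  have cU j : (q@_U_(j) *: 'X_j)@_m = if U_(j)%MM == m then q@_m else 0.
    by rewrite mcoeffZ mcoeffX; case: eqP => [->|_]; rewrite ?mulr1 ?mulr0.
  rewrite (eq_bigr _ (fun j _ => cU j)).
  have [->|m0] := eqVneq m 0%MM.
    rewrite ?eqxx mulr1 big1 ?addr0// => j _; case: eqP => // /(congr1 mdeg).
    by rewrite mdeg1 mdeg0.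
  rewrite ?(eq_sym 0%MM) ?(negbTE m0) mulr0 add0r; have [mq|/memN_msupp_eq0 ->] := boolP (m \in msupp q); last first.
    by rewrite big1// => j _; rewrite if_same.
  have /mdeg1P[j /eqP mE] : mdeg m == 1%N.
    rewrite eqn_leq -ltnS (leq_trans (msize_mdeg_lt mq) q1) lt0n mdeg_eq0.
    exact: m0.
  rewrite (bigD1 j)//= mE eqxx big1 ?addr0// => l lj.
  case: eqP => // /mnmP/(_ l)/eqP; rewrite !mnm1E eqxx [j == l]eq_sym (negbTE lj) //.
- move=> h q /span_gen[c ->] /cE ->.
  elim/big_ind: _ => [|a b ha hb|j _]; first exact: form0l.
    by rewrite formDl// ha hb addr0.
  by have := bl (c j) (gen j) 0 (q@_0%MM)%:MP; rewrite addr0 gen_orth form0l// mulr0 addr0.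
Qed.

End DegreeOne.

Lemma Usp_OPn n p : pos_cond k lam lami lamI lam0 ->
  Usp k gam lam0 n p <-> OPn ip n p.
Proof.
move=> pos; case: n => [|n].
  (* In degree 0 orthogonality is tested against the zero polynomial only, and both spaces are the
     constants. *)
  apply: (iff_trans (span1P p)); apply: (iff_trans (iff_sym (inPi0 p))).
  split=> [h|[]//]; split=> // q; rewrite leqn0 msize_poly_eq0 => /eqP ->.
  rewrite ipkE//; have [bC bl _ _] := good_ipU d2 k1 gam1 pos.
  by rewrite bC form0l.
have [nk|nk] := boolP (if (k <= d)%N then 0 < n.+1 else 1 < n.+1)%N.
  apply: (iff_trans (UspP d2 k1 gam1 lam0 p nk)); apply: OPn_harm => //.
  by move: nk; rewrite /min_deg; case: ifP.
move: nk; case: ifPn => //; rewrite -ltnNge ltnS -leqNgt leqn0 => kd /eqP ->.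
exact: UspP1.
Qed.

(** p has the factor x_{d+1} and so vanishes on |x| = 1, where the last term lives. The gradient
    terms add up to a single moment, which Green's formula for q and one integration by parts in
    X_{d+1} reduce to 0. *)
Lemma orth_k1 n p q : k = 1%N ->
  mulsp (@xc R d ord_max) (Vn (@epsJ R d k gam (Bset d k)) k n) p ->
  Hsp (@epsJ R d k gam finset.set0) n (Bset d k) q ->
  ip p q = 0.
Proof.
move=> kE [v [+ ->]] Hq;
rewrite ipkE// /Vn; case: ifPn => [n_gt0 [vn _]|_ ->]; last first.
  (* For n = 0 the space [Vn] is {0}, so p = 0 and linearity suffices. *)
  rewrite mulr0 /ip_sum [X in X + _ + _]big1 => [|I /andP[_]]; last by rewrite kE; lia.
  rewrite big1 => [|i li]; last first.
    by have [_ bl _ _] := good_Ti d2 k1 gam1 li 0; rewrite (form0l _ bl) mulr0.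
  have kd : (k < d)%N by rewrite kE.
  have [_ bl _ _] := good_TL d2 k1 gam1 (ltnW kd) 0.
  by rewrite /Tlast kd (form0l _ bl) mulr0 !addr0.
have {n_gt0} n_gt0 : (0 < n)%N by rewrite kE in n_gt0.
have {}vn : inPi n.-1 v by move: vn; rewrite {1}kE subn1.
case: n n_gt0 vn Hq => // n _ vn Hq.
have [h hh <-] := homogenize vn.
have BC := card_B d2 k1; rewrite [RHS]kE in BC.
have B0 : ord0 \notin Bset d k by rewrite in_B// eqxx.
have BE : faceN (Bset d k) = faceN (Bset d k :\: finset.set0) by rewrite finset.setD0.
have eB i : i \in faceN (Bset d k) -> -1 < @epsJ R d k gam finset.set0 i.
  by rewrite BE => /(eJ_gt d2 k1 gam1).
have BC1 : (#|Bset d k| < d)%N by rewrite BC.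
have /(HspP BC1 B0 eB)[G [hG sG ->]] := Hq.
have lowE i : low i = (i != ord0) && (i != ord_max).
  rewrite /low_idx kE -!val_eqE /=; have := ltn_ord i; lia.
have G0 i : ~~ low i -> G^`M(i) = 0.
  move=> li; apply: sG; rewrite in_faceN in_B// li andbT negb_and negbK.
  by case: (i == ord0).
(* The weight x^gamma does not involve x_{d+1}: its parameter there is 0, in contrast to -1 in
   [e0]. *)
pose e1 i := if i == ord_max then 0 else e0 i.
have hG1 : harm e1 n.+1 G.
  apply: harm_ext hG => i; have [li|li] := boolP (low i); last by right; exact: G0.
  left; have [_ /negbTE iM _] := low_neq d2 k1 li.
  by rewrite /e1 iM e0_low// -(eJ_low gam finset.set0 li).
have mk0 : Defs.mkset d k = finset.set0.
  by apply/eqP; rewrite -cards_eq0 card_mk// kE.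
have NE i : (i \in faceN (Defs.mkset d k)) = (i != ord0).
  by rewrite in_faceN mk0 inE andbT.
have eN i : i \in faceN (Defs.mkset d k) -> -1 < e1 i.
  rewrite NE /e1 => i0; case: eqVneq => [_|iM]; first by lra.
  have li : low i by rewrite lowE i0.
  by rewrite e0_low// gam1.
have eN' i : i \notin faceN (Defs.mkset d k) -> e1 i = -1.
  by rewrite NE negbK => /eqP ->; rewrite /e1 /= e0_nlow.
have [K [K0 hK]] := face_chartE (face_mk0 d2 k1) eN eN'.
have WE x : xgam k gam x = weight (faceN (Defs.mkset d k)) e1 x.
  rewrite xgamE weight_prod; apply: eq_bigr => i _; rewrite NE lowE /e1.
  case: eqVneq => //= i0; case: eqVneq => /= [_|iM]; first by rewrite powRr0.
  by rewrite e0_low// lowE i0.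
pose P := 'X_ord_max * h.
have PE : xc R ord_max * rho h = rho P by rewrite rhoM rhoXU.
have TiE i : low i -> Ti k gam i (rho P) (rho G) =
    K * Lam e1 ('X_i * (Dd i ord_max P * Dd i ord_max G)).
  move=> li; have [i0 iM _] := low_neq d2 k1 li.
  rewrite /Ti /faceform; apply: (hK _ _ _).1 => x _.
  by rewrite !pd_rho// !ev_rho !mevalM mevalXU /Wi WE; ring.
have DdG i : low i -> Dd i ord_max G = G^`M(i).
  by move=> _; rewrite /Dd (G0 ord_max) ?subr0// lowE eqxx andbF.
pose T := \sum_(i | low i) 'X_i * (Dd i ord_max P * Dd i ord_max G).
have Th : T \is (1 + (n + n)).-homog.
  have hP : P \is n.+1.-homog by rewrite -[n.+1]add1n dhomogM// dhomogU.
  have hD (F : Q) i : F \is n.+1.-homog -> Dd i ord_max F \is n.-homog.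
    by move=> hF; apply: rpredB; exact: mderiv_homog.
  apply: rpred_sum => i _; apply: dhomogM; first exact: dhomogU.
  by apply: dhomogM; [exact: hD|exact/hD/hG.1].
have PT : Phi e1 T = 0.
  have Gi := Phi_green e1 G P.
  rewrite hG1.2 mul0r /Phi linform0 -/(Phi e1) in Gi.
  (* G is free of X_{d+1}, so D_i G is a plain partial derivative; the terms of D_i P that
     differentiate X_{d+1} collect into the Euler operator of G. *)
  have TE : T = \sum_i 'X_i * G^`M(i) * P^`M(i)
      - (h + 'X_ord_max * h^`M(ord_max)) * euler G.
    rewrite /euler mulr_sumr -sumrB /T big_mkcond; apply: eq_bigr => i _.
    case: ifPn => li; last by rewrite G0// !(mulr0, mul0r) subrr.
    have [_ iM _] := low_neq d2 k1 li.
    rewrite DdG// /Dd /P !mderivM !mderivXU eqxx eq_sym (negbTE iM).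
    by rewrite mpolyC0 mpolyC1; ring.
  have eG := euler_homog hG.1.
  have PG : Phi e1 (\sum_i 'X_i * G^`M(i) * P^`M(i)) = Phi e1 (P * euler G).
    by apply/eqP; rewrite eq_sym -subr_eq0 -Gi.
  rewrite TE /Phi linformB -!/(Phi e1 _) PG eG -!scalerAr /Phi !linformZ -mulrBr -!/(Phi e1 _).
  (* With parameter 0 at d + 1, integration by parts says that the moments of (h + X_{d+1} d_{d+1}
     h) G and of P G coincide; these are the two terms left, each multiplied by the degree of G. *)
  have := Phi_ibp e1 ord_max (h * G).
  rewrite mderivM (G0 ord_max) ?lowE ?eqxx ?andbF// mulr0 addr0 /e1 eqxx add0r scale1r -/e1.
  move=> ibp; apply/eqP; rewrite mulf_eq0; apply/orP; right; rewrite subr_eq0; apply/eqP.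
  by rewrite /P -mulrA -ibp; congr (Phi _ _); ring.
rewrite PE /ip_sum [X in X + _ + _]big1 => [|I /andP[_]]; last by rewrite kE; lia.
rewrite add0r (eq_bigr (fun i => K * Lam e1 ('X_i * (Dd i ord_max P * Dd i ord_max G)))).
  rewrite -mulr_sumr -linform_sum -[linform _ _]/(Lam e1 T) (Lam_homog e1 Th) PT mul0r mulr0 add0r.
  have kd : (k < d)%N by rewrite kE.
  rewrite /Tlast kd (TL_vanish d2 k1 gam1 (ltnW kd)) ?mulr0// => x [_ xB].
  rewrite ev_rho mevalM mevalXU xB ?mul0r//.
  by rewrite in_faceN in_setU1 eqxx.
by move=> i li; rewrite TiE// /ci kE eqxx mul1r.
Qed.

End MainTheorem.

Theorem theorem3p7 (R : realType) (d k : nat) (gam : nat -> R) (lam : R)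
    (lami : nat -> R) (lamI : {set 'I_d.+2} -> R) (lam0 : nat -> R) :
  (2 <= d)%N -> (1 <= k <= d.+1)%N ->
  (forall i : nat, (1 <= i <= d.+1 - k)%N -> -1 < gam i) ->
  [/\ (* (i) *)
      pos_cond k lam lami lamI lam0 ->
        is_inner_product (ipk k gam lam lami lamI lam0),
      (* (ii) *)
      pos_cond k lam lami lamI lam0 ->
        forall (n : nat) (p : {mpoly R[d]}),
          Usp k gam lam0 n p <-> OPn (ipk k gam lam lami lamI lam0) n p &
      (* (iii) *)
      k = 1%N -> 0 <= lam ->
        forall (n : nat) (p q : {mpoly R[d]}),
          mulsp (@xc R d ord_max) (Vn (@epsJ R d k gam (Bset d k)) k n) p ->
          Hsp (@epsJ R d k gam finset.set0) n (Bset d k) q ->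
          ipk k gam lam lami lamI lam0 p q = 0].
Proof.
move=> d2 k1 gam1; split.
- by move=> pos; exact: (ip_inner d2 k1 gam1 pos).
- by move=> pos n p; exact: (Usp_OPn d2 k1 gam1 n p pos).
- by move=> kE _ n p q; exact: orth_k1.
Qed.
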